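(* Let $n\ge 2$ be a fixed integer. Let $\Omega_n(Q,I)$ be the number of algebraic integers $\alpha\in I$ of degree $n$ and height $H(\alpha)\le Q$, and let $\Phi_{n-1}(Q,I)$ be the number of algebraic numbers $\alpha\in I$ of degree $n-1$ and height $H(\alpha)\le Q$. For any fixed finite interval $I\subset\mathbb{R}$ the following limit equality is true: \[ \lim_{Q\to\infty}\frac{\Omega_n(Q,I)}{\Phi_{n-1}(Q,I)}=2\zeta(n), \] where $\zeta$ is the Riemann zeta function. However, if $I$ is infinite or may depend on $Q$, this equality generally does not hold. In particular, \[ \lim_{Q\to\infty}\frac{\Omega_n(Q,\mathbb{R})}{\Phi_{n-1}(Q,\mathbb{R})}=2\zeta(n)\left(1+\frac{2^n}{\int_{\mathbb{R}}\phi_{n-1}(t)\,dt}\right). \]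
   Context: The height of a polynomial $p(x)=a_nx^n+\dots+a_0$ is $H(p)=\max_{0\le i\le n}|a_i|$. The minimal polynomial of an algebraic number $\alpha\in\mathbb{C}$ is the nonzero polynomial of minimal degree with coprime integer coefficients and positive leading coefficient vanishing at $\alpha$; the degree and height $H(\alpha)$ of $\alpha$ are those of its minimal polynomial. An algebraic integer is an algebraic number whose minimal polynomial is monic. For an integer $m\ge 1$ and $t\in\mathbb{R}$, \[ \phi_m(t)=\int_{G_m(t)}\left|\sum_{k=1}^m k p_k t^{k-1}\right|dp_1\dots dp_m, \] \[ G_m(t)=\left\{(p_1,\dots,p_m)\in\mathbb{R}^m:\ \max_{1\le k\le m}|p_k|\le 1,\ \left|\sum_{k=1}^m p_kt^k\right|\le 1\right\}. \] *)

(* Defs.v *)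
From HB Require Import structures.
From mathcomp Require Import all_boot all_order all_algebra finmap.
From mathcomp Require Import all_classical all_reals all_analysis.

Set Implicit Arguments.
Unset Strict Implicit.
Unset Printing Implicit Defensive.

Import Order.TTheory GRing.Theory Num.Theory.
Import numFieldNormedType.Exports.

Local Open Scope classical_set_scope.
Local Open Scope ring_scope.

Section algebraic_numbers.
Context {R : realType}.
Implicit Types (p q : {poly int}) (a Q : R) (I : set R) (d n : nat).

Definition degree p : nat := (size p).-1.

Definition height p : nat := (\max_(i < size p) `|(p`_i)%R|)%N.

Definition vanishes_at p a : bool := root (map_poly intr p) a.

Definition is_minpoly a p : Prop :=
  [/\ p != 0, vanishes_at p a,
      forall q, q != 0 -> vanishes_at q a -> (degree p <= degree q)%N,
      (\big[gcdn/0]_(i < size p) `|(p`_i)%R|)%N = 1%N &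
      0 < lead_coef p].

Definition algebraic_numbers d Q I : set R :=
  [set a | I a /\
    exists p, [/\ is_minpoly a p, degree p = d & (height p)%:R <= Q]].

Definition algebraic_integers d Q I : set R :=
  [set a | I a /\
    exists p, [/\ is_minpoly a p, p \is monic, degree p = d &
                  (height p)%:R <= Q]].

(* The sets counted are finite: finitely many integer polynomials have given
   degree and bounded height, and each has finitely many roots.  So the default
   value of [fset_set] on infinite sets plays no role. *)
Definition Omega n Q I : nat := #|` fset_set (algebraic_integers n Q I) |%fset.

Definition Phi n Q I : nat := #|` fset_set (algebraic_numbers n Q I) |%fset.

Definition count_ratio n Q I : R :=
  (Omega n Q I)%:R / (Phi n.-1 Q I)%:R.

End algebraic_numbers.

(* [riemannR s] is the sequence k |-> 1 / (k + 1) ^ s. *)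
Definition zeta {R : realType} (s : R) : R := limn (series (riemannR s)).

Section lebesgue_tuple.
Context {R : realType}.
Local Notation T := (measurableTypeR R).
Local Open Scope ereal_scope.

Definition tcons n (x : T * n.-tuple T) : n.+1.-tuple T := [tuple of x.1 :: x.2].

Lemma measurable_tcons n : measurable_fun [set: T * n.-tuple T] (@tcons n).
Proof. exact: measurable_cons. Qed.

(* Lebesgue measure on R^n: the image of the n-fold product of the Lebesgue
   measure on R under the identification of R * R^n with R^(n+1). *)
Fixpoint lebesgue_tuple n : set (n.-tuple T) -> \bar R :=
  match n with
  | 0 => dirac [tuple]
  | n'.+1 => pushforward
               ((@lebesgue_measure R : set T -> \bar R) \x @lebesgue_tuple n')
               (@tcons n')
  end.

Let is_sfm n (m : set (n.-tuple T) -> \bar R) :=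
  [/\ m set0 = 0, (forall A, 0 <= m A), semi_sigma_additive m &
      sigma_finite [set: n.-tuple T] m].

Let is_sfm_pushforward n
    (m : {measure set (T * n.-tuple T)%type -> \bar R}) :
  sigma_finite setT m -> is_sfm (pushforward m (@tcons n)).
Proof.
move=> [F FT Ffin]; have mtc := @measurable_tcons n.
have pre A : measurable A -> measurable (@tcons n @^-1` A).
  by move=> mA; rewrite -[X in measurable X]setTI; exact: mtc.
split.
- by rewrite /pushforward preimage_set0 measure0.
- by move=> A; exact: measure_ge0.
- move=> {FT Ffin} {}F mF tF mUF; rewrite /pushforward preimage_bigcup.
  apply: measure_semi_sigma_additive.
  + by move=> k; exact: pre.
  + apply/trivIsetP => /= i j _ _ ij; rewrite -preimage_setI.
    by move/trivIsetP : tF => /(_ _ _ _ _ ij) ->//; rewrite preimage_set0.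
  + by rewrite -preimage_bigcup; exact: pre.
- pose tuncons (p : n.+1.-tuple T) : T * n.-tuple T :=
    (tnth p ord0, [tuple of behead p]).
  have mtu : measurable_fun [set: n.+1.-tuple T] tuncons.
    apply: measurable_fun_pair => /=; first exact: measurable_tnth.
    exact: measurable_behead.
  have tuK : cancel (@tcons n) tuncons.
    by move=> [x v]; rewrite /tuncons; congr pair; exact: val_inj.
  exists (fun k => tuncons @^-1` F k).
    by rewrite -preimage_bigcup -FT preimage_setT.
  move=> k; split.
    by rewrite -[X in measurable X]setTI; apply: mtu => //; exact: (Ffin k).1.
  rewrite /pushforward -comp_preimage (_ : tuncons \o @tcons n = id).
    by rewrite preimage_id; exact: (Ffin k).2.
  exact/funext.
Qed.

Let is_sfm_step n (nu : {sigma_finite_measure set (n.-tuple T) -> \bar R}) :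
  is_sfm (pushforward
    ((@lebesgue_measure R : set T -> \bar R) \x nu) (@tcons n)).
Proof.
pose l : {sigma_finite_measure set T -> \bar R} := @lebesgue_measure R.
apply: (@is_sfm_pushforward n (l \x nu)).
have /sigma_finiteP[F [TF ndF Foo]] := sigma_finiteT l.
have /sigma_finiteP[G [TG ndG Goo]] := sigma_finiteT nu.
exists (fun k => F k `*` G k).
  rewrite -setXTT TF TG predeqE => -[x y]; split; last first.
    by move=> [k _ []/= ? ?]; split; exists k.
  move=> [/= [i _ Fix] [k _ Gky]]; exists (maxn i k) => //; split.
    by move: x Fix; exact/subsetPset/ndF/leq_maxl.
  by move: y Gky; exact/subsetPset/ndG/leq_maxr.
move=> k; have [? ?] := Foo k; have [? ?] := Goo k.
split; first exact: measurableX.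
rewrite [X in X < _](_ : _ = l (F k) * nu (G k)); last exact: product_measure1E.
by rewrite lte_mul_pinfty// ge0_fin_numE.
Qed.

Let is_sfm_tuple n : is_sfm (@lebesgue_tuple n).
Proof.
elim: n => [|n [m0 mge0 msadd msf]].
  split=> /=; first exact: measure0.
  - by move=> A; exact: measure_ge0.
  - exact: measure_semi_sigma_additive.
  - by apply: fin_num_fun_sigma_finite; [rewrite measure0|exact: fin_num_measure].
pose h1 := isMeasure.Build _ _ _ (@lebesgue_tuple n) m0 mge0 msadd.
pose mu : {measure set (n.-tuple T) -> \bar R} := HB.pack (@lebesgue_tuple n) h1.
pose h2 := Measure_isSigmaFinite.Build _ _ _ mu msf.
pose nu : {sigma_finite_measure set (n.-tuple T) -> \bar R} :=
  HB.pack (@lebesgue_tuple n) h1 h2.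
exact: (is_sfm_step nu).
Qed.

Let lebesgue_tuple0 n : @lebesgue_tuple n set0 = 0.
Proof. by case: (is_sfm_tuple n). Qed.

Let lebesgue_tuple_ge0 n A : 0 <= @lebesgue_tuple n A.
Proof. by case: (is_sfm_tuple n). Qed.

Let lebesgue_tuple_sigma_additive n : semi_sigma_additive (@lebesgue_tuple n).
Proof. by case: (is_sfm_tuple n). Qed.

Let lebesgue_tuple_sigma_finite n :
  sigma_finite [set: n.-tuple T] (@lebesgue_tuple n).
Proof. by case: (is_sfm_tuple n). Qed.

HB.instance Definition _ n := isMeasure.Build _ _ _ (@lebesgue_tuple n)
  (@lebesgue_tuple0 n) (@lebesgue_tuple_ge0 n) (@lebesgue_tuple_sigma_additive n).

HB.instance Definition _ n := Measure_isSigmaFinite.Build _ _ _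
  (@lebesgue_tuple n) (@lebesgue_tuple_sigma_finite n).

Lemma lebesgue_tuple_box n (A : 'I_n -> set T) :
  (forall i, measurable (A i)) ->
  lebesgue_tuple [set p : n.-tuple T | forall i, A i (tnth p i)] =
  \prod_(i < n) (lebesgue_measure : set T -> \bar R) (A i).
Proof.
elim: n A => [|n IHn] A mA.
  by rewrite big_ord0 /= diracE mem_set// => -[].
rewrite big_ord_recl -IHn; last by move=> i; exact: mA.
rewrite /= /pushforward -product_measure1E//.
- congr (_ \x _)%E; apply/seteqP; split=> [[x v]/= Av|[x v]/= [A0 Av] i].
    split; first exact: (Av ord0).
    by move=> i; have := Av (lift ord0 i); rewrite tnthS.
  case: (unliftP ord0 i) => [j|] ->; last exact: A0.
  by rewrite tnthS; exact: Av.
- rewrite (_ : [set p | _] =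
    \bigcap_(i in [set: 'I_n]) (fun p : n.-tuple T => tnth p i) @^-1` A (lift ord0 i)).
    apply: fin_bigcap_measurable => // i _.
    by rewrite -[X in measurable X]setTI; apply: measurable_tnth.
  by apply/seteqP; split=> [p Ap i _|p Ap i]; [exact: Ap|exact: (Ap i I)].
Qed.

End lebesgue_tuple.

Section phi.
Context {R : realType}.
Local Notation T := (measurableTypeR R).

(* The index k : 'I_m is 0-based, so [tnth p k] is the coordinate p_(k+1). *)
Definition G m (t : R) : set (m.-tuple T) :=
  [set p | (forall k : 'I_m, `|tnth p k : R| <= 1) /\
           `|\sum_(k < m) (tnth p k : R) * t ^+ k.+1| <= 1].

Definition phi m (t : R) : \bar R :=
  (\int[@lebesgue_tuple R m]_(p in @G m t)
     `|\sum_(k < m) k.+1%:R * (tnth p k : R) * t ^+ k|%:E)%E.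

End phi.

(* Main.v *)
Require Import Defs.
From mathcomp Require Import all_boot all_order all_algebra finmap.
From mathcomp Require Import all_classical all_reals all_analysis.
From mathcomp Require Import ring lra zify qpoly measurable_realfun.
Import Order.TTheory GRing.Theory Num.Theory.
Import numFieldNormedType.Exports.
Local Open Scope classical_set_scope.
Local Open Scope ring_scope.

(**
Fix m = n - 1.  Up to a proportion of polynomials that tends to 0, an integer
polynomial is irreducible: by the inequality H(A) H(B) <= C H(A B), the number
of products of height at most Q is O(Q^m log Q).  So both counts are sums, over
the integer polynomials p of degree at most m and height at most Q, of numbers
of roots in I: of p itself, restricted to primitive p, for the algebraic numbers
(each being counted for p and - p), and of X^n + p for the algebraic integers.

For I bounded, fix all the coefficients but the constant one and write f for the
polynomial without its constant term.  The roots in I obtained when the constant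
term varies are the points of I where f takes an integer value in [-Q, Q], and
their number is the integral over I of |f'| 1_(|f| <= Q), up to O(1).
Rescaling by Q turns the sum over the other coefficients into a Riemann sum: both
with and without the term X^n the total is asymptotic to Q^n times the integral
of phi_m over I.  Sorting polynomials by their content d replaces Q by Q / d and
shows that the primitive ones contribute the proportion 1 / zeta(n).

On the real line, few polynomials of degree m have a root with |t| > T, while
all but few of the X^n + p have exactly one such root, close to minus the
coefficient of X^m.  These roots add (2 Q)^n to the count of algebraic integers.
*)

Set Implicit Arguments.
Unset Strict Implicit.
Unset Printing Implicit Defensive.

(** Both families are instances of [gensum c m K I], with [c = 0] or [c = 1]. Rescaling by K turns
    the leading coefficient into [c / K], which tends to 0; hence the common density on bounded
    intervals. The 2 in the limit is the choice of sign of a primitive polynomial, which a monic one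
    does not have. The obstacles are these. Products of monic polynomials must be counted without
    their leading terms, since otherwise the bound is Q^(m+1) log Q, larger than the main term. The
    integrand |f'| 1_(|f| <= 1) is discontinuous in the coefficients, so the Riemann sums are read
    as integrals of step functions and handled by dominated convergence, for each f off a finite set
    of t. The sum over contents is inverted by a contraction argument rather than by the Moebius
    function. On the real line the limits in Q and in the cut-off have to be exchanged, so the tail
    bounds must be uniform in Q. Dividing needs a positive integral of phi; its finiteness over R
    follows from the trivial bound on the number of roots. The interval depending on Q contains
    every root counted, so it reproduces the limit of the real line. *)

Local Notation pZtoQ := (map_poly (intr : int -> rat)).

(** * Heights of products of polynomials *)

Lemma coef_maxE (F : realFieldType) (p : {poly F}) :
  exists i, forall j, `|p`_j| <= `|p`_i|.
Proof.
case: (arg_maxP (fun i : 'I_(size p).+1 => `|p`_i|) (erefl : predT ord0)) => /= i _ ip.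
exists i => j; have [jp|pj] := ltnP j (size p); last by rewrite nth_default// normr0.
by have := ip (inord j) isT; rewrite inordK// ltnS ltnW.
Qed.

Lemma size_drop_top (F : nzRingType) (p : {poly F}) n :
  (size p <= n.+1)%N -> (size (p - p`_n *: 'X^n)%R <= n)%N.
Proof.
move=> pn; apply/leq_sizeP => j; rewrite leq_eqVlt => /predU1P[<-|nj].
  by rewrite coefB coefZ coefXn eqxx mulr1 subrr.
rewrite coefB coefZ coefXn gtn_eqF// mulr0 subr0.
by rewrite nth_default// (leq_trans pn).
Qed.

Lemma coefM_top (F : nzRingType) (p q : {poly F}) m n :
  (size p <= m.+1)%N -> (size q <= n.+1)%N -> (p * q)`_(m + n) = p`_m * q`_n.
Proof.
move=> pm qn; have mlt : (m < (m + n).+1)%N by rewrite ltnS leq_addr.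
rewrite coefM (bigD1 (Ordinal mlt))//= addKn big1 ?addr0// => i.
rewrite -val_eqE/= neq_ltn => /orP[im|mi].
  by rewrite [q`__]nth_default ?mulr0// (leq_trans qn)// ltn_subRL ltn_add2r.
by rewrite nth_default ?mul0r// (leq_trans pm).
Qed.

Lemma coefMnX_le (F : realFieldType) (p : {poly F}) (M x : F) n k :
  (forall i, `|p`_i| <= M) -> `|(x *: 'X^n * p)`_k| <= `|x| * M.
Proof.
move=> pM; have M0 : 0 <= M by exact: le_trans (pM 0%N).
rewrite -scalerAl coefZ coefXnM; case: ifP => _.
  by rewrite mulr0 normr0 mulr_ge0.
by rewrite normrM ler_wpM2l.
Qed.

Lemma gelfond_lead (F : realFieldType) (d : F) b : 0 < d ->
  exists2 c : F, 0 < c & forall (p q : {poly F}) a (M h : F),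
    (size p <= a.+1)%N -> (size q <= b)%N -> (forall i, `|p`_i| <= M) ->
    d * M <= `|p`_a| -> 0 <= h ->
    (forall k, `|(p * q)`_k| <= h) -> forall j, M * `|q`_j| <= c * h.
Proof.
move=> d0; elim: b => [|b [c c0 IH]].
  exists 1 => // p q a M h _; rewrite leqn0 size_poly_eq0 => /eqP -> _ _ h0 _ j.
  by rewrite coef0 normr0 mulr0 mul1r.
exists (d^-1 + c * (1 + d^-1)).
  by rewrite addr_gt0 ?invr_gt0// mulr_gt0// addr_gt0// invr_gt0.
move=> p q a M h pa qb pM dM h0 pqh j.
have M0 : 0 <= M by exact: le_trans (pM 0%N).
have top : M * `|q`_b| <= d^-1 * h.
  rewrite -[X in X <= _]mul1r -(mulVf (lt0r_neq0 d0)) -mulrA ler_pM2l ?invr_gt0//.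
  rewrite mulrA; apply: le_trans (pqh (a + b)%N).
  by rewrite (coefM_top pa qb) normrM ler_wpM2r.
have [->|jb] := eqVneq j b.
  rewrite mulrDl (le_trans top)// lerDl !mulr_ge0// ltW// ?addr_gt0// ?invr_gt0//.
have := IH p (q - q`_b *: 'X^b) a M (h + d^-1 * h) pa (size_drop_top qb) pM dM.
have dh : 0 <= d^-1 * h by rewrite mulr_ge0// invr_ge0 ltW.
move=> /(_ _ _ j); rewrite coefB coefZ coefXn (negbTE jb) mulr0 subr0.
move=> H; apply: le_trans (H _ _) _; first exact: addr_ge0.
  move=> k; rewrite mulrBr coefB (le_trans (ler_normB _ _))// lerD//.
  by rewrite [p * _]mulrC (le_trans (coefMnX_le _ _ _ pM))// mulrC.
by rewrite mulrDl -mulrA mulrDl mul1r lerDr.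
Qed.

(* Either the leading coefficient of [p] is large, and [q] is recovered from
   [p * q] by division, or it is small and can be dropped. *)
Lemma gelfond (F : realFieldType) a b :
  exists2 c : F, 1 <= c & forall (p q : {poly F}) (h : F),
    (size p <= a)%N -> (size q <= b)%N ->
    (forall k, `|(p * q)`_k| <= h) -> forall i j, `|p`_i| * `|q`_j| <= c * h.
Proof.
elim: a => [|a [c c1 IH]].
  exists 1 => // p q h; rewrite leqn0 size_poly_eq0 => /eqP -> _ H i j.
  by rewrite coef0 normr0 mul0r mul1r (le_trans _ (H 0%N)).
have c0 : 0 < c by exact: lt_le_trans c1.
(* The threshold is chosen so that [c * d = 1/2]: when the top coefficient is dropped, the error
   [d * M * N] comes back multiplied by [c], and half of [M * N] is absorbed on the left. *)
pose d : F := (2 * c)^-1; have d0 : 0 < d by rewrite invr_gt0 mulr_gt0.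
have [e e0 He] := gelfond_lead b d0.
exists (e + 2 * c); first by rewrite (le_trans c1)//; lra.
move=> p q h pa qb pqh i j.
have h0 : 0 <= h by exact: le_trans (pqh 0%N).
have [i0 Mi] := coef_maxE p; have [j0 Nj] := coef_maxE q.
set M : F := `|p`_i0|; set N : F := `|q`_j0|.
have MN : `|p`_i| * `|q`_j| <= M * N by rewrite ler_pM.
apply: (le_trans MN).
have [dM|Md] := leP (d * M) `|p`_a|.
  apply: le_trans (He p q a M h pa qb Mi dM h0 pqh j0) _.
  by rewrite mulrDl lerDl mulr_ge0// ltW// mulr_gt0.
(* As [d <= 1], a top coefficient below [d * M] is not the maximal one, so [M] survives its
   removal. *)
have i0a : i0 != a.
  have d1 : d <= 1 by rewrite /d invf_le1 ?mulr_gt0//; lra.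
  apply/eqP => i0a; move: Md; rewrite -i0a -/M ltNge => /negP[].
  by rewrite -[leRHS]mul1r ler_wpM2r// /M.
have H1 k : `|((p - p`_a *: 'X^a) * q)`_k| <= h + d * M * N.
  rewrite mulrBl coefB (le_trans (ler_normB _ _))// lerD//.
  by rewrite (le_trans (coefMnX_le _ _ _ Nj))// ler_wpM2r// ltW.
have := IH _ q _ (size_drop_top pa) qb H1 i0 j0.
rewrite coefB coefZ coefXn (negbTE i0a) mulr0 subr0 -/M -/N.
rewrite mulrDr !mulrA (_ : c * d = 2^-1); last first.
  by rewrite /d invfM mulrA [c * _]mulrC -mulrA mulfV ?mulr1// gt_eqF.
move=> H2; have : M * N <= 2 * c * h.
  by lra.
by move/le_trans; apply; rewrite ler_wpM2r// lerDr ltW.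
Qed.

(** * Integer polynomials of bounded height *)

Definition ints (K : nat) : seq int :=
  [seq i%:Z - K%:Z | i <- iota 0 K.*2.+1].
Arguments ints : simpl never.

Lemma mem_ints K c : (c \in ints K) = (`|c| <= K)%N.
Proof.
apply/mapP/idP => [[i]|cK]; first by rewrite mem_iota => /andP[_ iK] ->; lia.
by exists `|(c + K%:Z)%R|%N; [rewrite mem_iota; lia|lia].
Qed.

Lemma uniq_ints K : uniq (ints K).
Proof. by rewrite map_inj_uniq ?iota_uniq// => i j; lia. Qed.

Lemma size_ints K : size (ints K) = K.*2.+1.
Proof. by rewrite size_map size_iota. Qed.

(** The bound [n] is on the size, so the degrees are below [n]. Building by Horner's rule makes the
    constant coefficient the innermost index, and this is how [gensumE] isolates it. *)
Fixpoint polybox (n K : nat) : seq {poly int} :=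
  if n is m.+1 then [seq r * 'X + c%:P | r <- polybox m K, c <- ints K]
  else [:: 0].
Arguments polybox : simpl never.

Lemma polyboxS n K :
  polybox n.+1 K = [seq r * 'X + c%:P | r <- polybox n K, c <- ints K].
Proof. by []. Qed.

Lemma polyboxP n K (p : {poly int}) :
  reflect ((size p <= n)%N /\ forall i, (`|(p`_i)%R| <= K)%N) (p \in polybox n K).
Proof.
elim: n p => [|n IH] p; apply: (iffP idP); rewrite ?polyboxS.
- by rewrite inE => /eqP ->; rewrite size_poly0; split => // i; rewrite coef0.
- by case; rewrite leqn0 size_poly_eq0 => /eqP -> _; rewrite inE.
- move=> /allpairsPdep[r [c [/IH[rn rK]]]]; rewrite mem_ints => cK ->; split.
    by rewrite size_MXaddC; case: ifP.
  by case=> [|i]; rewrite coefD coefMX coefC/= ?add0r// addr0.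
- have [r [c ->]] : exists r c, p = r * 'X + c%:P.
    elim/poly_ind: p => [|r c _]; last by exists r, c.
    by exists 0, 0; rewrite mul0r addr0.
  move=> [sp pK]; apply/allpairsPdep; exists r, c.
  have rE i : r`_i = (r * 'X + c%:P)`_i.+1 by rewrite coefD coefMX coefC addr0.
  split=> //; last by rewrite mem_ints; have := pK 0%N; rewrite coefD coefMX coefC add0r.
  apply/IH; split; last by move=> i; rewrite rE.
  by apply/leq_sizeP => j nj; rewrite rE nth_default// (leq_trans sp).
Qed.

Lemma uniq_polybox n K : uniq (polybox n K).
Proof.
elim: n => [//|n IH]; rewrite polyboxS; apply: allpairs_uniq => //; first exact: uniq_ints.
move=> [r c] [r' c'] _ _ /= /polyP e; congr pair.
  by apply/polyP => i; have := e i.+1; rewrite !coefD !coefMX !coefC/= !addr0.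
by have := e 0%N; rewrite !coefD !coefMX !coefC/= !add0r.
Qed.

Lemma size_polybox n K : size (polybox n K) = (K.*2.+1 ^ n)%N.
Proof.
by elim: n => [//|n IH]; rewrite polyboxS size_allpairs size_ints IH expnSr.
Qed.

Lemma gelfond_int a b : exists2 C, (0 < C)%N & forall (p q : {poly int}) H,
  (size p <= a)%N -> (size q <= b)%N -> (forall k, (`|((p * q)`_k)%R| <= H)%N) ->
  forall i j, (`|(p`_i)%R| * `|(q`_j)%R| <= C * H)%N.
Proof.
have [c c1 Hc] := @gelfond rat a b; have c0 : 0 <= c by exact: le_trans c1.
exists (Num.truncn c).+1 => // p q H pa qb pqH i j.
have sz (r : {poly int}) : size (map_poly intr r : {poly rat}) = size r.
  by apply: size_map_inj_poly => //; exact: intr_inj.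
have := Hc (map_poly intr p) (map_poly intr q) H%:R.
rewrite !sz => /(_ pa qb) H1.
have {}/H1 /(_ i j) : forall k,
    `|(map_poly intr p * map_poly intr q : {poly rat})`_k| <= H%:R.
  move=> k; rewrite -rmorphM coef_map /= -intr_norm -[H%:R]/(H%:Z%:~R) ler_int.
  by rewrite -abszE lez_nat.
rewrite !coef_map/= -!intr_norm -intrM => H2.
have : (`|p`_i| * `|q`_j|)%:~R <= ((Num.truncn c).+1 * H)%:Z%:~R :> rat.
  apply: (le_trans H2); rewrite PoszM intrM ler_wpM2r ?ler0n//.
  exact/ltW/truncnS_gt.
by rewrite ler_int -!abszE -PoszM lez_nat.
Qed.

(** * Counting reducible polynomials of bounded height *)

Lemma leq_exp2rW m n e : (m <= n -> m ^ e <= n ^ e)%N.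
Proof. by move=> mn; case: e => // e; rewrite leq_exp2r. Qed.

(* Every pair with [H(A) * H(B) <= X] has [2 ^ j <= H(A) < 2 ^ j.+1] and hence
   [H(B) <= X %/ 2 ^ j] for some [j]. *)
Definition dyadic_pairs n X : seq ({poly int} * {poly int}) :=
  [seq AB | j <- iota 0 (trunc_log 2 X).+1,
      AB <- [seq (A, B) | A <- polybox n (2 ^ j.+1), B <- polybox n (X %/ 2 ^ j)]].

Lemma mem_dyadic_pairs n X (A B : {poly int}) h :
  (0 < h)%N -> (h <= X)%N -> (size A <= n)%N -> (size B <= n)%N ->
  (forall i, (`|(A`_i)%R| <= h)%N) -> (forall j, (h * `|(B`_j)%R| <= X)%N) ->
  (A, B) \in dyadic_pairs n X.
Proof.
move=> h0 hX An Bn Ah Bh; apply/allpairsPdep.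
have /andP[le_h lt_h] := trunc_log_bounds (isT : (1 < 2)%N) h0.
exists (trunc_log 2 h), (A, B); split => //.
  by rewrite mem_iota add0n ltnS leq_trunc_log.
apply/allpairsPdep; exists A, B; split => //; apply/polyboxP; split => // i.
  by rewrite (leq_trans (Ah i))// ltnW.
rewrite leq_divRL ?expn_gt0// mulnC (leq_trans _ (Bh i))//.
by rewrite leq_mul2r le_h orbT.
Qed.

(** With [v = 2 ^ j] and [u = X %/ v], both at least 1, one range contributes
    [((4v + 1) (2u + 1)) ^ n], which is at most [(5v * 3u) ^ n <= (15 X) ^ n]. The logarithm is the
    number of ranges. *)
Lemma size_dyadic_pairs n X : (0 < X)%N ->
  (size (dyadic_pairs n X) <= (trunc_log 2 X).+1 * (15 * X) ^ n)%N.
Proof.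
move=> X0; rewrite size_allpairs_dep sumnE big_map big_seq.
rewrite -[X in (_ <= X * _)%N](size_iota 0) -sum1_size big_distrl [leqRHS]big_seq.
apply: leq_sum => j; rewrite mem_iota add0n ltnS => jX.
have j2 : (2 ^ j <= X)%N.
  by apply: (@leq_trans (2 ^ trunc_log 2 X)); [rewrite leq_pexp2l|exact: trunc_logP].
have d0 : (0 < X %/ 2 ^ j)%N by rewrite divn_gt0 ?expn_gt0.
have e0 : (0 < 2 ^ j)%N by rewrite expn_gt0.
rewrite size_allpairs !size_polybox [leqRHS]mul1n -expnMn leq_exp2rW//.
have := leq_trunc_div X (2 ^ j).
rewrite expnS; set v := (2 ^ j)%N in e0 d0 *; set u := (X %/ v)%N in d0 *.
by clearbody u v; nia.
Qed.

(** Both factors must have positive degree: a constant factor belongs to the content and is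
    irrelevant to irreducibility over the rationals. *)
Definition splits (p : {poly int}) :=
  exists A B : {poly int}, [/\ p = A * B, (1 < size A)%N & (1 < size B)%N].

Lemma height_witness (p : {poly int}) : p != 0 ->
  exists2 i, (0 < `|(p`_i)%R|)%N & forall j, (`|(p`_j)%R| <= `|(p`_i)%R|)%N.
Proof.
move=> p0; case: (arg_maxnP (fun i : 'I_(size p).+1 => `|(p`_i)%R|%N)
  (erefl : predT ord0)) => /= i _ ip.
have ip' j : (`|(p`_j)%R| <= `|(p`_i)%R|)%N.
  have [jp|pj] := ltnP j (size p); last by rewrite nth_default// absz0.
  by have := ip (inord j) isT; rewrite inordK// ltnS ltnW.
exists i => //; rewrite (leq_trans _ (ip' (size p).-1))// absz_gt0.
by rewrite -[_`_ _]/(lead_coef p) lead_coef_eq0.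
Qed.

Lemma size_splits (A B : {poly int}) n : (1 < size A)%N -> (1 < size B)%N ->
  (size (A * B)%R <= n.+1)%N -> (size A <= n)%N /\ (size B <= n)%N.
Proof.
move=> A1 B1; rewrite size_proper_mul; first by lia.
by apply: mulf_neq0; rewrite lead_coef_eq0 -size_poly_gt0 ltnW.
Qed.

(** A nonzero integer polynomial [B] has a coefficient of absolute value at least 1, so the height
    of [A] alone is at most [X]. *)
Lemma mem_dyadic_pairs_split n X (A B : {poly int}) :
  A != 0 -> B != 0 -> (size A <= n)%N -> (size B <= n)%N ->
  (forall i j, (`|(A`_i)%R| * `|(B`_j)%R| <= X)%N) -> (A, B) \in dyadic_pairs n X.
Proof.
move=> A0 B0 An Bn AB; have [i i0 Ai] := height_witness A0.
have [j j0 Bj] := height_witness B0.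
by apply: (mem_dyadic_pairs i0) => //; rewrite (leq_trans _ (AB i j))// leq_pmulr.
Qed.

(** Multiplication sends [dyadic_pairs m] onto a list containing [s]. Each factor loses at least one
    degree to the other, hence has size at most [m]; this gives the exponent [m], against about
    [K ^ m.+1] polynomials in the box. *)
Lemma count_splits m : exists2 C, (0 < C)%N & forall K (s : seq {poly int}),
  (0 < K)%N -> uniq s ->
  (forall p, p \in s -> p \in polybox m.+1 K /\ splits p) ->
  (size s <= (trunc_log 2 (C * K)).+1 * (15 * (C * K)) ^ m)%N.
Proof.
have [C C0 HC] := gelfond_int m m; exists C => // K s K0 us sP.
have X0 : (0 < C * K)%N by rewrite muln_gt0 C0.
apply: leq_trans (size_dyadic_pairs m X0).
rewrite -(size_map (fun AB => AB.1 * AB.2)); apply: uniq_leq_size => // p /sP.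
move=> [/polyboxP[pm pK] [A [B [pE A1 B1]]]]; subst p.
have [Am Bm] := size_splits A1 B1 pm.
apply/mapP; exists (A, B) => //; apply: mem_dyadic_pairs_split => //.
- by rewrite -size_poly_gt0 ltnW.
- by rewrite -size_poly_gt0 ltnW.
- exact: HC.
Qed.

Lemma monic_splits (p : {poly int}) : p \is monic -> splits p ->
  exists A B : {poly int},
    [/\ p = A * B, A \is monic, B \is monic, (1 < size A)%N & (1 < size B)%N].
Proof.
move=> /monicP pm [A [B [pE A1 B1]]].
have : lead_coef A * lead_coef B = 1 by rewrite -lead_coefM -pE.
set e := lead_coef A => AB.
have ee : e * e = 1.
  have : `|e|%N = 1%N by apply/eqP; rewrite -dvdn1 -[X in (_ %| X)%N]/`|1%R|%N -AB abszM dvdn_mulr.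
  by lia.
exists (e *: A), (e *: B); rewrite !monicE !lead_coefZ -/e ee eqxx.
have e0 : e != 0 by apply/eqP => e0; rewrite e0 mul0r in ee.
by rewrite -scalerAl -scalerAr scalerA ee scale1r AB !size_scale.
Qed.

(** The factors may be taken monic, of degrees [a] and [m.+1 - a] with [1 <= a <= m]. Only their
    tails below the leading term are free, and these have size at most [m]; the factor [m] is the
    number of choices of [a]. *)
Lemma count_monic_splits m : exists2 C, (0 < C)%N & forall K (s : seq {poly int}),
  (0 < K)%N -> uniq s ->
  (forall p, p \in s ->
    [/\ p \in polybox m.+2 K, p \is monic, size p = m.+2 & splits p]) ->
  (size s <= m * ((trunc_log 2 (C * K)).+1 * (15 * (C * K)) ^ m))%N.
Proof.
have [C C0 HC] := gelfond_int m.+1 m.+1; exists C => // K s K0 us sP.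
have X0 : (0 < C * K)%N by rewrite muln_gt0 C0.
apply: (@leq_trans (m * size (dyadic_pairs m (C * K)))); last first.
  by rewrite leq_mul2l size_dyadic_pairs ?orbT.
rewrite -{1}(size_iota 1 m).
rewrite -(size_allpairs (fun a (AB : {poly int} * {poly int}) =>
  ('X^a + AB.1) * ('X^(m.+1 - a) + AB.2))).
apply: uniq_leq_size => // p /sP[/polyboxP[pm pK] pmon psz /(monic_splits pmon)].
move=> [A [B [pE Am Bm A1 B1]]].
have sAB : (size A + size B = m.+3)%N.
  move: psz; rewrite pE size_proper_mul; first by lia.
  by rewrite (monicP Am) (monicP Bm) mulr1 oner_neq0.
have tail (D : {poly int}) d : D \is monic -> size D = d.+1 ->
  (size (D - 'X^d)%R <= d)%N.
  move=> Dm Dd; have := @size_drop_top _ D d; rewrite Dd => /(_ (leqnn _)).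
  by have := monicP Dm; rewrite /lead_coef Dd /= => ->; rewrite scale1r.
have tailc (D : {poly int}) d i : D \is monic -> size D = d.+1 ->
  (`|((D - 'X^d)`_i)%R| <= `|(D`_i)%R|)%N.
  move=> Dm Dd; have := monicP Dm; rewrite /lead_coef Dd /= => Dd1.
  by rewrite coefB coefXn; case: eqP => [->|_]; rewrite ?Dd1 ?subr0.
have [a Aa] : exists a, size A = a.+1 by exists (size A).-1; lia.
have [b Bb] : exists b, size B = b.+1 by exists (size B).-1; lia.
apply/allpairsPdep; exists a, (A - 'X^a, B - 'X^b); split; last 1 first.
- have addK (x y : {poly int}) : x + (y - x) = y by rewrite addrC subrK.
  by rewrite /= (_ : m.+1 - a = b)%N; [rewrite !addK|lia].
- by rewrite mem_iota; lia.
(* The tail of [A] may vanish, so the dyadic range is given by the height of the monic [A] itself,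
   which is positive and bounds the tail. *)
have [i i0 Ai] : exists2 i, (0 < `|(A`_i)%R|)%N & forall j, (`|(A`_j)%R| <= `|(A`_i)%R|)%N.
  by apply: height_witness; rewrite monic_neq0.
have AB : forall i j, (`|(A`_i)%R| * `|(B`_j)%R| <= C * K)%N.
  by apply: HC; rewrite -?pE//; lia.
have [j j0 _] : exists2 j, (0 < `|(B`_j)%R|)%N & forall k, (`|(B`_k)%R| <= `|(B`_j)%R|)%N.
  by apply: height_witness; rewrite monic_neq0.
apply: (mem_dyadic_pairs i0).
- by rewrite (leq_trans _ (AB i j))// leq_pmulr.
- by rewrite (leq_trans (tail _ _ Am Aa))//; lia.
- by rewrite (leq_trans (tail _ _ Bm Bb))//; lia.
- by move=> k; rewrite (leq_trans (tailc _ _ _ Am Aa)).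
- move=> k; rewrite (leq_trans _ (AB i k))// leq_mul2l; apply/orP; right.
  exact: tailc.
Qed.

(** * Minimal polynomials *)

Definition content (p : {poly int}) : nat :=
  (\big[gcdn/0]_(i < size p) `|(p`_i)%R|)%N.

Section minpoly.
Context {R : realType}.
Implicit Types (p q : {poly int}) (a : R).

Lemma vanishes_at_ratr p a :
  vanishes_at p a = root (map_poly (ratr : rat -> R) (pZtoQ p)) a.
Proof.
rewrite /vanishes_at -map_poly_comp; congr (root _ a).
by apply: eq_map_poly => x /=; rewrite ratr_int.
Qed.

(** If [p] did not divide [q], they would be coprime over the rationals, hence over the reals, and
    could not share a root. *)
Lemma irreducible_dvd_common_root p q a :
  irreducible_poly (pZtoQ p) -> vanishes_at p a -> vanishes_at q a ->
  pZtoQ p %| pZtoQ q.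
Proof.
move=> ip pa qa; apply: contraTT isT; rewrite -irreducible_poly_coprime//.
rewrite -(coprimep_map (ratr : {rmorphism rat -> R})) => cpq.
rewrite vanishes_at_ratr in pa; rewrite vanishes_at_ratr in qa.
by have := coprimep_root cpq pa; rewrite -rootE qa.
Qed.

(** Replaces minimality of the degree by irreducibility, which can be counted. By Gauss's lemma a
    rational divisor of [p] comes from an integral factorization; one of the two factors vanishes at
    [a], and minimality gives it the full degree of [p]. *)
Lemma is_minpolyP a p : is_minpoly a p <->
  [/\ irreducible_poly (pZtoQ p), content p = 1%N, 0 < lead_coef p &
      vanishes_at p a].
Proof.
have szQ q : size (pZtoQ q) = size q by exact: size_rat_int_poly.
split=> [[p0 pa pmin pc pl]|[ip pc pl pa]]; split=> //; last 2 first.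
- by rewrite -lead_coef_eq0 gt_eqF.
- move=> q q0 qa; have /dvdp_leq := irreducible_dvd_common_root ip pa qa.
  rewrite -size_poly_eq0 !szQ size_poly_eq0 q0 => /(_ isT) pq.
  by rewrite /degree -!subn1 leq_sub2r.
have psz : (1 < size p)%N.
  rewrite ltnNge; apply/negP => /size1_polyC pE; move: p0 pa.
  by rewrite pE /vanishes_at map_polyC/= rootC polyC_eq0 intr_eq0 => /negbTE ->.
split; first by rewrite szQ.
move=> q q1 /[dup] qp /dvdpP_rat_int[p1 [c c0 qE] [r pE]].
have [p10 r0] : p1 != 0 /\ r != 0 by move: p0; rewrite pE mulf_eq0 negb_or => /andP.
have sE : (size p = (size p1 + size r).-1)%N.
  by rewrite pE size_mul.
have sq : size q = size p1 by rewrite qE size_scale// szQ.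
rewrite -dvdp_size_eqp// sq szQ eqn_leq {1}sE.
have s1 : (0 < size r)%N by rewrite size_poly_gt0.
have s2 : (0 < size p1)%N by rewrite size_poly_gt0.
move: pa; rewrite /vanishes_at pE rmorphM rootM => /orP[p1a|ra].
  by have := pmin _ p10 p1a; rewrite /degree -pE sE; lia.
have := pmin _ r0 ra; rewrite /degree -?pE sE; lia.
Qed.

(** The two are associate over the rationals; content 1 and a positive leading coefficient leave no
    freedom. So distinct minimal polynomials have disjoint root sets, and root counts may be
    added. *)
Lemma is_minpoly_inj a p q : is_minpoly a p -> is_minpoly a q -> p = q.
Proof.
move=> /is_minpolyP[ip pc pl pa] /is_minpolyP[iq qc ql qa].
have e : pZtoQ p %= pZtoQ q.
  apply/andP; split; first exact: irreducible_dvd_common_root ip pa qa.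
  exact: irreducible_dvd_common_root iq qa pa.
have zc r : content r = 1%N -> 0 < lead_coef r -> zcontents r = 1.
  by rewrite /zcontents -/(content r) => -> /gtr0_sgz ->.
have : lead_coef q *: p = lead_coef p *: q.
  apply: (@map_inj_poly _ _ (intr : int -> rat)) => //; first exact: intr_inj.
  by rewrite !linearZ/= -!(lead_coef_map_inj (@intr_inj rat))//; exact: eqp_eq.
move/(congr1 zprimitive); rewrite !zprimitiveZ ?gt_eqF// => E.
by rewrite [p]zpolyEprim [q]zpolyEprim !zc// !scale1r.
Qed.

End minpoly.

(** * Counting real roots *)

Lemma cardfs_bigcup (T : choiceType) (J : eqType) (s : seq J) (A : J -> set T) :
  uniq s -> (forall j, j \in s -> finite_set (A j)) ->
  (forall i j x, i \in s -> j \in s -> A i x -> A j x -> i = j) ->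
  finite_set [set x | exists2 j, j \in s & A j x] /\
  #|` fset_set [set x | exists2 j, j \in s & A j x]|%fset =
  (\sum_(j <- s) #|` fset_set (A j)|%fset)%N.
Proof.
elim: s => [|j s IH].
  move=> _ _ _; rewrite big_nil (_ : [set x | _] = set0) ?fset_set0 ?cardfs0//.
  by rewrite -subset0 => x [].
move=> /= /andP[js us] finA Ainj.
have [|i ii|fs cs] := IH us; first by move=> i ii; apply: finA; rewrite inE ii orbT.
  by move=> x is_ iis; apply: Ainj; rewrite inE ?is_ ?iis orbT.
rewrite (_ : [set x | _] = A j `|` [set x | exists2 j, j \in s & A j x]); last first.
  apply/seteqP; split=> x /= => [[i]|[Ajx|[i ii Aix]]].
  - by rewrite inE => /predU1P[->|ii] Aix; [left|right; exists i].
  - by exists j => //; rewrite inE eqxx.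
  - by exists i => //; rewrite inE ii orbT.
have fj : finite_set (A j) by apply: finA; rewrite inE eqxx.
split; first by rewrite finite_setU.
rewrite fset_setU// cardfsU -fset_setI// (_ : _ `&` _ = set0); last first.
  rewrite -subset0 => x /= [Ajx [i ii Aix]].
  have ij : i = j by apply: (Ainj _ _ x) Aix Ajx; rewrite inE ?ii ?eqxx ?orbT.
  by rewrite -ij ii in js.
by rewrite fset_set0 cardfs0 subn0 cs big_cons.
Qed.

Section roots.
Context {R : realType}.
Implicit Types (I J : set R) (f : {poly R}) (p : {poly int}).

Lemma finite_roots f : f != 0 -> finite_set [set a | root f a].
Proof.
have [n] := ubnP (size f); elim: n f => // n IH f fn f0.
have [[a fa]|noroot] := pselect (exists a, root f a); last first.
  rewrite (_ : [set a | _] = set0)// -subset0 => a fa.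
  by apply: noroot; exists a.
have /factor_theorem[g fg] := fa.
have g0 : g != 0 by apply: contraNneq f0; rewrite fg => ->; rewrite mul0r.
apply: (@sub_finite_set _ _ ([set a] `|` [set b | root g b])).
  move=> b /=; rewrite fg rootM root_XsubC => /orP[gb|/eqP ->]; first by right.
  by left.
rewrite finite_setU; split; first exact: finite_set1.
by apply: IH => //; move: fn; rewrite fg size_Mmonic ?monicXsubC// size_XsubC; lia.
Qed.

(* With this convention the zero polynomial contributes nothing. *)
Definition rootcount I f : nat :=
  if f == 0 then 0%N else #|` fset_set (I `&` [set a | root f a])|%fset.

Lemma finite_rootsI I f : f != 0 -> finite_set (I `&` [set a | root f a]).
Proof. by move=> f0; apply: finite_setIr; exact: finite_roots. Qed.

Lemma rootcount_le I f : (rootcount I f <= (size f).-1)%N.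
Proof.
rewrite /rootcount; case: eqP => [//|/eqP f0].
have := @max_poly_roots _ f (enum_fset (fset_set (I `&` [set a | root f a]))) f0.
rewrite fset_uniq => H; rewrite -ltnS prednK ?size_poly_gt0//; apply: H => //.
apply/allP => x xI; have : x \in fset_set (I `&` [set a | root f a]) by [].
by rewrite in_fset_set; [rewrite inE => -[]|exact: finite_rootsI].
Qed.

Lemma rootcountU I J f : I `&` J = set0 ->
  rootcount (I `|` J) f = (rootcount I f + rootcount J f)%N.
Proof.
move=> IJ; rewrite /rootcount; case: eqP => [//|/eqP f0].
rewrite setIUl fset_setU; try exact: finite_rootsI.
rewrite cardfsU -fset_setI; try exact: finite_rootsI.
by rewrite setIACA IJ set0I fset_set0 cardfs0 subn0.
Qed.

Lemma rootcountS I J f : I `<=` J -> (rootcount I f <= rootcount J f)%N.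
Proof.
move=> IJ; rewrite /rootcount; case: eqP => [//|/eqP f0].
apply: fsubset_leq_card; rewrite -fset_set_sub; try exact: finite_rootsI.
exact: setSI.
Qed.

Lemma rootcount1 c f : rootcount [set c] f = ((f != 0) && root f c).
Proof.
rewrite /rootcount; case: eqP => [//|/eqP f0] /=.
case: (boolP (root f c)) => fc.
  rewrite (_ : _ `&` _ = [set c]) ?fset_set1 ?cardfs1//.
  by apply/seteqP; split=> x /=; [case|move=> ->].
rewrite (_ : _ `&` _ = set0) ?fset_set0 ?cardfs0//.
by rewrite -subset0 => x /= [->]; rewrite (negbTE fc).
Qed.

Lemma rootcountZ I c f : c != 0 -> rootcount I (c *: f) = rootcount I f.
Proof.
move=> c0; rewrite /rootcount scale_poly_eq0 (negbTE c0)/=.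
by congr (if _ then _ else #|` fset_set (_ `&` _)|%fset); apply/seteqP; split=> x /=; rewrite rootZ.
Qed.

Lemma rootcountN I f : rootcount I (- f) = rootcount I f.
Proof. by rewrite -scaleN1r rootcountZ// oppr_eq0 oner_eq0. Qed.

Definition zroots I p : nat := rootcount I (map_poly intr p).

Lemma size_map_intr p : size (map_poly intr p : {poly R}) = size p.
Proof. by apply: size_map_inj_poly => //; exact: intr_inj. Qed.

Lemma map_intr_eq0 p : (map_poly intr p == 0 :> {poly R}) = (p == 0).
Proof. by rewrite -!size_poly_eq0 size_map_intr. Qed.

Lemma zroots_le I p : (zroots I p <= (size p).-1)%N.
Proof. by rewrite -size_map_intr; exact: rootcount_le. Qed.

Lemma heightP p K : (height p <= K)%N <-> forall i, (`|(p`_i)%R| <= K)%N.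
Proof.
split=> [/bigmax_leqP H i|H]; last by apply/bigmax_leqP => i _.
have [ip|pi] := ltnP i (size p); first exact: (H (Ordinal ip)).
by rewrite nth_default.
Qed.

Lemma height_le p (Q : R) : 0 <= Q ->
  ((height p)%:R <= Q) = (height p <= Num.truncn Q)%N.
Proof. by move=> Q0; rewrite truncn_ge_nat. Qed.

Definition minimal p :=
  `[< [/\ irreducible_poly (pZtoQ p), content p = 1%N & 0 < lead_coef p] >].

Lemma PhiE m (Q : R) I : 0 <= Q ->
  Phi m Q I = (\sum_(p <- polybox m.+1 (Num.truncn Q) |
                     minimal p && (size p == m.+1)) zroots I p)%N.
Proof.
move=> Q0; rewrite -big_filter; set s := [seq _ <- _ | _].
have sP p : p \in s <->
    [/\ irreducible_poly (pZtoQ p), content p = 1%N, 0 < lead_coef p,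
    size p = m.+1 & (height p)%:R <= Q].
  rewrite mem_filter; split.
    case/andP => /andP[/asboolP[ip cp lp] /eqP sp] /polyboxP[_ hp]; split=> //.
    by rewrite height_le//; apply/heightP.
  move=> [ip cp lp sp]; rewrite height_le// => /heightP hp.
  rewrite sp eqxx andbT; apply/andP; split; first exact/asboolP.
  by apply/polyboxP; rewrite sp.
have s0 p : p \in s -> p != 0 by move/sP => [_ _ + _ _]; apply: contraTneq => ->; rewrite lead_coef0 ltxx.
have us : uniq s by rewrite filter_uniq// uniq_polybox.
pose A p : set R := I `&` [set a | root (map_poly intr p) a].
transitivity (\sum_(p <- s) #|` fset_set (A p)|%fset)%N; last first.
  apply: eq_big_seq => p ps; rewrite /zroots /rootcount map_intr_eq0.
  by rewrite (negbTE (s0 _ ps)).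
have [||_ <-] := @cardfs_bigcup _ _ s A us.
- by move=> p ps; apply: finite_rootsI; rewrite map_intr_eq0 s0.
- move=> p q a /sP[ip cp lp _ _] /sP[iq cq lq _ _] [Ia pa] [_ qa].
  by apply: (@is_minpoly_inj R a); apply/is_minpolyP.
congr (#|` fset_set _|%fset); apply/seteqP; split=> a /=.
  move=> [Ia [p [mp dp hp]]]; exists p; last by case: mp.
  have [p0 _ _ _ _] := mp.
  move/is_minpolyP : mp => [ip cp lp pa]; apply/sP; split => //.
  by rewrite -dp /degree prednK// size_poly_gt0.
move=> [p ps [Ia pa]]; split=> //; exists p.
have /sP[ip cp lp sp hp] := ps; rewrite /degree sp; split=> //.
exact/is_minpolyP.
Qed.

Lemma content_monic p : p \is monic -> content p = 1%N.
Proof.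
move=> pm; have := zcontents_monic pm.
by rewrite /zcontents (monicP pm) sgz1 mul1r -/(content p) => -[].
Qed.

Definition irrmonic m (r : {poly int}) :=
  `[< irreducible_poly (pZtoQ ('X^(m.+1) + r)) >].

(** The condition [1 <= Q] makes the leading coefficient 1 harmless for the height: ['X^(m.+1) + r]
    has height at most [Q] exactly when the coefficients of [r] are bounded by [Q]. *)
Lemma OmegaE m (Q : R) I : 1 <= Q ->
  Omega m.+1 Q I = (\sum_(r <- polybox m.+1 (Num.truncn Q) |
     irrmonic m r) zroots I ('X^(m.+1) + r)%R)%N.
Proof.
move=> Q1; have Q0 : 0 <= Q by exact: le_trans Q1.
have K1 : (0 < Num.truncn Q)%N by rewrite truncn_gt0.
rewrite -[RHS](big_map (fun r : {poly int} => 'X^(m.+1) + r) (fun p => `[< irreducible_poly (pZtoQ p) >])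
  (fun p => zroots I p)) -big_filter; set s := [seq _ <- _ | _].
have sP p : p \in s <->
    [/\ irreducible_poly (pZtoQ p), p \is monic, size p = m.+2 & (height p)%:R <= Q].
  rewrite mem_filter; split.
    case/andP => /asboolP ip /mapP[r /polyboxP[sr hr] pE].
    have sX : (size r < size ('X^(m.+1) : {poly int}))%N by rewrite size_polyXn.
    split=> //.
    - by rewrite pE monicE lead_coefDl// lead_coefXn.
    - by rewrite pE size_polyDl// size_polyXn.
    - rewrite height_le//; apply/heightP => i; rewrite pE coefD coefXn.
      case: eqP => [->|_]; last by rewrite add0r.
      by rewrite [r`__]nth_default// addr0.
  move=> [ip pm sp]; rewrite height_le// => /heightP hp.
  apply/andP; split; first exact/asboolP.
  have lp : p`_m.+1 = 1 by have := monicP pm; rewrite /lead_coef sp.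
  apply/mapP; exists (p - 'X^(m.+1)); last by rewrite addrC subrK.
  apply/polyboxP; split.
    have := @size_drop_top _ p m.+1; rewrite sp => /(_ (leqnn _)).
    by rewrite lp scale1r.
  move=> i; rewrite coefB coefXn; case: eqP => [->|_]; last by rewrite subr0.
  by rewrite lp subrr.
have us : uniq s by rewrite filter_uniq// map_inj_uniq ?uniq_polybox//; exact: addrI.
pose A p : set R := I `&` [set a | root (map_poly intr p) a].
transitivity (\sum_(p <- s) #|` fset_set (A p)|%fset)%N; last first.
  apply: eq_big_seq => p /sP[_ pm _ _]; rewrite /zroots /rootcount map_intr_eq0.
  by rewrite (negbTE (monic_neq0 pm)).
have [||_ <-] := @cardfs_bigcup _ _ s A us.
- by move=> p /sP[_ pm _ _]; apply: finite_rootsI; rewrite map_intr_eq0 monic_neq0.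
- move=> p q a /sP[ip pm _ _] /sP[iq qm _ _] [Ia pa] [_ qa].
  apply: (@is_minpoly_inj R a); apply/is_minpolyP; split=> //;
    by rewrite ?content_monic ?(monicP pm) ?(monicP qm).
congr (#|` fset_set _|%fset); apply/seteqP; split=> a /=.
  move=> [Ia [p [mp pm dp hp]]]; exists p; last by case: mp.
  move/is_minpolyP : mp => [ip cp lp pa]; apply/sP; split => //.
  by rewrite -dp /degree prednK// size_poly_gt0 monic_neq0.
move=> [p /sP[ip pm sp hp] [Ia pa]]; split=> //; exists p.
rewrite /degree sp; split=> //.
by apply/is_minpolyP; split=> //; rewrite ?content_monic ?(monicP pm).
Qed.

End roots.

(** Gauss's lemma: a proper rational divisor yields an integral factorization with factors of the
    same degrees. *)
Lemma not_irreducible_splits (p : {poly int}) : (1 < size p)%N ->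
  ~ irreducible_poly (pZtoQ p) -> splits p.
Proof.
have szQ q : size (pZtoQ q) = size q by exact: size_rat_int_poly.
move=> p1 nip; apply: contrapT => nsp; apply: nip; split; first by rewrite szQ.
move=> q q1 /[dup] qp /dvdpP_rat_int[u [c c0 qE] [r pE]].
have p0 : p != 0 by rewrite -size_poly_gt0 ltnW.
have [u0 r0] : u != 0 /\ r != 0 by move: p0; rewrite pE mulf_eq0 negb_or => /andP.
have sq : size q = size u by rewrite qE size_scale// szQ.
have su : (1 < size u)%N by rewrite -sq ltn_neqAle eq_sym q1 sq size_poly_gt0.
have sr : (size r <= 1)%N.
  by rewrite leqNgt; apply/negP => r1; apply: nsp; exists u, r.
have {}sr : size r = 1%N by apply/eqP; rewrite eqn_leq sr size_poly_gt0.
by rewrite -dvdp_size_eqp// sq szQ pE size_mul// sr addn1.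
Qed.

Lemma perm_polybox_opp n K : perm_eq (map -%R (polybox n K)) (polybox n K).
Proof.
apply: uniq_perm; first by rewrite map_inj_uniq ?uniq_polybox//; exact: oppr_inj.
  exact: uniq_polybox.
have opp p : p \in polybox n K -> - p \in polybox n K.
  by move=> /polyboxP[sp hp]; apply/polyboxP; rewrite size_polyN; split=> // i; rewrite coefN abszN.
move=> p; apply/mapP/idP => [[q /opp qK ->]//|pK].
by exists (- p); [exact: opp|rewrite opprK].
Qed.

Lemma content_opp p : content (- p) = content p.
Proof. by rewrite /content size_polyN; apply: eq_bigr => i _; rewrite coefN abszN. Qed.

Lemma irreducible_opp p : irreducible_poly (pZtoQ p) -> irreducible_poly (pZtoQ (- p)).
Proof.
move=> [p1 ip]; rewrite rmorphN; split; first by rewrite size_polyN.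
move=> q q1; rewrite -scaleN1r dvdpZr ?oppr_eq0 ?oner_eq0// => /(ip _ q1) e.
by rewrite (eqp_trans e)// eqp_sym eqp_scale// oppr_eq0 oner_eq0.
Qed.

(** * Comparison of the two counts with sums over all polynomials of a box *)

Section bounds.
Context {R : realType}.
Implicit Types (I : set R).

Definition primsum m K I : nat :=
  (\sum_(p <- polybox m.+1 K | content p == 1) zroots I p)%N.

Definition monicsum m K I : nat :=
  (\sum_(r <- polybox m.+1 K) zroots I ('X^(m.+1) + r)%R)%N.

Lemma zrootsN I p : zroots I (- p) = zroots I p.
Proof. by rewrite /zroots rmorphN rootcountN. Qed.

Lemma sum_zroots_le (s : seq {poly int}) m I :
  (forall p, p \in s -> (size p <= m.+1)%N) ->
  (\sum_(p <- s) zroots I p <= m * size s)%N.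
Proof.
move=> sm; rewrite -sum1_size big_distrr/= !big_seq; apply: leq_sum => p /sm.
by have := zroots_le I p; lia.
Qed.

Definition bad_bound m C K : nat :=
  ((trunc_log 2 (C * K)).+1 * (15 * (C * K)) ^ m)%N.

(** The 2 pairs [p] with [- p]. The primitive polynomials not accounted for either have degree below
    [m], at most [K.*2.+1 ^ m] of them, or have degree [m] and split; each has at most [m] roots. *)
Lemma Phi_bounds m : (0 < m)%N -> exists2 C, (0 < C)%N &
  forall (Q : R) I, 1 <= Q -> forall K, K = Num.truncn Q ->
  (2 * Phi m Q I <= primsum m K I
    <= 2 * Phi m Q I + m * (K.*2.+1 ^ m + bad_bound m C K))%N.
Proof.
move=> m0; have [C C0 HC] := count_splits m; exists C => // Q I Q1 _ ->.
set K := Num.truncn Q; have Q0 : 0 <= Q by exact: le_trans Q1.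
have K0 : (0 < K)%N by rewrite truncn_gt0.
pose irr p := `[< irreducible_poly (pZtoQ p) >].
pose P p := [&& content p == 1%N, irr p & size p == m.+1].
have irrN p : irr (- p) = irr p.
  by apply/asboolP/asboolP => /irreducible_opp; rewrite ?opprK.
have PN p : P (- p) = P p by rewrite /P content_opp irrN size_polyN.
have PhiK : Phi m Q I = (\sum_(p <- polybox m.+1 K | P p && (0 < lead_coef p)%R) zroots I p)%N.
  rewrite PhiE//; apply: eq_bigl => p.
  apply/andP/andP => [[/asboolP[ip /eqP cp lp] sp]|[/and3P[/eqP cp /asboolP ip sp] lp]].
    by split => //; apply/and3P; split => //; apply/asboolP.
  by split => //; apply/asboolP.
have PhiK2 : (2 * Phi m Q I)%N = (\sum_(p <- polybox m.+1 K | P p) zroots I p)%N.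
  rewrite [RHS](bigID (fun p : {poly int} => 0 < lead_coef p))/= -PhiK mul2n -addnn.
  congr addn; rewrite PhiK -(perm_big _ (perm_polybox_opp _ _)) big_map/=.
  apply: eq_big => p; last by rewrite zrootsN.
  rewrite PN lead_coefN oppr_gt0; case: (boolP (P p)) => //= /and3P[_ _ /eqP sp].
  by rewrite -leNgt le_eqVlt lead_coef_eq0 -size_poly_eq0 sp.
have -> : primsum m K I = (2 * Phi m Q I + \sum_(p <- polybox m.+1 K |
    (content p == 1%N) && ~~ P p) zroots I p)%N.
  rewrite PhiK2 /primsum (bigID P)/=; congr addn; apply: eq_bigl => p.
  by rewrite /P; case: (content p == 1%N).
rewrite leq_addr leq_add2l/= -big_filter; set s := [seq _ <- _ | _].
have sP p : p \in s -> [/\ p \in polybox m.+1 K, content p = 1%N & ~~ P p].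
  by rewrite mem_filter => /andP[/andP[/eqP ? ?] ?].
have us : uniq s by apply: filter_uniq; exact: uniq_polybox.
apply: (leq_trans (@sum_zroots_le _ m I _)); first by move=> p /sP[/polyboxP[]].
rewrite leq_mul2l; apply/orP; right.
rewrite -(count_predC (fun p : {poly int} => size p <= m)%N s) -!size_filter leq_add//.
  rewrite -(size_polybox m K); apply: uniq_leq_size; first by rewrite filter_uniq.
  move=> p; rewrite mem_filter => /andP[pm /sP[/polyboxP[_ ?] _ _]].
  exact/polyboxP.
apply: HC => //; first by rewrite filter_uniq.
move=> p; rewrite mem_filter /= -ltnNge => /andP[mp /sP[pK cp nP]].
split=> //; have /polyboxP[pm _] := pK.
apply: not_irreducible_splits; first exact: leq_ltn_trans m0 mp.
move=> ip; case/negP: nP; apply/and3P; split; [exact/eqP|exact/asboolP|].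
by rewrite eqn_leq pm.
Qed.

(** Here the sign is fixed by monicity, and every polynomial has the full degree [m.+1]; only the
    reducible ones are lost, with at most [m.+1] roots each. *)
Lemma Omega_bounds m : exists2 C, (0 < C)%N &
  forall (Q : R) I, 1 <= Q -> forall K, K = Num.truncn Q ->
  (Omega m.+1 Q I <= monicsum m K I
    <= Omega m.+1 Q I + m.+1 * (m * bad_bound m C K))%N.
Proof.
have [C C0 HC] := count_monic_splits m; exists C => // Q I Q1 _ ->.
set K := Num.truncn Q; have Q0 : 0 <= Q by exact: le_trans Q1.
have K0 : (0 < K)%N by rewrite truncn_gt0.
rewrite OmegaE// -/K /monicsum [X in (_ <= X <= _)%N](bigID (irrmonic m))/=.
rewrite leq_addr leq_add2l/=.
rewrite -(big_map (fun r : {poly int} => 'X^(m.+1) + r)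
  (fun p => ~~ `[< irreducible_poly (pZtoQ p) >]) (fun p => zroots I p)).
rewrite -big_filter; set s := [seq _ <- _ | _].
have sP p : p \in s ->
    [/\ p \in polybox m.+2 K, p \is monic, size p = m.+2 & splits p].
  rewrite mem_filter => /andP[/asboolP ip /mapP[r /polyboxP[sr hr] pE]].
  have sX : (size r < size ('X^(m.+1) : {poly int}))%N by rewrite size_polyXn.
  have sp : size p = m.+2 by rewrite pE size_polyDl// size_polyXn.
  split => //.
  - apply/polyboxP; split => [|i]; first by rewrite sp.
    rewrite pE coefD coefXn; case: eqP => [->|_]; last by rewrite add0r.
    by rewrite [r`__]nth_default// addr0.
  - by rewrite pE monicE lead_coefDl// lead_coefXn.
  - by apply: not_irreducible_splits; rewrite ?sp.
apply: (leq_trans (@sum_zroots_le _ m.+1 I _)).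
  by move=> p /sP[_ _ ->].
rewrite leq_mul2l; apply/orP; right; apply: HC => //.
by apply: filter_uniq; rewrite map_inj_uniq ?uniq_polybox//; exact: addrI.
Qed.

End bounds.

(** * Integer level sets of a polynomial *)

Section counting.
Context {R : realType}.
Implicit Types (f : {poly R}).
Local Notation mu := (@lebesgue_measure R).

(** Leaving [P] free at [i = u] covers the strict and the non-strict inequality at once. *)
Lemma count_iota_le (N : nat) (u : R) (P : pred nat) : 0 <= u -> u <= N%:R ->
  (forall i, i%:R < u -> P i) -> (forall i, P i -> i%:R <= u) ->
  u <= (count P (iota 0 N.+1))%:R <= u + 1.
Proof.
move=> u0 uN Plt Ple; set n := Num.truncn u.
have /andP[nu un] : n%:R <= u < n.+1%:R by rewrite truncn_itv.
have nN : (n <= N)%N by rewrite -(ler_nat R) (le_trans nu).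
rewrite -(subnKC (_ : n.+1 <= N.+1)%N)// iotaD count_cat.
rewrite [X in (_ + X)%N](_ : _ = 0%N); last first.
  apply/eqP; rewrite -leqn0 leqNgt -has_count; apply/hasP => -[i].
  rewrite mem_iota add0n => /andP[ni _] /Ple iu.
  by move: (le_lt_trans iu un); rewrite ltr_nat ltnNge ni.
rewrite addn0 -[n.+1]addn1 iotaD count_cat /= add0n addn0.
have -> : count P (iota 0 n) = n.
  rewrite -[RHS](size_iota 0 n); apply/eqP; rewrite -all_count; apply/allP => i.
  rewrite mem_iota => /andP[_ ni]; apply: Plt; apply: lt_le_trans nu.
  by rewrite ltr_nat.
have : P n = false -> u <= n%:R by move=> /negP nP; rewrite leNgt; apply/negP => /Plt.
rewrite natrD; move: un; rewrite -addn1 natrD; case: (P n) => /= ? H; lra.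
Qed.

Lemma count_ints_between (K : nat) (x y : R) :
  - K%:R <= x -> x < y -> y <= K%:R ->
  `|(\sum_(c <- ints K) (x < - c%:~R < y)%R)%N%:R - (y - x)| <= 1.
Proof.
move=> Kx xy yK; rewrite /ints big_map.
set s := iota 0 K.*2.+1.
set A := (X in X%:R - _); set B := count (fun i : nat => i%:R <= K%:R - y) s.
(* For [c = i - K] the condition [x < - c < y] reads [K - y < i < K - x]: a difference of two
   initial segments, each counted with an excess in [0, 1], so the errors do not add up. *)
have AB : (A + B = count (fun i : nat => (i%:R < K%:R - x)%R) s)%N.
  rewrite /A /B -!sum1_count ![X in (_ + X)%N]big_mkcond [RHS]big_mkcond -big_split/=.
  apply: eq_bigr => i _.
  have -> : - (i%:Z - K%:Z)%:~R = K%:R - i%:R :> R by rewrite rmorphB/= opprB.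
  have -> : (x < K%:R - i%:R) = (i%:R < K%:R - x) by apply/idP/idP; lra.
  have -> : (K%:R - i%:R < y) = ~~ (i%:R <= K%:R - y) by rewrite -ltNge; apply/idP/idP; lra.
  have : i%:R <= K%:R - y -> i%:R < K%:R - x by lra.
  by case: (i%:R < _ - x); case: (i%:R <= _ - y) => //= /(_ isT).
have K2 : K.*2%:R = K%:R + K%:R :> R by rewrite -addnn natrD.
have : K%:R - y <= B%:R <= K%:R - y + 1.
  by apply: count_iota_le; rewrite ?K2//; [lra|lra|move=> i; exact: ltW].
have : K%:R - x <= (A + B)%:R <= K%:R - x + 1.
  by rewrite AB; apply: count_iota_le; rewrite ?K2//; [lra|lra|move=> i; exact: ltW].
by rewrite natrD ler_norml; lra.
Qed.

End counting.

(** * The integral of |f'| over |f| <= Q, and level counts on monotone pieces *)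

Section area.
Context {R : realType}.
Implicit Types (f : {poly R}).
Local Notation mu := (@lebesgue_measure R).

(** One-dimensional Kac-Rice integrand: its integral [area] is the length, with multiplicity, of the
    part of the image of [f] lying in [-Q, Q]. *)
Definition dens (Q : R) f (t : R) : R :=
  if `|f.[t]| <= Q then `|f^`().[t]| else 0.

Definition area (a b Q : R) f : R :=
  (\int[mu]_(t in `]a, b[) dens Q f t)%R.

Lemma dens_ge0 Q f t : 0 <= dens Q f t.
Proof. by rewrite /dens; case: ifP. Qed.

Lemma measurable_dens Q f D : measurable_fun D (dens Q f).
Proof.
apply: measurable_funTS; apply: measurable_fun_ifT => //.
  apply: measurable_fun_ler => //; apply: measurableT_comp => //.
  exact: measurable_poly.
by apply: measurableT_comp => //; exact: measurable_poly.
Qed.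

Lemma normr_horner_le f (t T : R) : `|t| <= T ->
  `|f.[t]| <= \sum_(i < size f) `|f`_i| * T ^+ i.
Proof.
move=> tT; rewrite horner_coef (le_trans (ler_norm_sum _ _ _))//.
apply: ler_sum => i _; rewrite normrM ler_wpM2l// normrX lerXn2r ?nnegrE//.
exact: le_trans tT.
Qed.

Lemma itv_norm_le (a b t : R) : t \in `]a, b[ -> `|t| <= `|a| + `|b|.
Proof.
rewrite in_itv/= => /andP[at_ tb]; rewrite ler_norml.
have := ler_norm b; have := lerNnormlW (lexx `|a|); have := normr_ge0 a.
have := normr_ge0 b; lra.
Qed.

Lemma integrable_dens a b Q f : mu.-integrable `]a, b[ (EFin \o dens Q f).
Proof.
apply: measurable_bounded_integrable => //=.
- by rewrite lebesgue_measure_itv/=; case: ifP => // _; rewrite -EFinB ltry.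
- exact: measurable_dens.
- exists (\sum_(i < size f^`()) `|f^`()`_i| * (`|a| + `|b|) ^+ i); split => //=.
  move=> M bM t /= /itv_norm_le tab; rewrite ger0_norm ?dens_ge0//.
  apply: le_trans (ltW bM); rewrite /dens; case: ifP => _.
    exact: normr_horner_le.
  by apply: sumr_ge0 => i _; rewrite mulr_ge0// exprn_ge0// addr_ge0.
Qed.

Lemma area_ge0 a b Q f : 0 <= area a b Q f.
Proof. by apply: Rintegral_ge0 => t _; exact: dens_ge0. Qed.

Lemma areaN a b Q f : area a b Q (- f) = area a b Q f.
Proof. by apply: eq_Rintegral => t _; rewrite /dens derivN !hornerN !normrN. Qed.

Lemma area_split a r b Q f : a < r -> r < b ->
  area a b Q f = area a r Q f + area r b Q f.
Proof.
move=> ar rb; rewrite /area.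
have -> : `]a, b[%classic = `]a, r]%classic `|` `]r, b[%classic.
  by rewrite -itv_bndbnd_setU// bnd_simp ltW.
rewrite Rintegral_setU//.
- by rewrite -Rintegral_itv_bndo_bndc//; exact: integrable_dens.
- rewrite -itv_bndbnd_setU ?bnd_simp ?ltW//; exact: integrable_dens.
- apply/disj_setPS => t [/=]; rewrite !in_itv/= => /andP[_ tr] /andP[rt _].
  by move: (lt_le_trans rt tr); rewrite ltxx.
Qed.

Lemma area_outside a b Q f : {in `]a, b[, forall t, Q < `|f.[t]|} ->
  area a b Q f = 0.
Proof.
move=> out; transitivity (\int[mu]_(t in `]a, b[) (0 : R))%R.
  apply: eq_Rintegral => t /set_mem/= /out ft; rewrite /dens leNgt ft//.
by rewrite Rintegral_cst// mul0r.
Qed.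

Lemma area_inside a b Q f : a < b -> {in `]a, b[, forall t, `|f.[t]| <= Q} ->
  {in `]a, b[, forall t, 0 < f^`().[t]} -> area a b Q f = f.[b] - f.[a].
Proof.
move=> ab fQ f'0; rewrite /area.
transitivity (\int[mu]_(t in `]a, b[) f^`().[t])%R.
  apply: eq_Rintegral => t /set_mem/= tab; rewrite /dens fQ// gtr0_norm//; exact: f'0.
rewrite /Rintegral -(@integral_itv_bndoo R a b _ true false); last first.
  by apply/measurable_EFinP; exact: measurable_poly.
rewrite (@continuous_FTC2 _ (horner f^`()) (horner f))//=.
- by apply: continuous_subspaceT => x; exact: continuous_horner.
- split.
  + by move=> x _; exact: derivable_horner.
  + by apply: cvg_at_right_filter; exact: continuous_horner.
  + by apply: cvg_at_left_filter; exact: continuous_horner.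
- by move=> x _; rewrite -derivE.
Qed.

Lemma horner_sign (g : {poly R}) a b : {in `]a, b[, forall t, g.[t] != 0} ->
  {in `]a, b[, forall t, 0 < g.[t]} \/ {in `]a, b[, forall t, g.[t] < 0}.
Proof.
move=> g0.
have key (h : {poly R}) s t : {in `]a, b[, forall t, h.[t] != 0} -> s \in `]a, b[ ->
    t \in `]a, b[ -> s <= t -> h.[s] <= 0 -> 0 <= h.[t] -> False.
  move=> h0 sab tab st hs ht; have [|c /andP[sc ct] hc] := @poly_ivt _ h s t st.
    by rewrite hs ht.
  have : c \in `]a, b[.
    move: sab tab; rewrite !in_itv/= => /andP[? _] /andP[_ ?].
    by rewrite (lt_le_trans _ sc)// (le_lt_trans ct).
  by move/h0; rewrite (eqP hc) eqxx.
have [neg|] := pselect ({in `]a, b[, forall t, g.[t] < 0}); first by right.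
move=> nneg; left => t tab; rewrite ltNge; apply/negP => gt.
apply: nneg => s sab; rewrite ltNge; apply/negP => gs.
have [st|ts] := leP s t; last exact: (key g t s g0 tab sab (ltW ts) gt gs).
apply: (key (- g) s t _ sab tab st) => [u /g0||]; rewrite hornerN ?oppr_eq0//.
  by rewrite oppr_le0.
by rewrite oppr_ge0.
Qed.

Lemma horner_incr f a b : {in `]a, b[, forall t, 0 < f^`().[t]} ->
  forall x y, a <= x -> x < y -> y <= b -> f.[x] < f.[y].
Proof.
move=> f'0; apply: gtr0_derive1_incr.
- by move=> x _; exact: derivable_horner.
- by move=> x /f'0; rewrite derivE.
- by apply: continuous_subspaceT => x; exact: continuous_horner.
Qed.

Lemma rootcount_incr f (a b c : R) : a < b ->
  {in `]a, b[, forall t, 0 < f^`().[t]} ->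
  rootcount `]a, b[ (f + c%:P) = (f.[a] < - c < f.[b]) :> nat.
Proof.
move=> ab f'0; have inc := horner_incr f'0.
have fc0 : f + c%:P != 0.
  apply/eqP => fc; have m : (a + b) / 2 \in `]a, b[ by rewrite in_itv/=; apply/andP; split; lra.
  have := f'0 _ m; have -> : f = - c%:P by apply/eqP; rewrite -subr_eq0 opprK fc.
  by rewrite derivN derivC oppr0 horner0 ltxx.
rewrite /rootcount (negbTE fc0).
case: (boolP (_ < _ < _)) => [/andP[ac cb]|nac] /=; last first.
  rewrite (_ : _ `&` _ = set0) ?fset_set0 ?cardfs0// -subset0 => t /=.
  rewrite in_itv/= rootE hornerD hornerC addr_eq0 => -[/andP[at_ tb] /eqP ft].
  by move: nac; rewrite -ft !inc// ltW.
have [|t /andP[at_ tb] ft] := @poly_ivt _ (f + c%:P) a b (ltW ab).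
  by rewrite !hornerD !hornerC; lra.
have {}ft : f.[t] = - c by move: ft; rewrite rootE hornerD hornerC addr_eq0 => /eqP.
have {}at_ : a < t by rewrite lt_neqAle at_ andbT; apply: contraTneq ac => ->; rewrite ft ltxx.
have {}tb : t < b by rewrite lt_neqAle tb andbT; apply: contraTneq cb => <-; rewrite ft ltxx.
rewrite (_ : _ `&` _ = [set t]) ?fset_set1 ?cardfs1//.
apply/seteqP; split=> s /= => [|->]; last first.
  by rewrite in_itv/= at_ tb rootE hornerD hornerC ft addNr.
rewrite in_itv/= rootE hornerD hornerC addr_eq0 -ft => -[/andP[as_ sb] /eqP fst].
have [st|ts|//] := ltgtP s t.
  by have := inc s t (ltW as_) st (ltW tb); rewrite fst ltxx.
by have := inc t s (ltW at_) ts (ltW sb); rewrite fst ltxx.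
Qed.

Definition levelcount (I : set R) K f : nat :=
  (\sum_(c <- ints K) rootcount I (f + (c%:~R)%:P))%N.

Lemma levelcountN I K f : levelcount I K (- f) = levelcount I K f.
Proof.
have oK : perm_eq (map -%R (ints K)) (ints K).
  apply: uniq_perm; [by rewrite map_inj_uniq ?uniq_ints//; exact: oppr_inj|exact: uniq_ints|].
  move=> c; rewrite mem_ints; apply/mapP/idP => [[d]|cK].
    by rewrite mem_ints => ? ->; rewrite abszN.
  by exists (- c); rewrite ?mem_ints ?abszN ?opprK.
rewrite /levelcount -(perm_big _ oK) big_map; apply: eq_bigr => c _.
by rewrite rmorphN/= polyCN -opprD rootcountN.
Qed.

(** On such a piece [f] is strictly monotone, and |f| stays on one side of [K]. Either both
    quantities vanish, or they are the number of integers strictly between f(a) and f(b) and the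
    length of that interval. Both are invariant under [f -> - f], so [f] may be taken increasing. *)
Lemma levelcount_piece a b K f : a < b ->
  {in `]a, b[, forall t, f^`().[t] != 0} ->
  {in `]a, b[, forall t, f.[t] != K%:R} ->
  {in `]a, b[, forall t, f.[t] != - K%:R} ->
  `|(levelcount `]a, b[ K f)%:R - area a b K%:R f| <= 1.
Proof.
move=> ab; wlog : f / {in `]a, b[, forall t, 0 < f^`().[t]}.
  move=> H f'0 fK fNK; have [f'p|f'n] := horner_sign f'0; first exact: H.
  rewrite -levelcountN -areaN; apply: H => t tab; rewrite ?derivN hornerN.
  - by rewrite oppr_gt0 f'n.
  - by rewrite oppr_eq0 f'0.
  - by rewrite -subr_eq0 -opprD oppr_eq0 addrC -[X in X + _]opprK addrC subr_eq0 fNK.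
  - by rewrite eqr_opp fK.
move=> f'0 _ fK fNK; have inc := horner_incr f'0.
have cntE : levelcount `]a, b[ K f =
    (\sum_(c <- ints K) (f.[a] < - c%:~R < f.[b])%R)%N.
  by apply: eq_bigr => c _; rewrite rootcount_incr.
have out : {in `]a, b[, forall t, K%:R < `|f.[t]|} ->
    `|(levelcount `]a, b[ K f)%:R - area a b K%:R f| <= 1.
  move=> fout; rewrite area_outside// subr0.
  rewrite /levelcount big_seq big1 ?normr0 ?ler01// => c; rewrite mem_ints => cK.
  rewrite /rootcount; case: ifP => // _.
  rewrite (_ : _ `&` _ = set0) ?fset_set0 ?cardfs0// -subset0 => t /= [tab].
  rewrite rootE hornerD hornerC addr_eq0 => /eqP ft; have := fout _ tab.
  by rewrite ft normrN -intr_norm -[K%:R]/(K%:Z%:~R) ltr_int; lia.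
have sgnK (k : R) : {in `]a, b[, forall t, f.[t] != k} ->
    {in `]a, b[, forall t, k < f.[t]} \/ {in `]a, b[, forall t, f.[t] < k}.
  move=> fk; have [t tab|gp|gn] := @horner_sign (f - k%:P) a b.
  - by rewrite hornerD hornerN hornerC subr_eq0 fk.
  - by left => t /gp; rewrite hornerD hornerN hornerC subr_gt0.
  - by right => t /gn; rewrite hornerD hornerN hornerC subr_lt0.
have [fgt|flt] := sgnK _ fK.
  by apply: out => t /fgt ft; rewrite (lt_le_trans ft)// ler_norm.
have [gtf|ltf] := sgnK _ fNK; last first.
  by apply: out => t /ltf ft; rewrite -normrN (lt_le_trans _ (ler_norm _))// ltrNr.
have mab : (a + b) / 2 \in `]a, b[ by rewrite in_itv/=; apply/andP; split; lra.
have fin : {in `]a, b[, forall t, `|f.[t]| <= K%:R}.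
  by move=> t tab; rewrite ler_norml !ltW ?gtf ?flt.
rewrite area_inside// cntE; apply: count_ints_between.
(* The bound [- K < f] is known only inside the interval; f(a) < - K would force an interior point
   with value [- K]. *)
- rewrite leNgt; apply/negP => faK.
  have [||t /andP[at_ tm] /eqP] := @poly_ivt _ (f + K%:R%:P) a ((a + b) / 2).
  + lra.
  + by rewrite !hornerD !hornerC; have := gtf _ mab; lra.
  rewrite hornerD hornerC => ft.
  have : a != t by apply/eqP => at'; move: faK; rewrite at'; lra.
  move=> at'; have : t \in `]a, b[.
    by rewrite in_itv/= lt_neqAle at' at_/=; move: ab tm; lra.
  by move/gtf; lra.
- exact: inc.
- rewrite leNgt; apply/negP => fbK.
  have [||t /andP[mt tb] /eqP] := @poly_ivt _ (f - K%:R%:P) ((a + b) / 2) b.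
  + lra.
  + by rewrite !hornerD !hornerN !hornerC; have := flt _ mab; lra.
  rewrite hornerD hornerN hornerC => ft.
  have : t != b by apply/eqP => tb'; move: fbK; rewrite -tb'; lra.
  move=> tb'; have : t \in `]a, b[.
    by rewrite in_itv/= lt_neqAle [in X in _ && X]lt_neqAle tb' tb/=; move: ab mt; lra.
  by move/flt; lra.
Qed.

End area.

(** * Cutting an interval into monotone pieces *)

Section levelcount.
Context {R : realType}.
Implicit Types (f : {poly R}) (I J : set R).

Lemma levelcountU I J K f : I `&` J = set0 ->
  levelcount (I `|` J) K f = (levelcount I K f + levelcount J K f)%N.
Proof.
by move=> IJ; rewrite /levelcount -big_split; apply: eq_bigr => c _; exact: rootcountU.
Qed.

Lemma levelcountS I J K f : I `<=` J -> (levelcount I K f <= levelcount J K f)%N.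
Proof. by move=> IJ; apply: leq_sum => c _; exact: rootcountS. Qed.

Lemma levelcount1 r K f : (levelcount [set r] K f <= 1)%N.
Proof.
apply: (@leq_trans (count (fun c : int => c%:~R == - f.[r]) (ints K))).
  rewrite -sum1_count [leqRHS]big_mkcond; apply: leq_sum => c _.
  have -> : rootcount [set r] (f + (c%:~R)%:P) =
      (f + (c%:~R)%:P != 0) && (c%:~R == - f.[r]) :> nat.
    by rewrite rootcount1 rootE hornerD hornerC [f.[r] + _]addrC (addr_eq0 c%:~R).
  by case: (_ == - _); rewrite ?andbF// ?leq_b1.
have [/hasP[c0 c0K /eqP c0f]|] := boolP (has (fun c : int => c%:~R == - f.[r]) (ints K)).
  rewrite (@eq_count _ _ (pred1 c0)); last by move=> c /=; rewrite -c0f eqr_int.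
  by rewrite count_uniq_mem ?uniq_ints//; case: (_ \in _).
by rewrite has_count -eqn0Ngt => /eqP ->.
Qed.

Lemma itvoo_split (a r b : R) : a < r -> r < b ->
  `]a, b[%classic = `]a, r[%classic `|` ([set r] `|` `]r, b[%classic).
Proof.
move=> ar rb; apply/seteqP; split=> t /=; rewrite !in_itv/=.
  move=> /andP[at_ tb]; have [tr|rt|->] := ltgtP t r; last by right; left.
    by left; apply/andP.
  by right; right; apply/andP.
move=> [/andP[at_ tr]|[->|/andP[rt tb]]]; apply/andP; split=> //.
- exact: lt_trans rb.
- exact: lt_trans rt.
Qed.

Lemma itvoo_splitI (a r b : R) :
  ([set r] `&` `]r, b[%classic = set0) *
  (`]a, r[%classic `&` ([set r] `|` `]r, b[%classic) = set0).
Proof.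
split; rewrite -subset0 => t /=; rewrite !in_itv/=.
  by move=> [->]; rewrite ltxx.
move=> [/andP[_ tr]] [tr'|/andP[rt _]]; first by rewrite tr' ltxx in tr.
by have := lt_trans tr rt; rewrite ltxx.
Qed.

(** Its roots are the points where the hypotheses of [levelcount_piece] fail. *)
Definition breakpoly K f := f^`() * ((f - K%:R%:P) * (f + K%:R%:P)).

Lemma breakpoly_neq0 (K : nat) f : f^`() != 0 -> breakpoly K f != 0.
Proof.
move=> f'0; rewrite !mulf_neq0//; apply: contra_neq f'0 => /eqP.
  by rewrite subr_eq0 => /eqP ->; rewrite derivC.
by rewrite addr_eq0 => /eqP ->; rewrite derivN derivC oppr0.
Qed.

Lemma size_breakpoly (K : nat) f : (size (breakpoly K f) <= 3 * size f)%N.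
Proof.
have s1 (c : R) : (size (f + c%:P)%R <= maxn (size f) 1)%N.
  by rewrite (leq_trans (size_polyD _ _))// geq_max leq_maxl (leq_trans (size_polyC_leq1 _))// leq_maxr.
have s2 := s1 K%:R; have s3 := s1 (- K%:R); rewrite polyCN in s3.
rewrite /breakpoly; have [f0|f0] := eqVneq (size f) 0%N.
  by move/eqP: f0; rewrite size_poly_eq0 => /eqP ->; rewrite deriv0 mul0r size_poly0.
have d1 := lt_size_deriv (_ : f != 0); rewrite -size_poly_eq0 in d1.
have {}d1 := d1 f0.
apply: (leq_trans (size_polyMleq _ _)); have := size_polyMleq (f - K%:R%:P) (f + K%:R%:P).
move: s2 s3 d1 f0.
set g := f - _; set h := f + _; set gh := g * h.
move: (size gh) (size h) (size g) (size f) (size f^`()) => *; lia.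
Qed.

(** With [n] cut points there are at most [n + 1] pieces, each with error at most 1, and each cut
    point carries at most one root by [levelcount1]: in total [2 n + 1]. The induction cuts at one
    root and splits the remaining ones between the two sides. *)
Lemma levelcount_area_oo n (a b : R) K f : a < b -> f^`() != 0 ->
  (rootcount `]a, b[ (breakpoly K f) <= n)%N ->
  `|(levelcount `]a, b[ K f)%:R - area a b K%:R f| <= n.*2.+1%:R.
Proof.
move=> + f'0; elim/ltn_ind: n a b => n IH a b ab gn.
have [[r rab gr]|noroot] := pselect (exists2 r, r \in `]a, b[ & root (breakpoly K f) r); last first.
  apply: (@le_trans _ _ 1); last by rewrite ler1n.
  have nr t : t \in `]a, b[ -> (breakpoly K f).[t] != 0.
    by move=> tab; apply/negP => gt; apply: noroot; exists t.
  apply: levelcount_piece => // t /nr; rewrite /breakpoly !hornerM !mulf_eq0 !negb_or.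
  - by case/andP.
  - by move=> /and3P[_ + _]; rewrite hornerD hornerN hornerC subr_eq0.
  - by move=> /and3P[_ _]; rewrite hornerD hornerC addr_eq0.
have /andP[ar rb] : a < r < b by move: rab; rewrite in_itv.
move: gn; rewrite (itvoo_split ar rb) rootcountU ?itvoo_splitI// rootcountU ?itvoo_splitI//.
rewrite rootcount1 breakpoly_neq0// gr /= => gn.
set k1 := rootcount _ _ in gn; set k2 := rootcount `]r, b[ _ in gn.
have k1n : (k1 < n)%N by lia.
have k2n : (k2 < n)%N by lia.
have := IH k1 k1n a r ar (leqnn _); have := IH k2 k2n r b rb (leqnn _).
rewrite levelcountU ?itvoo_splitI// levelcountU ?itvoo_splitI// (area_split _ _ ar rb).
have : (k1.*2.+1 + 1 + k2.*2.+1 <= n.*2.+1)%N by lia.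
rewrite -(ler_nat R) !natrD.
have := ler0n R (levelcount [set r] K f).
have : (levelcount [set r] K f)%:R <= 1 :> R by rewrite lern1 levelcount1.
by rewrite !ler_norml; lra.
Qed.

(** The constant is [2 (3 * size f) + 1], plus 2 for the endpoints, which the booleans include or
    exclude. *)
Lemma levelcount_area (i j : bool) (a b : R) K f : a < b -> f^`() != 0 ->
  `|(levelcount [set` Interval (BSide i a) (BSide j b)] K f)%:R - area a b K%:R f|
    <= (6 * size f).+3%:R.
Proof.
move=> ab f'0; set I := [set` _].
have le1 := levelcountS K f (_ : `]a, b[%classic `<=` I).
have le2 := levelcountS K f (_ : I `<=` [set a] `|` (`]a, b[%classic `|` [set b])).
have {}le1 : (levelcount `]a, b[ K f <= levelcount I K f)%N.
  apply: le1 => t /=; rewrite /I/= !in_itv/= => /andP[at_ tb].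
  by apply/andP; split; [case: (i)|case: (j)]; rewrite //= ltW.
have {}le2 : (levelcount I K f <= levelcount `]a, b[ K f + 2)%N.
  apply: (leq_trans (le2 _)).
    move=> t; rewrite /I/= itv_boundlr => /andP[at_ tb].
    have {}at_ : a <= t by move: at_; case: (i); rewrite bnd_simp// => /ltW.
    have {}tb : t <= b by move: tb; case: (j); rewrite bnd_simp// => /ltW.
    have [->|ta] := eqVneq t a; [by left|right].
    have [->|tb'] := eqVneq t b; [by right|left].
    by rewrite in_itv/= !lt_neqAle eq_sym ta at_ tb' tb.
  rewrite !levelcountU.
  - by have := levelcount1 a K f; have := levelcount1 b K f; lia.
  - by rewrite -subset0 => t /= []; rewrite in_itv/= => /andP[_ /[swap] ->]; rewrite ltxx.
  - rewrite -subset0 => t /= [->] []; rewrite ?in_itv/= ?ltxx// => ab'.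
    by rewrite ab' ltxx in ab.
have := @levelcount_area_oo (3 * size f) a b K f ab f'0.
have -> : (rootcount `]a, b[ (breakpoly K f) <= 3 * size f)%N.
  by rewrite (leq_trans (rootcount_le _ _))// (leq_trans (leq_pred _))// size_breakpoly.
move=> /(_ isT); move: le1 le2; rewrite -!(ler_nat R) natrD.
have -> : (6 * size f).+3%:R = (3 * size f).*2.+1%:R + 2 :> R.
  by rewrite -natrD; congr (_%:R); lia.
by rewrite !ler_norml; lra.
Qed.

End levelcount.

(** * Riemann sums over coefficient vectors *)

Section pol.
Context {R : realType}.
Local Notation mu := (@lebesgue_measure R).

(** No constant term: that is the coefficient whose variation is replaced by an integral. The extra
    leading coefficient [e] stands for [c / K] and tends to 0. *)
Definition pol m (e : R) (q : 'I_m -> R) : {poly R} :=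
  \sum_(k < m) q k *: 'X^(k.+1) + e *: 'X^(m.+1).

Lemma horner_pol m e (q : 'I_m -> R) t :
  (pol e q).[t] = \sum_(k < m) q k * t ^+ k.+1 + e * t ^+ m.+1.
Proof.
rewrite /pol hornerD horner_sum hornerZ hornerXn; congr (_ + _).
by apply: eq_bigr => k _; rewrite hornerZ hornerXn.
Qed.

Lemma horner_deriv_pol m e (q : 'I_m -> R) t :
  (pol e q)^`().[t] =
  \sum_(k < m) k.+1%:R * q k * t ^+ k + m.+1%:R * e * t ^+ m.
Proof.
rewrite /pol derivD linear_sum hornerD horner_sum; congr (_ + _).
  apply: eq_bigr => k _; rewrite /= derivZ derivXn hornerZ hornerMn hornerXn/=.
  by rewrite -mulr_natl mulrCA mulrA.
by rewrite derivZ derivXn hornerZ hornerMn hornerXn/= -mulr_natl mulrCA mulrA.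
Qed.

Definition densbound m (T : R) : R := \sum_(k < m.+1) k.+1%:R * T ^+ k.

Lemma densbound_ge0 m T : 0 <= T -> 0 <= densbound m T.
Proof. by move=> T0; apply: sumr_ge0 => k _; rewrite mulr_ge0// exprn_ge0. Qed.

Lemma dens_pol_le m e (q : 'I_m -> R) Q t T : (forall k, `|q k| <= 1) ->
  `|e| <= 1 -> `|t| <= T -> dens Q (pol e q) t <= densbound m T.
Proof.
move=> q1 e1 tT; have T0 : 0 <= T by exact: le_trans tT.
rewrite /dens; case: ifP => _; last exact: densbound_ge0.
rewrite horner_deriv_pol /densbound big_ord_recr/= (le_trans (ler_normD _ _))//.
have term (k : nat) (x : R) : `|x| <= 1 -> `|k.+1%:R * x * t ^+ k| <= k.+1%:R * T ^+ k.
  move=> x1; rewrite !normrM normr_nat normrX -mulrA ler_wpM2l//.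
  by rewrite -[leRHS]mul1r ler_pM// ?exprn_ge0// lerXn2r// nnegrE.
rewrite lerD ?term// (le_trans (ler_norm_sum _ _ _))//.
by apply: ler_sum => k _; exact: term.
Qed.

Definition areabound m (a b : R) : R := densbound m (`|a| + `|b|) * (b - a).

Lemma area_pol_le m e (q : 'I_m -> R) a b Q : (forall k, `|q k| <= 1) ->
  `|e| <= 1 -> a < b -> area a b Q (pol e q) <= areabound m a b.
Proof.
move=> q1 e1 ab; set M := densbound m (`|a| + `|b|).
have M0 : 0 <= M by rewrite densbound_ge0// addr_ge0.
apply: (@le_trans _ _ (\int[mu]_(t in `]a, b[) M)%R).
  apply: le_Rintegral => //=.
  - exact: integrable_dens.
  - apply: measurable_bounded_integrable => //=.
    + by rewrite lebesgue_measure_itv/=; case: ifP => // _; rewrite -EFinB ltry.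
    + by exists M; split; rewrite ?num_real// => N MN t _ /=; rewrite ger0_norm// ltW.
  - by move=> t tab; apply: dens_pol_le => //; exact: itv_norm_le.
rewrite Rintegral_cst//.
have E : mu `]a, b[%classic = (b - a)%:E.
  by rewrite lebesgue_measure_itv/= lte_fin ab EFinB.
rewrite /areabound -[b - a]/(fine (b - a)%:E) -E; exact: lexx.
Qed.

Lemma cvg_sumr {I : Type} (s : seq I) (u : I -> nat -> R) (v : I -> R) :
  (forall i, u i n @[n --> \oo] --> v i) ->
  \sum_(i <- s) u i n @[n --> \oo] --> \sum_(i <- s) v i.
Proof.
move=> uv; elim: s => [|i s IH].
  by rewrite big_nil; under eq_cvg do rewrite big_nil; exact: cvg_cst.
by rewrite big_cons; under eq_cvg do rewrite big_cons; exact: cvgD.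
Qed.

Section continuity.
Variables (m : nat) (e_ : nat -> R) (e : R) (q_ : nat -> 'I_m -> R) (q : 'I_m -> R).
Hypothesis (e1 : forall n, `|e_ n| <= 1) (q1 : forall n k, `|q_ n k| <= 1).
Hypothesis (ecvg : e_ n @[n --> \oo] --> e).
Hypothesis (qcvg : forall k, q_ n k @[n --> \oo] --> q k).

Lemma cvg_horner_pol t : (pol (e_ n) (q_ n)).[t] @[n --> \oo] --> (pol e q).[t].
Proof.
rewrite horner_pol; under eq_cvg do rewrite horner_pol.
apply: cvgD; last exact: cvgMr_tmp.
by apply: cvg_sumr => k; exact: cvgMr_tmp.
Qed.

Lemma cvg_horner_deriv_pol t :
  (pol (e_ n) (q_ n))^`().[t] @[n --> \oo] --> (pol e q)^`().[t].
Proof.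
rewrite horner_deriv_pol; under eq_cvg do rewrite horner_deriv_pol.
apply: cvgD; last by apply: cvgMr_tmp; exact: cvgMl_tmp.
by apply: cvg_sumr => k; apply: cvgMr_tmp; exact: cvgMl_tmp.
Qed.

(** Away from |f(t)| = Q the condition |f(t)| <= Q is stable under small changes of the
    coefficients; at equality it need not be. *)
Lemma cvg_dens_pol Q t : `|(pol e q).[t]| != Q ->
  dens Q (pol (e_ n) (q_ n)) t @[n --> \oo] --> dens Q (pol e q) t.
Proof.
have cp := cvg_norm (@cvg_horner_pol t).
rewrite neq_lt /dens => /orP[ltQ|Qlt].
  rewrite ltW//; apply: cvg_trans (cvg_norm (@cvg_horner_deriv_pol t)).
  apply: near_eq_cvg; near=> n; rewrite ifT// ltW//.
  by near: n; apply: cvgr_lt ltQ; exact: cp.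
rewrite leNgt Qlt/=; apply: cvg_near_cst; near=> n.
rewrite ifF//; apply/negbTE; rewrite -ltNge.
by near: n; apply: cvgr_gt Qlt; exact: cp.
Unshelve. all: by end_near. Qed.

(** As [pol e q] vanishes at 0, it is not the constant [Q] or [- Q], so each of these levels is
    taken finitely often. The exceptional set in [cvg_area_pol] is therefore null. *)
Lemma pol_level_finite Q : 0 < Q -> finite_set [set t | `|(pol e q).[t]| = Q].
Proof.
move=> Q0.
have p0 c : c != 0 -> pol e q - c%:P != 0.
  move=> c0; apply: contra_neq c0 => /(congr1 (horner^~ 0)).
  rewrite hornerD hornerN hornerC horner0 horner_pol expr0n/= mulr0 addr0 big1.
    by rewrite sub0r => /eqP; rewrite oppr_eq0 => /eqP.
  by move=> k _; rewrite expr0n/= mulr0.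
apply: (@sub_finite_set _ _ ([set t | root (pol e q - Q%:P) t] `|`
                             [set t | root (pol e q - (- Q)%:P) t])).
  move: (pol e q) => p t /= ptQ; rewrite !rootE !hornerD !hornerN !hornerC !subr_eq0.
  by move: ptQ; case: ler0P => _ ptQ; [right|left]; rewrite -ptQ ?opprK.
by rewrite finite_setU; split; apply: finite_roots; apply: p0; rewrite ?oppr_eq0 gt_eqF.
Qed.

Lemma cvg_area_pol a b Q : 0 < Q ->
  area a b Q (pol (e_ n) (q_ n)) @[n --> \oo] --> area a b Q (pol e q).
Proof.
move=> Q0; apply: fine_cvg.
rewrite fineK; last exact: integrable_fin_num (integrable_dens _ _ _ _).
have := @dominated_convergence _ _ R mu `]a, b[%classic (measurable_itv _)
  (fun n t => (dens Q (pol (e_ n) (q_ n)) t)%:E) (fun t => (dens Q (pol e q) t)%:E)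
  (fun=> (densbound m (`|a| + `|b|))%:E).
case => //.
- by move=> n; apply/measurable_EFinP; exact: measurable_dens.
- by apply/measurable_EFinP; exact: measurable_dens.
- exists [set t | `|(pol e q).[t]| = Q]; split.
  + by apply: countable_measurable => [t|]; [exact: measurable_set1|apply: finite_set_countable; exact: pol_level_finite].
  + by apply: countable_lebesgue_measure0; apply: finite_set_countable; exact: pol_level_finite.
  + move=> t /= H; apply: contrapT => tQ; apply: H => tab.
    by apply: cvg_EFin; [near=> n|apply: cvg_dens_pol; apply/eqP].
- apply: measurable_bounded_integrable => //=.
  + by rewrite lebesgue_measure_itv/=; case: ifP => // _; rewrite -EFinB ltry.
  + set M := densbound _ _; exists M; split; rewrite ?num_real// => N MN t _ /=.
    by rewrite ger0_norm ?(ltW MN)// /M densbound_ge0// addr_ge0.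
- apply: aeW => t n tab /=; rewrite lee_fin ger0_norm ?dens_ge0//.
  by apply: dens_pol_le => //; exact: itv_norm_le.
Unshelve. all: by end_near. Qed.

End continuity.
End pol.

(** * The integral of phi as an average of areas over the unit cube *)

Section tonelli.
Context {R : realType}.
Local Notation T := (measurableTypeR R).
Local Notation mu := (@lebesgue_measure R).
Local Notation lam m := (@lebesgue_tuple R m).

Definition tpol m (e : R) (p : m.-tuple T) : {poly R} :=
  pol e (fun k => tnth p k : R).

Lemma measurable_box m (A : 'I_m -> set T) : (forall k, measurable (A k)) ->
  measurable [set p : m.-tuple T | forall k, A k (tnth p k)].
Proof.
move=> mA; rewrite (_ : [set p | _] =
    \bigcap_(k in [set: 'I_m]) (fun p : m.-tuple T => tnth p k) @^-1` A k).
  apply: fin_bigcap_measurable => // k _.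
  by rewrite -[X in measurable X]setTI; exact: measurable_tnth.
by apply/seteqP; split=> [p Ap k _|p Ap k]; [exact: Ap|exact: Ap k I].
Qed.

Definition cube m (c : R) : set (m.-tuple T) :=
  [set p | forall k : 'I_m, `[- c, c]%classic (tnth p k : R)].

Lemma measurable_cube m c : measurable (@cube m c).
Proof. by apply: (@measurable_box m (fun=> `[- c, c]%classic)). Qed.

Lemma lebesgue_cube m (c : R) : 0 <= c -> lam m (@cube m c) = ((c *+ 2) ^+ m)%:E.
Proof.
move=> c0; rewrite (@lebesgue_tuple_box R m (fun=> `[- c, c]%classic))//.
under eq_bigr do rewrite lebesgue_measure_itv/=.
rewrite -[in RHS](card_ord m) -prodr_const -prodEFin; apply: eq_bigr => k _.
rewrite lte_fin; case: ltP => [_|cN]; first by rewrite -EFinD opprK.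
by rewrite (_ : c = 0) ?mul0rn//; lra.
Qed.

Lemma cubeP m (p : m.-tuple T) c :
  cube c p <-> forall k : 'I_m, `|tnth p k : R| <= c.
Proof. by split=> H k; have := H k; rewrite /= in_itv/= ler_norml. Qed.

Lemma measurable_horner_tpol m : measurable_fun [set: T * m.-tuple T]
  (fun x => (tpol 0 x.2).[x.1 : R]).
Proof.
under eq_fun do rewrite horner_pol mul0r addr0.
apply: measurable_sum => k; apply: measurable_funM.
  exact: (measurableT_comp (measurable_tnth k) measurable_snd).
by apply: measurable_funX; exact: measurable_fst.
Qed.

Lemma measurable_horner_deriv_tpol m : measurable_fun [set: T * m.-tuple T]
  (fun x => (tpol 0 x.2)^`().[x.1 : R]).
Proof.
under eq_fun do rewrite horner_deriv_pol mulr0 mul0r addr0.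
apply: measurable_sum => k; apply: measurable_funM; last first.
  by apply: measurable_funX; exact: measurable_fst.
apply: measurable_funM => //.
exact: (measurableT_comp (measurable_tnth k) measurable_snd).
Qed.

Lemma measurable_dens_tpol m : measurable_fun [set: T * m.-tuple T]
  (fun x => dens 1 (tpol 0 x.2) (x.1 : R)).
Proof.
apply: measurable_fun_ifT => //.
  apply: measurable_fun_ler => //; apply: measurableT_comp => //.
  exact: measurable_horner_tpol.
by apply: measurableT_comp => //; exact: measurable_horner_deriv_tpol.
Qed.

(** The integrand of phi, extended by 0 to all pairs (t, p), so that Tonelli can exchange the
    integration in [t] with that over the coefficients. *)
Definition kacrice m (D : set R) (x : T * m.-tuple T) : \bar R :=
  (\1_(D `*` @cube m 1) x * dens 1 (tpol 0 x.2) (x.1 : R))%:E.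

Lemma measurable_kacrice m D : measurable D -> measurable_fun setT (@kacrice m D).
Proof.
move=> mD; apply/measurable_EFinP; apply: measurable_funM.
  by apply: measurable_indic; apply: measurableX => //; exact: measurable_cube.
exact: measurable_dens_tpol.
Qed.

Lemma kacrice_ge0 m D x : (0 <= @kacrice m D x)%E.
Proof. by rewrite lee_fin mulr_ge0// dens_ge0. Qed.

Lemma phiE m t : phi m t = (\int[lam m]_p @kacrice m setT (t, p))%E.
Proof.
rewrite /phi integral_mkcond; apply: eq_integral => p _.
rewrite /kacrice/= patchE indicE /dens horner_pol mul0r addr0.
rewrite horner_deriv_pol mulr0 mul0r addr0.
case: ifPn => [/set_mem[/cubeP p1 pt]|/negP pG].
  by rewrite pt mem_set ?mul1r.
case: ifPn => [pt|_]; last by rewrite mulr0.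
rewrite (_ : (t, p) \in _ = false) ?mul0r//; apply/negP => /set_mem[_ /= /cubeP p1].
by apply: pG; apply: mem_set; split.
Qed.

Lemma integral_phi m (D : set R) : measurable D ->
  (\int[mu]_(t in D) phi m t = \int[lam m]_p \int[mu]_t @kacrice m D (t, p))%E.
Proof.
move=> mD; rewrite -(@fubini_tonelli _ _ _ _ R mu (lam m) (@kacrice m D)); last 2 first.
- exact: measurable_kacrice.
- by move=> x; exact: kacrice_ge0.
rewrite integral_mkcond; apply: eq_integral => t _; rewrite patchE phiE.
case: ifPn => tD.
  apply: eq_integral => p _; rewrite /kacrice !indicE/=; congr (((nat_of_bool _)%:R * _)%:E).
  by apply/idP/idP => /set_mem[/= ? ?]; apply/mem_set; split => //=; exact: set_mem.
rewrite integral0_eq// => p _; rewrite /kacrice indicE.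
rewrite (_ : (t, p) \in _ = false) ?mul0r//; apply/negP => /set_mem[/= tD' _].
by move/negP: tD; apply; exact: mem_set.
Qed.

Definition cubearea m (a b : R) (p : m.-tuple T) : R :=
  \1_(@cube m 1) p * area a b 1 (tpol 0 p).

Lemma cubeareaE m a b p :
  (cubearea a b p)%:E = (\int[mu]_t @kacrice m `]a, b[%classic (t, p))%E.
Proof.
rewrite /cubearea /area EFinM /Rintegral fineK; last first.
  exact: integrable_fin_num (integrable_dens _ _ _ _).
rewrite -ge0_integralZl_EFin//; last 2 first.
- by move=> t _; rewrite lee_fin dens_ge0.
- by apply/measurable_EFinP; exact: measurable_dens.
rewrite integral_mkcond; apply: eq_integral => t _.
rewrite patchE /kacrice !indicE -EFinM.
case: ifPn => [tab|tab]; last first.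
  rewrite (_ : (t, p) \in _ = false) ?mul0r//; apply/negP => /set_mem[/= tD' _].
  by move/negP: tab; apply; exact: mem_set.
congr (((nat_of_bool _)%:R * _)%:E).
by apply/idP/idP => [/set_mem pc|/set_mem[/= _ pc]]; apply/mem_set => //; split => //=; exact: set_mem.
Qed.

Lemma measurable_cubearea m a b : measurable_fun setT (@cubearea m a b).
Proof.
apply/measurable_EFinP; rewrite (_ : EFin \o _ = fubini_G mu (@kacrice m `]a, b[%classic)).
  apply: measurable_fun_fubini_tonelli_G; first exact: measurable_kacrice.
  by move=> x; exact: kacrice_ge0.
by apply/funext => p; rewrite /= cubeareaE.
Qed.

Lemma integral_phi_itv m a b :
  (\int[mu]_(t in `]a, b[) phi m t = \int[lam m]_p (cubearea a b p)%:E)%E.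
Proof.
by rewrite integral_phi//; apply: eq_integral => p _; rewrite cubeareaE.
Qed.

End tonelli.

(** * Riemann sums as integrals of step functions *)

Section riemann.
Context {R : realType}.
Local Notation T := (measurableTypeR R).
Local Notation mu := (@lebesgue_measure R).
Local Notation lam m := (@lebesgue_tuple R m).

Definition scaled m K (r : {poly int}) : 'I_m -> R :=
  fun k => (r`_k)%:~R / K%:R.

(** Half-open, so that a point lies in exactly one cell, the one given by the floors of its scaled
    coordinates. *)
Definition cell m K (r : {poly int}) : set (m.-tuple T) :=
  [set p | forall k : 'I_m,
     `[(r`_k)%:~R / K%:R, ((r`_k)%:~R + 1) / K%:R[%classic (tnth p k : R)].

Lemma measurable_cell m K r : measurable (@cell m K r).
Proof.
exact: (@measurable_box R m
  (fun k => `[(r`_k)%:~R / K%:R, ((r`_k)%:~R + 1) / K%:R[%classic)).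
Qed.

Lemma lebesgue_cell m K r : (0 < K)%N -> lam m (@cell m K r) = (K%:R^-1 ^+ m)%:E.
Proof.
move=> K0; rewrite (@lebesgue_tuple_box R m
  (fun k => `[(r`_k)%:~R / K%:R, ((r`_k)%:~R + 1) / K%:R[%classic))//.
under eq_bigr do rewrite lebesgue_measure_itv/=.
rewrite -[in RHS](card_ord m) -prodr_const -prodEFin; apply: eq_bigr => k _.
have iK : (0 : R) < K%:R^-1 by rewrite invr_gt0 ltr0n.
by rewrite lte_fin mulrDl mul1r ltrDl iK -EFinD addrAC subrr add0r.
Qed.

Definition floorpoly m K (p : m.-tuple T) : {poly int} :=
  \poly_(i < m) (if insub i is Some k then Num.floor (K%:R * (tnth p k : R)) else 0).

Lemma floorpolyE m K (p : m.-tuple T) (k : 'I_m) :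
  (floorpoly K p)`_k = Num.floor (K%:R * (tnth p k : R)).
Proof. by rewrite coef_poly ltn_ord valK. Qed.

Lemma cellP m K (p : m.-tuple T) r : (0 < K)%N -> r \in polybox m K ->
  cell K r p <-> r = floorpoly K p.
Proof.
move=> K0 /polyboxP[rm _]; have K0' : 0 < K%:R :> R by rewrite ltr0n.
have itvE (k : 'I_m) (z : int) : (tnth p k : R) \in `[z%:~R / K%:R, (z%:~R + 1) / K%:R[ =
    (Num.floor (K%:R * (tnth p k : R)) == z).
  rewrite in_itv/= ler_pdivrMr// ltr_pdivlMr// mulrC.
  apply/idP/eqP => [zp|<-]; first by apply: floor_def; rewrite intrD.
  by have := floor_itv (K%:R * (tnth p k : R)); rewrite intrD.
split=> [rp|->].
  apply/polyP => i; have [im|mi] := ltnP i m; last first.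
    rewrite (nth_default _ (leq_trans rm mi)).
    by rewrite (nth_default _ (leq_trans (size_poly _ _) mi)).
  have := floorpolyE K p (Ordinal im) => /= ->.
  by have := rp (Ordinal im); rewrite /= itvE => /eqP ->.
by move=> k; rewrite /= itvE floorpolyE.
Qed.

Definition stepfun m (e : R) a b K (p : m.-tuple T) : R :=
  \sum_(r <- polybox m K) area a b 1 (pol (e / K%:R) (scaled K r : 'I_m -> R)) * \1_(cell K r) p.

Lemma stepfunE m e a b K (p : m.-tuple T) : (0 < K)%N ->
  stepfun e a b K p = if floorpoly K p \in polybox m K then
    area a b 1 (pol (e / K%:R) (scaled K (floorpoly K p) : 'I_m -> R)) else 0.
Proof.
move=> K0; have off r : r \in polybox m K -> r != floorpoly K p -> \1_(cell K r) p = 0 :> R.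
  move=> rK rp; rewrite indicE (_ : _ \in _ = false)//; apply/negP => /set_mem.
  by move/(cellP p K0 rK) => rE; rewrite rE eqxx in rp.
rewrite /stepfun; case: ifPn => pK.
  rewrite (bigD1_seq (floorpoly K p))//=; last exact: uniq_polybox.
  rewrite indicE mem_set ?mulr1; last by apply/(cellP p K0 pK).
  rewrite big_seq_cond big1 ?addr0// => r /andP[rK rp].
  by rewrite off// mulr0.
rewrite big_seq big1// => r rK; rewrite off ?mulr0//.
by apply: contraNneq pK => <-.
Qed.

Lemma measurable_stepfun m e a b K : measurable_fun setT (@stepfun m e a b K).
Proof.
apply: measurable_sum => r; apply: measurable_funM => //.
by apply: measurable_indic; exact: measurable_cell.
Qed.

Lemma integral_stepfun m e a b K : (0 < K)%N ->
  (\int[lam m]_p (@stepfun m e a b K p)%:E)%E =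
  (K%:R^-1 ^+ m * \sum_(r <- polybox m K)
     area a b 1 (pol (e / K%:R) (scaled K r : 'I_m -> R)))%:E.
Proof.
move=> K0; rewrite /stepfun; under eq_integral do rewrite -sumEFin.
rewrite ge0_integral_sum//; last 2 first.
- move=> r; apply/measurable_EFinP; apply: measurable_funM => //.
  by apply: measurable_indic; exact: measurable_cell.
- by move=> r p _; rewrite lee_fin mulr_ge0 ?area_ge0.
rewrite mulr_sumr -sumEFin; apply: eq_bigr => r _.
under eq_integral do rewrite EFinM.
rewrite ge0_integralZl_EFin ?area_ge0//; last first.
  by apply/measurable_EFinP; apply: measurable_indic; exact: measurable_cell.
rewrite integral_indic ?setIT//; last exact: measurable_cell.
by rewrite [X in (_ * X)%E](lebesgue_cell m r K0) -EFinM mulrC.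
Qed.

Lemma scaled_le1 m K r (k : 'I_m) : r \in polybox m K -> `|scaled K r k| <= 1.
Proof.
move=> /polyboxP[_ /(_ k) rK]; rewrite /scaled normrM normfV normr_nat.
have [->|K0] := posnP K; first by rewrite invr0 mulr0.
rewrite ler_pdivrMr ?ltr0n// mul1r -intr_norm -[K%:R]/(K%:Z%:~R) ler_int.
by rewrite -abszE lez_nat.
Qed.

Lemma areabound_ge0 m (a b : R) : a < b -> 0 <= areabound m a b.
Proof.
by move=> ab; apply: mulr_ge0; [rewrite densbound_ge0// addr_ge0|rewrite subr_ge0 ltW].
Qed.

Lemma normr_divn_le1 (e : R) K : `|e| <= 1 -> `|e / K%:R| <= 1.
Proof.
move=> e1; have [->|K0] := posnP K; first by rewrite invr0 mulr0 normr0.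
rewrite normrM normfV normr_nat ler_pdivrMr ?ltr0n// mul1r (le_trans e1)//.
by rewrite ler1n.
Qed.

Lemma stepfun_le m e a b K (p : m.-tuple T) : (0 < K)%N -> `|e| <= 1 -> a < b ->
  `|stepfun e a b K p| <= areabound m a b * \1_(@cube R m 2) p.
Proof.
move=> K0 e1 ab; rewrite stepfunE//; case: ifPn => [pK|_]; last first.
  by rewrite normr0 mulr_ge0 ?areabound_ge0.
rewrite indicE mem_set ?mulr1.
  rewrite ger0_norm ?area_ge0//; apply: area_pol_le => //.
    by move=> k; exact: scaled_le1.
  exact: normr_divn_le1.
have K0' : 0 < K%:R :> R by rewrite ltr0n.
apply/cubeP => k; have /polyboxP[_ /(_ k)] := pK; rewrite floorpolyE => fK.
have := floor_itv (K%:R * (tnth p k : R)); set z := Num.floor _ in fK *.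
have : `|z%:~R| <= K%:R :> R.
  by rewrite -intr_norm -[K%:R]/(K%:Z%:~R) ler_int -abszE lez_nat.
have : 1 <= K%:R :> R by rewrite ler1n.
rewrite intrD; move: (K%:R : R) K0' => x x0 x1; rewrite !ler_norml.
move: (z%:~R : R) (tnth p k : R) => u v; move=> /andP[? ?] /andP[? ?]; apply/andP; split; nra.
Qed.

Lemma cvg_floor_scaled (x : R) :
  (Num.floor (n.+1%:R * x))%:~R / n.+1%:R @[n --> \oo] --> x.
Proof.
apply/cvgrPdist_le => eps eps0; near=> n.
have n0 : 0 < n.+1%:R :> R by rewrite ltr0n.
have := floor_itv (n.+1%:R * x); set z := Num.floor _; rewrite intrD.
have ne : n.+1%:R^-1 <= eps.
  by apply: ltW; near: n; exact: (near_infty_natSinv_lt (PosNum eps0)).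
move=> /andP[z1 z2]; rewrite -[x in x - _](mulfK (lt0r_neq0 n0)) -mulrBl normrM normfV normr_nat.
apply: le_trans ne; rewrite ler_piMl ?invr_ge0//.
by rewrite mulrC ler_norml; apply/andP; split; lra.
Unshelve. all: by end_near. Qed.

End riemann.

Section riemann_cvg.
Context {R : realType}.
Local Notation T := (measurableTypeR R).
Local Notation mu := (@lebesgue_measure R).
Local Notation lam m := (@lebesgue_tuple R m).

Definition opencube m : set (m.-tuple T) :=
  [set p | forall k : 'I_m, `]-1, 1[%classic (tnth p k : R)].

Lemma lebesgue_cube_boundary m : lam m (@cube R m 1 `\` @opencube m) = 0%E.
Proof.
have mo : measurable (@opencube m).
  exact: (@measurable_box R m (fun=> `]-1, 1[%classic)).
have oc : @cube R m 1 `&` @opencube m = @opencube m.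
  apply/setIidPr => p po k; have := po k.
  by rewrite /= !in_itv/= => /andP[? ?]; rewrite !ltW.
have olam : lam m (@opencube m) = ((1 *+ 2) ^+ m)%:E.
  rewrite (@lebesgue_tuple_box R m (fun=> `]-1, 1[%classic))//.
  under eq_bigr do rewrite lebesgue_measure_itv/=.
  rewrite -[in RHS](card_ord m) -prodr_const -prodEFin; apply: eq_bigr => k _.
  by rewrite lte_fin ifT ?ltrN10 ?(lt_trans ltrN10)// -EFinD opprK.
have clam := @lebesgue_cube R m 1 ler01.
transitivity (lam m (@cube R m 1) - lam m (@opencube m))%E; last first.
  by rewrite clam olam subee.
rewrite -[in X in (_ - X)%E]oc; apply: measureD => //; first exact: measurable_cube.
by have := ltry ((1 *+ 2) ^+ m : R); rewrite -clam.
Qed.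

(** Off the cube some coordinate eventually leaves the box and the step function is 0. Inside, the
    corner of the cell tends to [p] and [e / n.+1] to 0, so [cvg_area_pol] applies: here the term
    X^(m+1) disappears. *)
Lemma cvg_stepfun m (e a b : R) (p : m.-tuple T) : `|e| <= 1 ->
  ~ (@cube R m 1 `\` @opencube m) p ->
  stepfun e a b n.+1 p @[n --> \oo] --> cubearea a b p.
Proof.
move=> e1 pN; rewrite /cubearea indicE.
have fl (k : 'I_m) := cvg_norm (@cvg_floor_scaled R (tnth p k)).
have normfl n (k : 'I_m) : `|(Num.floor (n.+1%:R * (tnth p k : R)))%:~R / n.+1%:R : R| =
    `|Num.floor (n.+1%:R * (tnth p k : R))|%N%:R / n.+1%:R.
  by rewrite normrM normfV normr_nat -intr_norm -abszE.
case: (boolP (p \in cube 1)) => [/set_mem pc|pc]; last first.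
  rewrite mul0r; have [k pk] : exists k : 'I_m, 1 < `|tnth p k : R|.
    apply: contrapT => H; move/negP: pc; apply; apply/mem_set/cubeP => k.
    by rewrite leNgt; apply/negP => pk; apply: H; exists k.
  apply: cvg_near_cst; near=> n; rewrite stepfunE// ifF//; apply/negbTE/negP.
  move=> /polyboxP[_ /(_ k)]; rewrite floorpolyE => fn.
  have : 1 < `|(Num.floor (n.+1%:R * (tnth p k : R)))%:~R / n.+1%:R : R|.
    by near: n; apply: cvgr_gt pk; exact: fl.
  by rewrite normfl ltr_pdivlMr// mul1r ltr_nat ltnNge fn.
have po : opencube p by apply: contrapT => po; apply: pN.
rewrite mul1r.
have pn n : floorpoly n.+1 p \in polybox m n.+1.
  apply/polyboxP; split; first exact: size_poly.
  move=> i; have [im|mi] := ltnP i m; last by rewrite nth_default// (leq_trans (size_poly _ _)).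
  have := floorpolyE n.+1 p (Ordinal im) => /= ->.
  have := po (Ordinal im); rewrite /= in_itv/=; set x : R := tnth _ _ => /andP[x1 x2].
  have n0 : 0 < n.+1%:R :> R by rewrite ltr0n.
  have := floor_itv (n.+1%:R * x); set z := Num.floor _; rewrite intrD => /andP[z1 z2].
  have : - n.+1%:R - 1 < z%:~R :> R by nra.
  have : z%:~R < n.+1%:R :> R by nra.
  rewrite -[n.+1%:R]/(n.+1%:Z%:~R) -(intrN _ n.+1) -(intrB _ _ 1) !ltr_int; lia.
under eq_cvg do rewrite stepfunE// pn.
apply: cvg_area_pol => //.
- by move=> n; exact: normr_divn_le1.
- by move=> n k; apply: scaled_le1; exact: pn.
- rewrite -[0](mulr0 e); apply: cvgMl_tmp; exact: cvg_harmonic.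
- move=> k; rewrite /scaled; under eq_cvg do rewrite floorpolyE.
  exact: cvg_floor_scaled.
Unshelve. all: by end_near. Qed.

Definition boxsum m (e a b : R) (K : nat) : R :=
  K%:R^-1 ^+ m * \sum_(r <- polybox m K)
     area a b 1 (pol (e / K%:R) (scaled K r : 'I_m -> R)).

(** Dominated convergence also yields that the limit is finite; the shift to [n.+1] avoids dividing
    by 0. *)
Lemma cvg_boxsum_shift m (e a b : R) : `|e| <= 1 -> a < b ->
  (\int[mu]_(t in `]a, b[) phi m t)%E \is a fin_num /\
  boxsum m e a b n.+1 @[n --> \oo] --> fine (\int[mu]_(t in `]a, b[) phi m t)%E.
Proof.
move=> e1 ab.
have := @dominated_convergence _ _ R (lam m) setT measurableT
  (fun n p => (stepfun e a b n.+1 p)%:E) (fun p => (cubearea a b p)%:E)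
  (fun p => (areabound m a b * \1_(@cube R m 2) p)%:E).
case.
- by move=> n; apply/measurable_EFinP; exact: measurable_stepfun.
- by apply/measurable_EFinP; exact: measurable_cubearea.
- exists (@cube R m 1 `\` @opencube m); split.
  + apply: measurableD; first exact: measurable_cube.
    exact: (@measurable_box R m (fun=> `]-1, 1[%classic)).
  + exact: lebesgue_cube_boundary.
  + move=> p /= H; apply: contrapT => pN; apply: H => _.
    by apply: cvg_EFin; [near=> n|apply: cvg_stepfun].
- apply/integrableP; split.
    apply/measurable_EFinP; apply: measurable_funM => //.
    by apply: measurable_indic; exact: measurable_cube.
  under eq_integral do rewrite abse_EFin ger0_norm ?(mulr_ge0 (areabound_ge0 m ab))// EFinM.
  rewrite ge0_integralZl_EFin ?areabound_ge0//; last first.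
    by apply/measurable_EFinP; apply: measurable_indic; exact: measurable_cube.
  rewrite integral_indic ?setIT//; last exact: measurable_cube.
  by rewrite [X in (_ * X)%E](@lebesgue_cube R m 2)// -EFinM ltry.
- by apply: aeW => p n _; rewrite lee_fin; exact: stepfun_le.
move=> ig _ cv; rewrite integral_phi_itv.
have fin := integrable_fin_num measurableT ig.
split; first exact: fin.
have -> : (fun n => boxsum m e a b n.+1) =
    fine \o (fun n => \int[lam m]_p (stepfun e a b n.+1 p)%:E)%E.
  by apply/funext => n /=; rewrite integral_stepfun.
by apply: fine_cvg; rewrite fineK.
Unshelve. all: by end_near. Qed.

Lemma phi_itv_fin_num m (a b : R) : a < b ->
  (\int[mu]_(t in `]a, b[) phi m t)%E \is a fin_num.
Proof. by move=> ab; have [] := @cvg_boxsum_shift m 0 a b _ ab; rewrite ?normr0. Qed.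

Lemma cvg_boxsum m (e a b : R) : `|e| <= 1 -> a < b ->
  boxsum m e a b K @[K --> \oo] --> fine (\int[mu]_(t in `]a, b[) phi m t)%E.
Proof.
by move=> e1 ab; rewrite -cvg_shiftS; exact: (cvg_boxsum_shift m e1 ab).2.
Qed.

End riemann_cvg.

(** * Asymptotics of the root count of both families on a bounded interval *)

Section gensum.
Context {R : realType}.
Implicit Types (f : {poly R}) (I : set R).
Local Notation mu := (@lebesgue_measure R).

(** [c = 0] gives all polynomials of degree at most [m], and [c = 1] the monic ones of degree
    [m.+1]. *)
Definition gensum (c : int) m K I : nat :=
  (\sum_(p <- polybox m.+1 K) zroots I (c *: 'X^(m.+1) + p)%R)%N.

Definition liftpoly (c : int) m (r : {poly int}) : {poly R} :=
  map_poly intr ((c *: 'X^m + r) * 'X).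

Lemma gensumE c m K I :
  gensum c m K I = (\sum_(r <- polybox m K) levelcount I K (liftpoly c m r))%N.
Proof.
rewrite /gensum polyboxS big_allpairs_dep; apply: eq_bigr => r _.
apply: eq_bigr => d _; rewrite /zroots /liftpoly; congr (rootcount I _).
by rewrite addrA exprSr scalerAl -mulrDl rmorphD/= map_polyC.
Qed.

Lemma liftpoly_pol c m K r : (0 < K)%N -> r \in polybox m K ->
  liftpoly c m r = K%:R *: pol (c%:~R / K%:R) (scaled K r : 'I_m -> R).
Proof.
move=> K0 /polyboxP[rm _]; have K0' : K%:R != 0 :> R by rewrite pnatr_eq0 -lt0n.
rewrite /pol scalerDr scalerA mulrC divfK// /liftpoly.
have rE : r = \sum_(k < m) r`_k *: 'X^k.
  rewrite -poly_def; apply/polyP => i; rewrite coef_poly; case: ltnP => // mi.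
  by rewrite nth_default// (leq_trans rm).
rewrite [in LHS]rE addrC mulrDl rmorphD/=; congr (_ + _); last first.
  by rewrite -scalerAl -exprSr map_polyZ/= map_polyXn.
rewrite mulr_suml rmorph_sum/= scaler_sumr; apply: eq_bigr => k _.
rewrite -scalerAl -exprSr map_polyZ/= map_polyXn scalerA mulrC /scaled.
by rewrite divfK.
Qed.

Lemma areaZ a b (k : R) f : 0 < k -> area a b k (k *: f) = k * area a b 1 f.
Proof.
move=> k0; rewrite /area -RintegralZl//; last exact: integrable_dens.
apply: eq_Rintegral => t _; rewrite /dens derivZ !hornerZ !normrM gtr0_norm//.
by rewrite -[X in _ <= X]mulr1 ler_pM2l//; case: ifP; rewrite ?mulr0.
Qed.

Lemma size_liftpoly c m K r : r \in polybox m K -> (size (liftpoly c m r) <= m.+2)%N.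
Proof.
move=> /polyboxP[rm _]; rewrite /liftpoly size_map_intr (leq_trans (size_polyMleq _ _))//.
rewrite size_polyX addn2/= ltnS (leq_trans (size_polyD _ _))// geq_max.
rewrite (leq_trans (size_scale_leq _ _)) ?size_polyXn// ltnW//.
Qed.

(** [levelcount_area] needs a nonzero derivative. In the remaining case the polynomial is constant
    without constant term, hence 0, and both sides vanish: the zero polynomial counts for nothing in
    [rootcount]. *)
Lemma levelcount_liftpoly (i j : bool) a b c m K r : a < b -> r \in polybox m K ->
  `|(levelcount [set` Interval (BSide i a) (BSide j b)] K (liftpoly c m r))%:R
     - area a b K%:R (liftpoly c m r)| <= (6 * m.+2).+3%:R.
Proof.
move=> ab rK; set f := liftpoly c m r.
have [f'0|f'0] := eqVneq f^`() 0; last first.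
  apply: (le_trans (levelcount_area i j K ab f'0)).
  by rewrite ler_nat !ltnS leq_mul2l/= (size_liftpoly _ rK).
have f0 : f = 0.
  have fC : (size f <= 1)%N.
    rewrite leqNgt; apply/negP => f1; have fn0 : f != 0 by rewrite -size_poly_gt0 ltnW.
    have : f^`()`_(size f).-2 = lead_coef f *+ (size f).-1.
      by rewrite coef_deriv /lead_coef; case: (size f) f1 => [|[]].
    move/eqP; rewrite f'0 coef0 eq_sym mulrn_eq0 lead_coef_eq0 (negbTE fn0) orbF.
    by case: (size f) f1 => [|[]].
  rewrite (size1_polyC fC) /f /liftpoly coef_map/= coefMX/=.
  by rewrite polyC0.
have -> : area a b K%:R f = 0.
  rewrite /area; transitivity (\int[mu]_(t in `]a, b[) (0 : R))%R.
    by apply: eq_Rintegral => t _; rewrite /dens f'0 horner0 normr0 if_same.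
  by rewrite Rintegral_cst// mul0r.
rewrite f0 /levelcount big1 ?subr0 ?normr0// => d _; rewrite add0r.
have [->|d0] := eqVneq (d%:~R : R) 0; first by rewrite /rootcount polyC0 eqxx.
apply/eqP; rewrite -leqn0 (leq_trans (rootcount_le _ _))//.
by rewrite size_polyC d0.
Qed.

(** There are [K.*2.+1 ^ m <= (3 K) ^ m] polynomials without constant term, each with bounded error;
    dividing by [K ^ m.+1] leaves a multiple of [1 / K]. *)
Lemma gensum_boxsum (i j : bool) a b c m K : (0 < K)%N -> a < b ->
  `|(gensum c m K [set` Interval (BSide i a) (BSide j b)])%:R / K%:R ^+ m.+1
     - boxsum m c%:~R a b K| <= (3 ^ m * (6 * m.+2).+3)%:R / K%:R :> R.
Proof.
move=> K0 ab; have K0' : 0 < K%:R :> R by rewrite ltr0n.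
have -> : boxsum m c%:~R a b K = (\sum_(r <- polybox m K)
    area a b K%:R (liftpoly c m r)) / K%:R ^+ m.+1.
  rewrite /boxsum exprVn mulr_sumr mulr_suml; apply: eq_big_seq => r rK.
  rewrite (liftpoly_pol _ K0 rK) areaZ// exprS invfM [_ * (_ * _)]mulrAC mulrA.
  by rewrite divff ?gt_eqF// mul1r.
rewrite -mulrBl gensumE natr_sum -sumrB normrM.
rewrite [X in _ * X]ger0_norm; last by rewrite invr_ge0 exprn_ge0// ltW.
rewrite ler_pdivrMr ?exprn_gt0//.
apply: (le_trans (ler_norm_sum _ _ _)).
apply: (@le_trans _ _ (\sum_(r <- polybox m K) (6 * m.+2).+3%:R)).
  rewrite !big_seq; apply: ler_sum => r rK; exact: levelcount_liftpoly.
rewrite big_const_seq count_predT iter_addr_0 size_polybox -[leLHS]mulr_natr -natrM.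
rewrite exprS mulrA divfK ?gt_eqF// -natrX -natrM ler_nat.
rewrite [(3 ^ m * _)%N]mulnC -mulnA leq_mul2l -expnMn leq_exp2rW ?orbT//; lia.
Qed.

Lemma cvg_gensum (i j : bool) (a b : R) (c : int) m : `|c| <= 1 -> a < b ->
  (gensum c m K [set` Interval (BSide i a) (BSide j b)])%:R / K%:R ^+ m.+1
    @[K --> \oo] --> fine (\int[mu]_(t in `]a, b[) phi m t)%E.
Proof.
move=> c1 ab; have c1' : `|c%:~R| <= 1 :> R by rewrite -intr_norm -[1]/(1%:Z%:~R) ler_int.
have bs := @cvg_boxsum R m c%:~R a b c1' ab.
set D : R := (3 ^ m * (6 * m.+2).+3)%:R.
rewrite -cvg_shiftS; rewrite -cvg_shiftS in bs.
set u := fun n => _; set v := fun n => _ in bs.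
have -> : u = v \+ (u \- v) by apply/funext => n /=; rewrite addrC subrK.
set l := fine _; rewrite -[l]addr0; apply: cvgD => //.
apply/cvgrPdist_le => eps eps0.
have Dh : D * n.+1%:R^-1 @[n --> \oo] --> 0.
  by rewrite -[0](mulr0 D); apply: cvgMl_tmp; exact: cvg_harmonic.
near=> n; rewrite sub0r normrN.
apply: (le_trans (gensum_boxsum i j c m (ltn0Sn n) ab)).
by apply: ltW; near: n; apply: cvgr_lt eps0; exact: Dh.
Unshelve. all: by end_near. Qed.

End gensum.

(** * Primitive polynomials *)

Lemma content_zcontents p : content p = `|zcontents p|%N.
Proof.
have [->|p0] := eqVneq p 0.
  by rewrite zcontents0 /content size_poly0 big_ord0.
by rewrite /zcontents -/(content p) abszM absz_nat absz_sg lead_coef_eq0 p0 mul1n.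
Qed.

Lemma contentZ c p : content (c *: p) = (`|c| * content p)%N.
Proof. by rewrite !content_zcontents zcontentsZ abszM. Qed.

Lemma content_eq0 p : (content p == 0%N) = (p == 0).
Proof. by rewrite content_zcontents absz_eq0 zcontents_eq0. Qed.

Lemma content_primitive (p : {poly int}) : p != 0 ->
  exists2 q, content q = 1%N & p = (content p)%:Z *: q.
Proof.
move=> p0; exists (sgz (zcontents p) *: zprimitive p).
  rewrite contentZ content_zcontents zcontents_primitive p0 absz_sg.
  by rewrite zcontents_eq0 p0.
rewrite scalerA content_zcontents mulrC -intEsg; exact: zpolyEprim.
Qed.

Section primitive.
Context {R : realType}.
Implicit Types (I : set R).

Lemma zrootsZ I (c : int) p : c != 0 -> zroots I (c *: p) = zroots I p.
Proof. by move=> c0; rewrite /zroots map_polyZ rootcountZ// intr_eq0. Qed.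

Lemma zroots0 I : zroots I 0 = 0%N.
Proof. by rewrite /zroots rmorph0 /rootcount eqxx. Qed.

(** Division by [d] is a bijection onto the primitive polynomials of height at most [K %/ d], and it
    keeps the roots. *)
Lemma sum_content m K I d : (0 < d)%N ->
  (\sum_(p <- polybox m.+1 K | content p == d) zroots I p)%N =
  primsum m (K %/ d) I.
Proof.
move=> d0; have d0' : d%:Z != 0 by lia.
rewrite /primsum -[LHS]big_filter -[RHS]big_filter; set s := [seq _ <- _ | _].
set s' := [seq _ <- _ | _].
have sE : perm_eq s [seq d%:Z *: q | q <- s'].
  apply: uniq_perm.
  - by apply: filter_uniq; exact: uniq_polybox.
  - rewrite map_inj_uniq; first by apply: filter_uniq; exact: uniq_polybox.
    move=> q q' /polyP e; apply/polyP => i.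
    by have := e i; rewrite !coefZ => /(mulfI d0').
  - move=> p; rewrite mem_filter; apply/andP/mapP => [[/eqP cp pK]|[q]].
      have p0 : p != 0 by rewrite -content_eq0 cp -lt0n.
      have [q cq pE] := content_primitive p0; rewrite cp in pE.
      exists q => //; rewrite mem_filter cq eqxx/=.
      move: pK => /polyboxP[sp hp]; apply/polyboxP; split.
        by move: sp; rewrite pE size_scale.
      by move=> i; have := hp i; rewrite pE coefZ abszM absz_nat leq_divRL// mulnC.
    rewrite mem_filter => /andP[/eqP cq /polyboxP[sq hq]] ->.
    rewrite contentZ cq muln1 absz_nat; split=> //; apply/polyboxP.
    by split=> [|i]; rewrite ?size_scale// coefZ abszM absz_nat mulnC -leq_divRL.
by rewrite (perm_big _ sE) big_map; apply: eq_bigr => q _; exact: zrootsZ.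
Qed.

Lemma content_le m K p : p \in polybox m K -> (content p <= K)%N.
Proof.
move=> /polyboxP[_ hp]; have [->|p0] := eqVneq p 0.
  by rewrite /content size_poly0 big_ord0.
apply: leq_trans (hp (size p).-1); apply: dvdn_leq.
  by rewrite absz_gt0 -[_`_ _]/(lead_coef p) lead_coef_eq0.
have sp : ((size p).-1 < size p)%N by rewrite prednK ?size_poly_gt0.
by rewrite /content (bigD1 (Ordinal sp))//= dvdn_gcdl.
Qed.

Lemma gensum_primsum m K I :
  gensum 0 m K I = (\sum_(1 <= d < K.+1) primsum m (K %/ d) I)%N.
Proof.
transitivity (\sum_(0 <= d < K.+1)
    \sum_(p <- polybox m.+1 K | content p == d) zroots I p)%N.
  rewrite /gensum; under eq_bigr do rewrite scale0r add0r.
  rewrite [RHS](exchange_big_dep xpredT)//=; apply: eq_big_seq => p /content_le pK.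
  rewrite big_mkcond (bigD1_seq (content p)) ?iota_uniq ?mem_index_iota//= ?ltnS//.
  by rewrite eqxx big1_seq ?addn0// => d /andP[dp _]; rewrite eq_sym (negbTE dp).
rewrite big_ltn// big1 ?add0n.
  by apply: eq_big_nat => d /andP[d0 _]; exact: sum_content.
by move=> p /[!content_eq0] /eqP ->; exact: zroots0.
Qed.

End primitive.

(** * Partial sums of zeta and inversion of the sum over contents *)

Section dirichlet.
Context {R : realType}.
Implicit Types (E P : nat -> R).

Definition zsum n K : R := \sum_(1 <= d < K.+1) (d%:R ^+ n)^-1.

Lemma invr_exp_le (d n k : nat) : (0 < d)%N -> (k <= n)%N ->
  (d%:R ^+ n)^-1 <= (d%:R ^+ k)^-1 :> R.
Proof.
move=> d0 kn; rewrite lef_pV2 ?posrE ?exprn_gt0 ?ltr0n//.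
by rewrite ler_weXn2l// ler1n.
Qed.

(** Telescoping with [1 / (x + 1)^2 <= 1 / x - 1 / (x + 1)], but keeping the exact first term 1/4.
    Telescoping from [d = 2] would give only 1, which is too weak for the contraction. *)
Lemma zsum_tail n K : (2 <= n)%N ->
  \sum_(2 <= d < K.+1) (d%:R ^+ n)^-1 <= 3%:R / 4%:R :> R.
Proof.
move=> n2; case: K => [|[|K]]; [by rewrite big_geq// divr_ge0|by rewrite big_geq// divr_ge0|].
suff : \sum_(2 <= d < K.+3) (d%:R ^+ n)^-1 <= 3%:R / 4%:R - K.+2%:R^-1 :> R.
  by move=> H; apply: (le_trans H); rewrite gerBl.
elim: K => [|K IH].
  rewrite big_nat1 (le_trans (invr_exp_le _ n2))// expr2.
  have -> : (2 * 2 : R)^-1 = 3%:R / 4%:R - 2^-1 by field.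
  by [].
rewrite big_nat_recr//=; apply: le_trans (lerD IH (invr_exp_le _ n2)) _ => //.
have x0 : 0 < K.+2%:R :> R by rewrite ltr0n.
have -> : K.+3%:R = K.+2%:R + 1 :> R by rewrite -natr1.
move: (K.+2%:R : R) x0 => x x0.
have -> : (x + 1) ^- 2 = x^-1 - (x + 1)^-1 - (x * (x + 1) ^+ 2)^-1.
  by field; apply/andP; split; rewrite gt_eqF// addr_gt0.
have : 0 <= (x * (x + 1) ^+ 2)^-1.
  by rewrite invr_ge0 mulr_ge0 ?exprn_ge0 ?addr_ge0// ltW.
lra.
Qed.

Lemma nondecreasing_zsum n : nondecreasing_seq (zsum n).
Proof.
apply/nondecreasing_seqP => K; rewrite /zsum [leRHS]big_nat_recr//= lerDl.
by rewrite invr_ge0 exprn_ge0.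
Qed.

Lemma zsum_le n K : (2 <= n)%N -> zsum n K <= 2.
Proof.
move=> n2; case: K => [|K]; first by rewrite /zsum big_geq.
rewrite /zsum big_ltn// expr1n invr1; have := zsum_tail K.+1 n2; lra.
Qed.

Lemma cvg_zsum n : (2 <= n)%N -> zsum n K @[K --> \oo] --> zeta (n%:R : R).
Proof.
move=> n2; rewrite /zeta.
have -> : series (riemannR n%:R) = zsum n :> (nat -> R).
  apply/funext => K; rewrite /series/= /zsum big_add1/=; apply: eq_bigr => k _.
  by rewrite /riemannR powR_mulrn.
apply: nondecreasing_is_cvgn; first exact: nondecreasing_zsum.
by exists 2 => _ [K _ <-]; exact: zsum_le.
Qed.

Lemma zeta_ge1 n : (2 <= n)%N -> 1 <= zeta (n%:R : R).
Proof.
move=> n2; have := cvg_zsum n2 => /cvg_lim <-//.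
apply: limr_ge; first by apply/cvg_ex; exists (zeta n%:R); exact: cvg_zsum.
near=> K; have : (1 <= K)%N by near: K; exact: nbhs_infty_ge.
move/(nondecreasing_zsum n); apply: le_trans.
by rewrite /zsum big_nat1 expr1n invr1.
Unshelve. all: by end_near. Qed.

Lemma divn_exp_le n K d : (0 < d)%N ->
  (K %/ d)%:R ^+ n <= K%:R ^+ n * (d%:R ^+ n)^-1 :> R.
Proof.
move=> d0; rewrite -exprVn -exprMn lerXn2r ?nnegrE ?mulr_ge0 ?invr_ge0//.
by rewrite ler_pdivlMr ?ltr0n// -natrM ler_nat leq_trunc_div.
Qed.

(* The terms d >= 2 of the sum only carry the weight zeta(n) - 1 <= 3/4 < 1, so
   the identity improves any asymptotic bound for E by a constant factor. *)
Lemma dirichlet_contraction n E F : (2 <= n)%N -> 0 < F ->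
  (forall k, `|E k| <= F * k%:R ^+ n) ->
  (\sum_(1 <= d < K.+1) E (K %/ d)%N) / K%:R ^+ n @[K --> \oo] --> (0 : R) ->
  E K / K%:R ^+ n @[K --> \oo] --> (0 : R).
Proof.
move=> n2 F0 EF S0.
(* Isolating [d = 1], the loss is 3/4 from the terms [d >= 2], 1/16 from the hypothesis on the sum
   and 1/16 from small arguments, so 7/8 in all. *)
have step B : 0 < B -> (\forall k \near \oo, `|E k| <= B * k%:R ^+ n) ->
    \forall k \near \oo, `|E k| <= (7%:R / 8%:R * B) * k%:R ^+ n.
  move=> B0 [k0 _ Bk0].
  (* Below [k0] only the a priori bound holds. It costs a constant per term, hence [F' * K] in the
     sum, negligible against [K ^ n] because [n >= 2]. *)
  have bound k : `|E k| <= B * k%:R ^+ n + F * k0%:R ^+ n.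
    have [kk|kk] := leqP k0 k.
      by apply: (le_trans (Bk0 _ kk)); rewrite lerDl mulr_ge0 ?exprn_ge0// ltW.
    apply: (le_trans (EF k)); rewrite ler_wpDl ?mulr_ge0 ?exprn_ge0 ?(ltW B0)//.
    by rewrite ler_pM2l// lerXn2r ?nnegrE// ler_nat ltnW.
  set F' := F * k0%:R ^+ n in bound; have F'0 : 0 <= F' by rewrite mulr_ge0 ?exprn_ge0// ltW.
  near=> K; have K0 : (0 < K)%N by near: K; exact: nbhs_infty_gt.
  have Kn0 : 0 < K%:R ^+ n :> R by rewrite exprn_gt0// ltr0n.
  have SB : `|\sum_(1 <= d < K.+1) E (K %/ d)%N| <= B / 16%:R * K%:R ^+ n.
    have : `|(\sum_(1 <= d < K.+1) E (K %/ d)%N) / K%:R ^+ n| <= B / 16%:R.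
      near: K; apply: cvgr0_norm_le => //; exact: divr_gt0.
    by rewrite normrM normfV [X in _ / X]gtr0_norm// ler_pdivrMr.
  have KF : F' * K%:R <= B / 16%:R * K%:R ^+ n.
    have KF : F' / (B / 16%:R) <= K%:R.
      by near: K; exact: nbhs_infty_ger.
    have b0 : 0 < B / 16%:R by rewrite divr_gt0.
    rewrite ler_pdivrMr// mulrC in KF.
    apply: (le_trans (ler_wpM2r (ler0n _ K) KF)).
    rewrite -(subnK n2) exprD expr2 [_ ^+ _ * _]mulrC !mulrA ler_peMr//.
      by rewrite !mulr_ge0// ltW.
    by rewrite exprn_ege1// ler1n.
  move: SB; rewrite big_ltn// divn1 => SB.
  have tail : `|\sum_(2 <= d < K.+1) E (K %/ d)%N| <= B * K%:R ^+ n * (3%:R / 4%:R) + F' * K%:R.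
    apply: (le_trans (ler_norm_sum _ _ _)).
    apply: (@le_trans _ _ (\sum_(2 <= d < K.+1) (B * K%:R ^+ n * (d%:R ^+ n)^-1 + F'))).
      rewrite !big_nat; apply: ler_sum => d /andP[d2 _]; apply: (le_trans (bound _)).
      by rewrite lerD2r -mulrA ler_pM2l// divn_exp_le// (leq_trans _ d2).
    rewrite big_split/= -mulr_sumr lerD//.
      by rewrite ler_pM2l ?mulr_gt0// zsum_tail.
    rewrite big_const_nat iter_addr_0 -[leLHS]mulr_natr ler_wpM2l// ler_nat; lia.
  move: SB tail; set X := \sum_(2 <= _ < _) _; set Y := K%:R ^+ n in KF *.
  rewrite (addrC (E K)) => SB tail.
  have : `|E K| <= `|X + E K| + `|X|.
    by rewrite -[in leLHS](addKr X (E K)) addrC (le_trans (ler_normB _ _)).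
  nra.
have geo j : \forall k \near \oo, `|E k| <= ((7%:R / 8%:R) ^+ j * F) * k%:R ^+ n.
  elim: j => [|j IH]; first by near=> k; rewrite expr0 mul1r.
  by rewrite exprS -mulrA; apply: step => //; rewrite mulr_gt0// exprn_gt0// divr_gt0.
apply/cvgrPdist_le => eps eps0.
have [j jeps] : exists j, (7%:R / 8%:R) ^+ j * F <= eps.
  have q1 : `|7%:R / 8%:R| < 1 :> R by rewrite ger0_norm ?divr_ge0// ltr_pdivrMr// mul1r ltr_nat.
  have := cvg_expr q1 => /cvgr0_norm_le /(_ (eps / F) (divr_gt0 eps0 F0)) [j _ /(_ j (leqnn j))].
  by rewrite ler_pdivlMr// => H; exists j; apply: le_trans H; rewrite ler_pM2r// ler_norm.
near=> K; have K0 : (0 < K)%N by near: K; exact: nbhs_infty_gt.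
have Kn0 : 0 < K%:R ^+ n :> R by rewrite exprn_gt0// ltr0n.
rewrite sub0r normrN normrM normfV [X in _ / X]gtr0_norm// ler_pdivrMr//.
apply: (@le_trans _ _ ((7%:R / 8%:R) ^+ j * F * K%:R ^+ n)); first by near: K; exact: geo.
by rewrite ler_pM2r.
Unshelve. all: by end_near. Qed.

End dirichlet.

Section primitive_density.
Context {R : realType}.

Lemma subrXX_le (x y : R) n : 0 <= y -> y <= x -> x <= y + 1 ->
  x ^+ n.+1 - y ^+ n.+1 <= n.+1%:R * x ^+ n.
Proof.
move=> y0 yx xy; have x0 : 0 <= x by exact: le_trans yx.
elim: n => [|n IH]; first by rewrite !expr1 expr0 mulr1; lra.
have -> : x ^+ n.+2 - y ^+ n.+2 = x * (x ^+ n.+1 - y ^+ n.+1) + (x - y) * y ^+ n.+1.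
  by rewrite !(exprS _ n.+1); ring.
have -> : n.+2%:R * x ^+ n.+1 = x * (n.+1%:R * x ^+ n) + x ^+ n.+1.
  by rewrite -(natr1 n.+1) exprS; ring.
apply: lerD; first by rewrite ler_wpM2l.
apply: (@le_trans _ _ (1 * x ^+ n.+1)); last by rewrite mul1r.
by apply: ler_pM; rewrite ?subr_ge0 ?exprn_ge0 ?lerXn2r ?nnegrE//; lra.
Qed.

(** This is the Cesaro mean of the harmonic sequence. *)
Lemma cvg_zsum1_div : zsum 1 K / K%:R @[K --> \oo] --> (0 : R).
Proof.
rewrite -cvg_shiftS.
have -> : (fun n => zsum 1 n.+1 / n.+1%:R) = arithmetic_mean (@harmonic R).
  apply/funext => n.
  rewrite /arithmetic_mean/= /series/= /zsum mulrC big_add1/=; congr (_ * _).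
exact: (cesaro (@cvg_harmonic R)).
Qed.

(** Replacing the integer part of [K / d] by [K / d] costs at most [n (K / d) ^ (n - 1)]; after
    division by [K ^ n] this is at most [n / (d K)]. *)
Lemma sum_divn_exp n K : (2 <= n)%N -> (0 < K)%N ->
  `|(\sum_(1 <= d < K.+1) (K %/ d)%:R ^+ n) / K%:R ^+ n - zsum n K|
    <= n%:R * (zsum 1 K / K%:R) :> R.
Proof.
move=> n2 K0; have K0' : 0 < K%:R :> R by rewrite ltr0n.
rewrite /zsum mulr_suml -sumrB (le_trans (ler_norm_sum _ _ _))//.
rewrite mulr_suml mulr_sumr !big_nat; apply: ler_sum => d /andP[d0 dK].
rewrite ltnS in dK.
have d0' : 0 < d%:R :> R by rewrite ltr0n.
set x : R := K%:R / d%:R; set y : R := (K %/ d)%:R.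
have yx : y <= x by rewrite ler_pdivlMr// -natrM ler_nat leq_trunc_div.
have xy : x <= y + 1.
  rewrite ler_pdivrMr// natr1 -natrM ler_nat; apply: ltnW.
  exact: ltn_ceil.
have y0 : 0 <= y by [].
have x1 : 1 <= x by rewrite ler_pdivlMr// mul1r ler_nat.
case: n n2 => [//|n]; rewrite ltnS => n0.
have -> : y ^+ n.+1 / K%:R ^+ n.+1 - (d%:R ^+ n.+1)^-1 =
    - ((x ^+ n.+1 - y ^+ n.+1) / K%:R ^+ n.+1).
  rewrite mulrBl opprB; congr (_ - _).
  by rewrite /x expr_div_n mulrAC divff ?mul1r// gt_eqF// exprn_gt0.
rewrite normrN normrM normfV [X in _ / X]gtr0_norm ?exprn_gt0//.
rewrite ger0_norm ?subr_ge0 ?lerXn2r ?nnegrE// ?(le_trans y0)//.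
rewrite ler_pdivrMr ?exprn_gt0// (le_trans (subrXX_le n y0 yx xy))//.
rewrite expr1 -mulrA ler_wpM2l// exprS [K%:R * _]mulrC mulrA.
have -> : d%:R^-1 / K%:R * K%:R ^+ n * K%:R = K%:R ^+ n / d%:R :> R.
  by field; rewrite !gt_eqF.
rewrite /x expr_div_n ler_wpM2l ?exprn_ge0//.
by have := @invr_exp_le R d n 1 d0 n0; rewrite expr1.
Qed.

Lemma cvg_sum_divn_exp n : (2 <= n)%N ->
  (\sum_(1 <= d < K.+1) (K %/ d)%:R ^+ n) / K%:R ^+ n @[K --> \oo] --> zeta (n%:R : R).
Proof.
move=> n2; set u := fun K => _.
have -> : u = zsum n \+ (u \- zsum n) by apply/funext => K /=; rewrite addrC subrK.
rewrite -[zeta _]addr0; apply: cvgD; first exact: cvg_zsum.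
have H : n%:R * (zsum 1 K / K%:R) @[K --> \oo] --> (0 : R).
  by rewrite -[0](mulr0 n%:R); apply: cvgMl_tmp; exact: cvg_zsum1_div.
apply/cvgrPdist_le => eps eps0; near=> K.
have K0 : (0 < K)%N by near: K; exact: nbhs_infty_gt.
rewrite sub0r normrN; apply: (le_trans (sum_divn_exp n2 K0)).
by apply: ltW; near: K; apply: cvgr_lt eps0; exact: H.
Unshelve. all: by end_near. Qed.

Lemma primsum_le m K (I : set R) : ((primsum m K I)%:R <= m%:R * 3%:R ^+ m.+1 * K%:R ^+ m.+1 :> R).
Proof.
have [K0|K0] := posnP K.
  rewrite K0 /primsum big1_seq ?mulr_ge0//.
  move=> p /andP[_ /polyboxP[_ hp]]; suff -> : p = 0 by rewrite zroots0.
  by apply/polyP => i; have := hp i; rewrite leqn0 absz_eq0 coef0 => /eqP.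
rewrite -!natrX -!natrM ler_nat; apply: (@leq_trans (m * size (polybox m.+1 K))).
  rewrite /primsum -big_filter; apply: (leq_trans (@sum_zroots_le R _ m I _)).
    by move=> p; rewrite mem_filter => /andP[_ /polyboxP[]].
  by rewrite leq_mul2l size_filter count_size orbT.
rewrite size_polybox -mulnA leq_mul2l -expnMn leq_exp2rW ?orbT//; lia.
Qed.

(** The contraction is applied to the error [E k = primsum - L k ^ n]. Its sum over the contents is
    [gensum] minus [L] times the sum of the [(K %/ d) ^ n], of normalized limit [V - L zeta(n)], and
    [L] is chosen to make this 0. *)
Lemma cvg_primsum m (I : set R) (V : R) : (0 < m)%N -> 0 <= V ->
  (gensum 0 m K I)%:R / K%:R ^+ m.+1 @[K --> \oo] --> V ->
  (primsum m K I)%:R / K%:R ^+ m.+1 @[K --> \oo] --> V / zeta (m.+1%:R : R).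
Proof.
move=> m0 V0 gV; set n := m.+1; have n2 : (2 <= n)%N by [].
have z1 := @zeta_ge1 R n n2; have z0 : 0 < zeta (n%:R : R) by exact: lt_le_trans z1.
set L := V / zeta _; have L0 : 0 <= L by rewrite divr_ge0// ltW.
pose E k : R := (primsum m k I)%:R - L * k%:R ^+ n.
pose F : R := m%:R * 3%:R ^+ n + L.
have F0 : 0 < F by rewrite ltr_pwDl// mulr_gt0 ?exprn_gt0// ltr0n.
have EF k : `|E k| <= F * k%:R ^+ n.
  rewrite /E (le_trans (ler_normB _ _))// mulrDl lerD//.
    by rewrite normr_nat primsum_le.
  by rewrite ger0_norm// mulr_ge0// exprn_ge0.
have H : E K / K%:R ^+ n @[K --> \oo] --> (0 : R).
  apply: (dirichlet_contraction n2 F0 EF).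
  have -> : (fun K => (\sum_(1 <= d < K.+1) E (K %/ d)%N) / K%:R ^+ n) =
      (fun K => (gensum 0 m K I)%:R / K%:R ^+ n -
         L * ((\sum_(1 <= d < K.+1) (K %/ d)%:R ^+ n) / K%:R ^+ n)).
    apply/funext => K; rewrite mulrA -mulrBl; congr (_ / _).
    by rewrite gensum_primsum natr_sum mulr_sumr -sumrB.
  have VL : V - L * zeta n%:R = 0 by rewrite /L divfK ?subrr// gt_eqF.
  have := cvgB gV (cvgMl_tmp (a := L) (cvg_sum_divn_exp n2)); rewrite VL; exact.
have HL : (fun K => E K / K%:R ^+ n + L) @ \oo --> L.
  by rewrite -[X in _ --> X](add0r L); apply: cvgD => //; exact: cvg_cst.
apply: cvg_trans HL; apply: near_eq_cvg; near=> K.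
have K0 : (0 < K)%N by near: K; exact: nbhs_infty_gt.
have Kn0 : K%:R ^+ n != 0 :> R by rewrite expf_neq0// pnatr_eq0 -lt0n.
by rewrite /= /E mulrBl mulfK// subrK.
Unshelve. all: by end_near. Qed.

End primitive_density.

(** * Limits of the counting ratio *)

Section ratio.
Context {R : realType}.
Implicit Types (I : set R).

Lemma cvg_small (u : nat -> R) (D : R) : (forall K, 0 <= u K) ->
  (forall K, (0 < K)%N -> u K <= D / K%:R) -> u K @[K --> \oo] --> (0 : R).
Proof.
move=> u0 uD; rewrite -cvg_shiftS.
have H : D * n.+1%:R^-1 @[n --> \oo] --> (0 : R).
  by rewrite -[0](mulr0 D); apply: cvgMl_tmp; exact: cvg_harmonic.
apply: (@squeeze_cvgr _ _ _ _ (cst 0) (fun n => D * n.+1%:R^-1)) => //; last exact: cvg_cst.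
by near=> n; rewrite /cst/= u0/=; exact: uD.
Unshelve. all: by end_near. Qed.

(** A crude form of log N = O(sqrt N), enough to make the square of [log K / K] a O(1 / K) in
    [cvg_bad_bound]. *)
Lemma trunc_log_sqr N : (0 < N)%N -> ((trunc_log 2 N).+1 ^ 2 <= 4 * N)%N.
Proof.
move=> N0; have := trunc_logP (isT : (1 < 2)%N) N0; move: (trunc_log 2 N) => j jN.
apply: (@leq_trans (4 * 2 ^ j)); last by rewrite leq_mul2l.
elim: j {jN} => [//|[|[|j]] IH] //; rewrite (expnS 2); move: IH.
by move: (2 ^ j.+2)%N => x; rewrite -!mulnn; lia.
Qed.

Lemma cvg_bad_bound m C : (0 < C)%N ->
  (bad_bound m C K)%:R / K%:R ^+ m.+1 @[K --> \oo] --> (0 : R).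
Proof.
move=> C0; pose u K : R := (trunc_log 2 (C * K)).+1%:R / K%:R.
have u0 K : 0 <= u K by rewrite divr_ge0.
have su : u K ^+ 2 @[K --> \oo] --> (0 : R).
  apply: (@cvg_small _ (4 * C)%:R) => [K|K K0]; first exact: exprn_ge0.
  have K0' : 0 < K%:R :> R by rewrite ltr0n.
  rewrite /u expr_div_n ler_pdivrMr ?exprn_gt0// expr2 [X in _ <= _ * X]expr2 mulrA divfK ?gt_eqF//.
  rewrite -!natrM ler_nat -mulnA (leq_trans _ (trunc_log_sqr _))// muln_gt0 C0//.
have cu : u K @[K --> \oo] --> (0 : R).
  apply/cvgrPdist_le => eps eps0; near=> K; rewrite sub0r normrN ger0_norm//.
  rewrite -(@ler_pXn2r _ 2) ?nnegrE ?(ltW eps0)//.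
  by apply: ltW; near: K; apply: cvgr_lt (exprn_gt0 2 eps0); exact: su.
have H : u K * (15 * C)%:R ^+ m @[K --> \oo] --> (0 : R).
  by rewrite -[0](mul0r ((15 * C)%:R ^+ m)); exact: cvgMr_tmp.
apply: cvg_trans H; apply: near_eq_cvg; near=> K.
have K0 : (0 < K)%N by near: K; exact: nbhs_infty_gt.
have K0' : K%:R != 0 :> R by rewrite pnatr_eq0 -lt0n.
rewrite /bad_bound mulnA (natrM _ (trunc_log 2 _).+1) natrX (natrM _ (15 * C)) exprMn exprS /u.
by field; rewrite K0' expf_neq0.
Unshelve. all: by end_near. Qed.

Lemma cvg_box m : (K.*2.+1 ^ m)%:R / K%:R ^+ m.+1 @[K --> \oo] --> (0 : R).
Proof.
apply: (@cvg_small _ (3%:R ^+ m)) => [K|K K0]; first by rewrite divr_ge0// exprn_ge0.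
have K0' : 0 < K%:R :> R by rewrite ltr0n.
rewrite ler_pdivrMr ?exprn_gt0// exprS mulrA divfK ?gt_eqF//.
rewrite -!natrX -natrM ler_nat -expnMn leq_exp2rW//; lia.
Qed.

Lemma natr_truncn K : Num.truncn (K%:R : R) = K.
Proof. exact: natrK. Qed.

Lemma cvg_sandwich (u v r : nat -> R) (l : R) :
  u @ \oo --> l -> r @ \oo --> (0 : R) ->
  (\forall K \near \oo, v K <= u K <= v K + r K) -> v @ \oo --> l.
Proof.
move=> ul r0 uv; have url : (fun K => u K - r K) @ \oo --> l.
  by rewrite -[l]subr0; apply: cvgB.
apply: (@squeeze_cvgr _ _ _ _ (fun K => u K - r K) u) => //.
near=> K; have /andP[vu ur] : v K <= u K <= v K + r K by near: K.
by rewrite lerBlDr ur.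
Unshelve. all: by end_near. Qed.

Lemma cvg_Phi m I (L : R) : (0 < m)%N ->
  (primsum m K I)%:R / K%:R ^+ m.+1 @[K --> \oo] --> L ->
  (Phi m (K%:R : R) I)%:R / K%:R ^+ m.+1 @[K --> \oo] --> L / 2.
Proof.
move=> m0 pL; have [C C0 HC] := @Phi_bounds R m m0.
have H : (2 * Phi m (K%:R : R) I)%:R / K%:R ^+ m.+1 @[K --> \oo] --> L.
  apply: (@cvg_sandwich _ _ (fun K => m%:R * ((K.*2.+1 ^ m)%:R / K%:R ^+ m.+1 +
     (bad_bound m C K)%:R / K%:R ^+ m.+1)) _ pL).
    rewrite -[0](mulr0 m%:R) -[X in _ * X]addr0; apply: cvgMl_tmp.
    by apply: cvgD; [exact: cvg_box|exact: cvg_bad_bound].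
  near=> K; have K1 : 1 <= K%:R :> R by rewrite ler1n; near: K; exact: nbhs_infty_gt.
  have Kn0 : 0 < K%:R ^+ m.+1 :> R by rewrite exprn_gt0// (lt_le_trans _ K1).
  have := HC K%:R I K1 K (esym (natr_truncn K)).
  rewrite -mulrDl mulrA -mulrDl !ler_pM2r ?invr_gt0//.
  by rewrite -natrD -natrM -natrD !ler_nat.
rewrite [L / 2]mulrC.
have H2 : (fun K => 2^-1 * ((2 * Phi m (K%:R : R) I)%:R / K%:R ^+ m.+1)) @ \oo --> 2^-1 * L.
  exact: cvgMl_tmp H.
apply: cvg_trans H2; apply: near_eq_cvg; near=> K.
by rewrite natrM !mulrA mulVf ?mul1r.
Unshelve. all: by end_near. Qed.

Lemma cvg_Omega m I (W : R) :
  (gensum 1 m K I)%:R / K%:R ^+ m.+1 @[K --> \oo] --> W ->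
  (Omega m.+1 (K%:R : R) I)%:R / K%:R ^+ m.+1 @[K --> \oo] --> W.
Proof.
move=> gW; have [C C0 HC] := @Omega_bounds R m.
apply: (@cvg_sandwich _ _ (fun K => (m.+1 * m)%:R *
     ((bad_bound m C K)%:R / K%:R ^+ m.+1)) _ gW).
  rewrite -[0](mulr0 (m.+1 * m)%:R); apply: cvgMl_tmp; exact: cvg_bad_bound.
near=> K; have K1 : 1 <= K%:R :> R by rewrite ler1n; near: K; exact: nbhs_infty_gt.
have Kn0 : 0 < K%:R ^+ m.+1 :> R by rewrite exprn_gt0// (lt_le_trans _ K1).
have := HC K%:R I K1 K (esym (natr_truncn K)).
have -> : monicsum m K I = gensum 1 m K I.
  by apply: eq_bigr => p _; rewrite scale1r.
rewrite mulrA -mulrDl !ler_pM2r ?invr_gt0//.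
by rewrite -natrM -natrD !ler_nat mulnA.
Unshelve. all: by end_near. Qed.

Lemma Phi_truncn m (Q : R) I : 0 <= Q -> Phi m Q I = Phi m (Num.truncn Q)%:R I.
Proof. by move=> Q0; rewrite !PhiE// natr_truncn. Qed.

Lemma Omega_truncn m (Q : R) I : 1 <= Q ->
  Omega m.+1 Q I = Omega m.+1 (Num.truncn Q)%:R I.
Proof.
by move=> Q1; rewrite !OmegaE ?natr_truncn// ler1n truncn_gt0.
Qed.

Lemma cvg_truncn : Num.truncn Q @[Q --> (+oo : set_system R)] --> \oo.
Proof.
apply/cvgnyPge => N; near=> Q; have QN : N%:R <= Q by near: Q; exact: nbhs_pinfty_ge.
by rewrite /= truncn_ge_nat ?(le_trans _ QN).
Unshelve. all: by end_near. Qed.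

(** The 2 is the sign: [Phi] is asymptotic to [L / 2]. Both counts depend only on the integer part
    of [Q], so the limit along the integers suffices. *)
Lemma cvg_count_ratio m I (L W : R) : (0 < m)%N -> L != 0 ->
  (primsum m K I)%:R / K%:R ^+ m.+1 @[K --> \oo] --> L ->
  (gensum 1 m K I)%:R / K%:R ^+ m.+1 @[K --> \oo] --> W ->
  count_ratio m.+1 Q I @[Q --> +oo] --> 2 * W / L.
Proof.
move=> m0 L0 /(cvg_Phi m0) cP /cvg_Omega cO.
have H : (Omega m.+1 (K%:R : R) I)%:R / (Phi m (K%:R : R) I)%:R @[K --> \oo] --> 2 * W / L.
  have -> : 2 * W / L = W / (L / 2) by field.
  have L2 : L / 2 != 0 by rewrite mulf_neq0.
  have H : (fun K => (Omega m.+1 (K%:R : R) I)%:R / K%:R ^+ m.+1 *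
      ((Phi m (K%:R : R) I)%:R / K%:R ^+ m.+1)^-1) @ \oo --> W / (L / 2).
    exact: cvgM cO (cvgV L2 cP).
  apply: cvg_trans H; apply: near_eq_cvg; near=> K.
  have K0 : (0 < K)%N by near: K; exact: nbhs_infty_gt.
  have Kn0 : K%:R ^+ m.+1 != 0 :> R by rewrite expf_neq0// pnatr_eq0 -lt0n.
  by rewrite /= invf_div mulrA divfK.
have H2 : (fun Q : R => (Omega m.+1 ((Num.truncn Q)%:R : R) I)%:R /
    (Phi m ((Num.truncn Q)%:R : R) I)%:R) @ +oo --> 2 * W / L.
  exact: cvg_comp _ _ cvg_truncn H.
apply: cvg_trans H2; apply: near_eq_cvg; near=> Q.
have Q1 : 1 <= Q by near: Q; exact: nbhs_pinfty_ge.
have Q0 : 0 <= Q by exact: le_trans Q1.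
by rewrite /= /count_ratio -Omega_truncn// -Phi_truncn.
Unshelve. all: by end_near. Qed.

End ratio.

(** * Roots of large absolute value *)

Section tails.
Context {R : realType}.
Implicit Types (I : set R).

Definition outside (r : R) : set R := [set t | r <= `|t|].

Lemma gensum_outside c m K (r : R) :
  gensum c m K [set: R] = (gensum c m K `]- r, r[%classic + gensum c m K (outside r))%N.
Proof.
rewrite /gensum -big_split; apply: eq_bigr => p _; rewrite /zroots.
have inE t : `]- r, r[%classic t <-> `|t| < r by rewrite /= in_itv/= ltr_norml.
have {1}-> : [set: R] = `]- r, r[%classic `|` outside r.
  apply/esym/seteqP; split=> // t _; have [rt|tr] := leP r `|t|; [by right|left].
  exact/inE.
rewrite rootcountU// -subset0 => t [/inE tr]; rewrite /outside/= leNgt.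
by rewrite tr.
Qed.

Lemma count_top_le m K B : (size [seq p : {poly int} <- polybox m.+1 K | (`|(p`_m)%R| <= B)%N]
  <= B.*2.+1 * K.*2.+1 ^ m)%N.
Proof.
rewrite -(size_ints B) -(size_polybox m K).
rewrite -(size_allpairs (fun (d : int) (q : {poly int}) => q + d *: 'X^m)).
apply: uniq_leq_size; first by apply: filter_uniq; exact: uniq_polybox.
move=> p; rewrite mem_filter => /andP[pB /polyboxP[sp hp]].
apply/allpairsPdep; exists p`_m, (p - p`_m *: 'X^m); split.
- by rewrite mem_ints.
- apply/polyboxP; split; first exact: size_drop_top.
  move=> i; rewrite coefB coefZ coefXn; case: eqP => [->|_].
    by rewrite mulr1 subrr.
  by rewrite mulr0 subr0.
- by rewrite subrK.
Qed.

Lemma int_norm_le (d : int) (x : R) : 0 <= x ->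
  (`|d%:~R| <= x) = (`|d| <= Num.truncn x)%N.
Proof. by move=> x0; rewrite truncn_ge_nat// -intr_norm -abszE. Qed.

Lemma count_top_le_real m K (x : R) : 0 <= x ->
  (count (fun p : {poly int} => `|(p`_m)%:~R| <= x) (polybox m.+1 K))%:R
    <= (2 * x + 1) * K.*2.+1%:R ^+ m :> R.
Proof.
move=> x0; rewrite -size_filter; under eq_filter do rewrite int_norm_le//.
apply: (@le_trans _ _ ((Num.truncn x).*2.+1 * K.*2.+1 ^ m)%:R).
  by rewrite ler_nat; exact: count_top_le.
rewrite natrM natrX ler_wpM2r ?exprn_ge0// -addn1 natrD -mul2n natrM lerD2r.
by rewrite ler_pM2l// truncn_le.
Qed.

Lemma rootcount_witness I (f : {poly R}) : rootcount I f != 0%N ->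
  exists2 t, I t & root f t.
Proof.
rewrite /rootcount; case: (f =P 0) => [//|_] H; apply: contrapT => no.
have E : I `&` [set a | root f a] = set0.
  by rewrite -subset0 => t [It ft]; apply: no; exists t.
by move: H; rewrite E fset_set0 cardfs0.
Qed.

(** Solving for the leading term and summing the geometric series bounds the coefficient of X^m by
    [K / (|t| - 1)], and [r <= 2 (|t| - 1)] since [2 <= r <= |t|]. *)
Lemma zroots_outside0 m K (p : {poly int}) (r : R) : 2 <= r ->
  p \in polybox m.+1 K -> zroots (outside r) p != 0%N ->
  `|(p`_m)%:~R| <= 2 * K%:R / r.
Proof.
move=> r2 /polyboxP[sp hp] /rootcount_witness[t rt pt].
have {}rt : r <= `|t| by [].
have r0 : 0 < r by lra.
have t0 : 0 < `|t| by exact: lt_le_trans rt.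
have hpR i : `|(p`_i)%:~R| <= K%:R :> R.
  by rewrite -intr_norm -abszE ler_nat.
move: pt; rewrite /= rootE (@horner_coef_wide _ m.+1) ?size_map_intr//.
rewrite big_ord_recr/= coef_map/= addrC addr_eq0 => /eqP pt.
have : `|(p`_m)%:~R| * `|t| ^+ m <= K%:R * \sum_(i < m) `|t| ^+ i.
  rewrite -normrX -normrM pt normrN (le_trans (ler_norm_sum _ _ _))//.
  rewrite mulr_sumr; apply: ler_sum => i _; rewrite coef_map/= normrM normrX.
  by rewrite ler_wpM2r ?exprn_ge0.
have geo : (`|t| - 1) * \sum_(i < m) `|t| ^+ i <= `|t| ^+ m.
  by rewrite -subrX1 gerBl.
set S := \sum_(i < m) _ in geo * => pm.
have S0 : 0 <= S by apply: sumr_ge0 => i _; rewrite exprn_ge0.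
have tm0 : 0 < `|t| ^+ m by rewrite exprn_gt0.
rewrite ler_pdivlMr// -(ler_pM2r tm0).
have : S * r <= 2 * `|t| ^+ m.
  apply: (@le_trans _ _ (S * (2 * (`|t| - 1)))).
    by rewrite ler_wpM2l//; lra.
  by rewrite mulrCA ler_pM2l// mulrC.
move=> Sr; apply: (@le_trans _ _ (K%:R * S * r)).
  by rewrite mulrAC ler_wpM2r// ltW.
by rewrite -mulrA [2 * _]mulrC -[leRHS]mulrA ler_wpM2l.
Qed.

Lemma gensum0_outside m K (r : R) : 2 <= r ->
  (gensum 0 m K (outside r))%:R <= m%:R * ((4%:R * K%:R / r + 1) * K.*2.+1%:R ^+ m) :> R.
Proof.
move=> r2; have x0 : 0 <= 2 * K%:R / r :> R by rewrite divr_ge0// ?mulr_ge0//; lra.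
have -> : 4%:R * K%:R / r = 2 * (2 * K%:R / r) by rewrite (_ : 4%:R = 2 * 2)  -?mulrA// -natrM.
apply: le_trans (ler_wpM2l (ler0n _ m) (count_top_le_real m K x0)).
rewrite -(natrM _ m) ler_nat -sum1_count big_distrr/= [leqRHS]big_mkcond/=.
rewrite /gensum !big_seq; apply: leq_sum => p pK; rewrite scale0r add0r.
have [-> //|nz] := eqVneq (zroots (outside r) p) 0%N.
rewrite (zroots_outside0 r2 pK nz) muln1 (leq_trans (zroots_le _ _))//.
by have /polyboxP[sp _] := pK; rewrite -subn1 leq_subLR add1n.
Qed.

End tails.

(** * The single large root of most monic polynomials *)

Section monic_tail.
Context {R : realType}.
Implicit Types (I : set R).

(* The monic polynomial X^(m+1) + p has the root t <> 0 iff F takes the value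
   -1 at 1/t, where F has the coefficients of p in reverse order. *)
Definition revpol m (p : {poly int}) : {poly R} :=
  pol 0 (fun k : 'I_m.+1 => (p`_(m - k))%:~R).

Lemma horner_revpol m (p : {poly int}) (u : R) :
  (revpol m p).[u] = \sum_(k < m.+1) (p`_(m - k))%:~R * u ^+ k.+1.
Proof. by rewrite horner_pol mul0r addr0. Qed.

Lemma horner_deriv_revpol m (p : {poly int}) (u : R) :
  (revpol m p)^`().[u] = \sum_(k < m.+1) k.+1%:R * (p`_(m - k))%:~R * u ^+ k.
Proof. by rewrite horner_deriv_pol mulr0 mul0r addr0. Qed.

Lemma root_monic_revpol m (p : {poly int}) (t : R) : (size p <= m.+1)%N -> t != 0 ->
  root (map_poly intr ('X^(m.+1) + p)) t = ((revpol m p).[t^-1] == -1).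
Proof.
move=> sp t0; rewrite rootE rmorphD/= map_polyXn hornerD hornerXn.
rewrite (@horner_coef_wide _ m.+1) ?size_map_intr//.
have -> : \sum_(i < m.+1) (map_poly intr p)`_i * t ^+ i = t ^+ m.+1 * (revpol m p).[t^-1].
  rewrite horner_revpol mulr_sumr (reindex_inj rev_ord_inj)/=; apply: eq_bigr => k _.
  rewrite coef_map/= subSS mulrCA; congr (_ * _).
  by rewrite exprVn -expfB_cond ?subSS// (negbTE t0) add0n.
rewrite -[X in X + _]mulr1 -mulrDr mulf_eq0 expf_eq0/= (negbTE t0) /=.
by rewrite addrC addr_eq0.
Qed.

Section big_top.
Variables (m K : nat) (p : {poly int}) (r : R).
Hypotheses (r2 : 2 <= r) (rK : r ^+ 2 <= K%:R) (pK : p \in polybox m.+1 K).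
(** On |u| <= 1/r the linear term of [revpol] then dominates the others, in value and in
    derivative. *)
Hypothesis top : 2 * (m.+1 ^ 2)%:R * K%:R / r < `|(p`_m)%:~R|.

Let r0 : 0 < r. Proof. exact: lt_le_trans r2. Qed.
Let hp i : `|(p`_i)%:~R| <= K%:R :> R.
Proof. by have /polyboxP[_ /(_ i)] := pK; rewrite -intr_norm -abszE ler_nat. Qed.
Let rV : 0 <= r^-1 <= 1.
Proof. by rewrite invr_ge0 (ltW r0) invf_le1//; move: r2; lra. Qed.

(** Covers both the derivative ([c k = k + 1], [e = 0]) and the value ([c = 1], [e = 1]) of the part
    of [revpol] beyond its linear term. *)
Let rest (c : nat -> R) (u : R) e : (forall k, (k <= m)%N -> 0 <= c k <= m.+1%:R) ->
  `|u| <= r^-1 ->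
  `|\sum_(k < m) c k.+1 * (p`_(m - k.+1))%:~R * u ^+ (k.+1 + e)| <=
     (m.+1 ^ 2)%:R * K%:R * r^-1 ^+ e.+1.
Proof.
move=> c1 ur; have [rv0 rv1] := andP rV.
apply: (le_trans (ler_norm_sum _ _ _)).
apply: (@le_trans _ _ (\sum_(k < m) m.+1%:R * K%:R * r^-1 ^+ e.+1)).
  apply: ler_sum => k _; have /andP[ck0 ck1] := c1 k.+1 (ltn_ord k).
  rewrite !normrM (ger0_norm ck0) normrX; apply: ler_pM => //.
  - by rewrite mulr_ge0.
  - by apply: ler_pM.
  - apply: (@le_trans _ _ (r^-1 ^+ (k.+1 + e))); first by rewrite lerXn2r// nnegrE.
    by rewrite ler_wiXn2l// addSn ltnS leq_addl.
rewrite sumr_const card_ord -[leLHS]mulr_natr [leLHS]mulrC !mulrA.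
rewrite ler_wpM2r ?exprn_ge0// ler_wpM2r// -natrM ler_nat.
by rewrite -mulnn leq_mul2r leqnSn orbT.
Qed.

Let deriv_rest u : `|u| <= r^-1 ->
  `|(revpol m p)^`().[u] - (p`_m)%:~R| <= (m.+1 ^ 2)%:R * K%:R / r.
Proof.
move=> ur; rewrite horner_deriv_revpol big_ord_recl/= subn0 expr0 mulr1 mul1r.
rewrite addrAC subrr add0r.
rewrite -[_ / r]/(_ * r^-1 ^+ 1) (le_trans _ (@rest (fun k => k.+1%:R) u 0 _ ur))//.
  rewrite le_eqVlt; apply/orP; left; apply/eqP; congr (`|_|).
  by apply: eq_bigr => k _; rewrite addn0.
by move=> k km; rewrite ler0n ler_nat.
Qed.

Let value_rest u : `|u| <= r^-1 ->
  `|(revpol m p).[u] - (p`_m)%:~R * u| <= (m.+1 ^ 2)%:R * K%:R / r ^+ 2.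
Proof.
move=> ur; rewrite horner_revpol big_ord_recl/= subn0 expr1 addrAC subrr add0r.
rewrite -exprVn (le_trans _ (@rest (fun=> 1) u 1 _ ur))//.
  rewrite le_eqVlt; apply/orP; left; apply/eqP; congr (`|_|).
  by apply: eq_bigr => k _; rewrite mul1r addn1.
by move=> k km; rewrite ler01 ler1n.
Qed.

Let itvP u : u \in `]- r^-1, r^-1[ -> `|u| <= r^-1.
Proof. by rewrite in_itv/= -ltr_norml => /ltW. Qed.

Let deriv_neq0 : {in `]- r^-1, r^-1[, forall u, (revpol m p)^`().[u] != 0}.
Proof.
move=> u /itvP/deriv_rest H; apply/eqP => E; move: H; rewrite E sub0r normrN => H.
have : 0 <= (m.+1 ^ 2)%:R * K%:R / r by rewrite divr_ge0 ?mulr_ge0// ltW.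
by move: top H; rewrite -!mulrA; lra.
Qed.

Let revpol_inj : forall u v, `|u| <= r^-1 -> `|v| <= r^-1 ->
  (revpol m p).[u] = (revpol m p).[v] -> u = v.
Proof.
suff lt u v : `|u| <= r^-1 -> `|v| <= r^-1 -> u < v ->
    (revpol m p).[u] <> (revpol m p).[v].
  move=> u v ur vr E; have [uv|vu|//] := ltgtP u v.
    by case: (lt u v ur vr uv).
  by case: (lt v u vr ur vu).
rewrite !ler_norml => /andP[u1 u2] /andP[v1 v2] uv E.
have [dp|dn] := horner_sign deriv_neq0.
  by have := horner_incr dp u1 uv v2; rewrite E ltxx.
have dp : {in `]- r^-1, r^-1[, forall t, 0 < (- revpol m p)^`().[t]}.
  by move=> t /dn; rewrite derivN hornerN oppr_gt0.
by have := horner_incr dp u1 uv v2; rewrite !hornerN E ltxx.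
Qed.

(** With [y = (m+1)^2 K / r], the linear term at the endpoints exceeds [2 y / r] in absolute value
    and the rest is at most [y / r]. At one endpoint the value is thus below [- y / r <= - 1], by
    [r ^ 2 <= K], while it is 0 at 0. *)
Let revpol_root : exists2 u, `|u| <= r^-1 & (revpol m p).[u] = -1.
Proof.
have rv0 : 0 < r^-1 by rewrite invr_gt0.
have top' := top; set x : R := (p`_m)%:~R in top'; set y := (m.+1 ^ 2)%:R * K%:R / r.
have yE : y * r^-1 = (m.+1 ^ 2)%:R * K%:R / r ^+ 2.
  by rewrite /y -mulrA -invfM -expr2.
have y1 : 1 <= y * r^-1.
  rewrite yE ler_pdivlMr ?exprn_gt0// mul1r.
  by apply: (le_trans rK); rewrite ler_peMl// ler1n expn_gt0.
have topy : 2 * y < `|x| by move: top'; rewrite /y !mulrA.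
have bnd u : `|u| = r^-1 -> `|(revpol m p).[u] - x * u| <= y * r^-1.
  move=> ur; have := @value_rest u; rewrite ur lexx => /(_ isT).
  by rewrite yE.
have F0 : (revpol m p).[0] = 0.
  by rewrite horner_revpol big1// => k _; rewrite expr0n/= mulr0.
move: (revpol m p) bnd F0 => F bnd F0.
have xr : 2 * y * r^-1 < `|x| * r^-1 by rewrite ltr_pM2r.
have [x0|x0] := leP 0 x.
  rewrite ger0_norm// in xr topy.
  have rn : `|- r^-1| = r^-1 by rewrite normrN gtr0_norm.
  have := bnd _ rn.
  rewrite ler_norml mulrN => /andP[_ H].
  have [||u /andP[u1 u2] /eqP] := @poly_ivt _ (F + 1%:P) (- r^-1) 0.
  - by rewrite oppr_le0 ltW.
  - by rewrite !hornerD !hornerC F0; apply/andP; split; lra.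
  rewrite hornerD hornerC => E; exists u; last by lra.
  by rewrite ler0_norm//; lra.
rewrite ltr0_norm// in xr topy.
have := bnd _ (gtr0_norm rv0).
rewrite ler_norml => /andP[_ H].
have [||u /andP[u1 u2] /eqP] := @poly_ivt _ (- (F + 1%:P)) 0 r^-1.
- exact: ltW.
- by rewrite !hornerN !hornerD !hornerC F0; apply/andP; split; lra.
rewrite hornerN hornerD hornerC => E; exists u; last by lra.
by rewrite ger0_norm.
Qed.

Lemma zroots_outside1 : zroots (outside r) ('X^(m.+1) + p) = 1%N.
Proof.
have /polyboxP[sp _] := pK.
have [u ur Fu] := revpol_root.
have u0 : u != 0.
  apply/eqP => u0; have := Fu; rewrite u0 horner_revpol big1.
    by move/eqP; rewrite eq_sym oppr_eq0 oner_eq0.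
  by move=> k _; rewrite expr0n/= mulr0.
rewrite /zroots /rootcount map_intr_eq0.
have Xp : 'X^(m.+1) + p != 0.
  have : ('X^(m.+1) + p)`_m.+1 = 1 by rewrite coefD coefXn eqxx nth_default ?addr0.
  by apply: contra_eq_neq => ->; rewrite coef0 eq_sym oner_eq0.
rewrite (negbTE Xp).
have -> : outside r `&` [set a | root (map_poly intr ('X^(m.+1) + p)) a] = [set u^-1].
  apply/seteqP; split=> t.
    move=> [rt]; rewrite /outside/= in rt; have t0 : t != 0.
      by rewrite -normr_gt0 (lt_le_trans r0).
    rewrite /= root_monic_revpol// => /eqP Ft; rewrite -[t]invrK; congr (_^-1).
    apply: revpol_inj => //; last by rewrite Ft Fu.
    by rewrite normfV lef_pV2 ?posrE ?normr_gt0.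
  move=> ->; split.
    rewrite /outside/= normfV -[r]invrK lef_pV2 ?posrE ?normr_gt0 ?invr_gt0//.
  by rewrite /= root_monic_revpol ?invr_eq0// invrK Fu.
by rewrite fset_set1 cardfs1.
Qed.

End big_top.

(** Each polynomial whose coefficient of X^m is large contributes exactly one root, so the main term
    is the size of the box. The others, few by [count_top_le_real], have between 0 and [m.+1] such
    roots. *)
Lemma gensum1_outside m K (r : R) : 2 <= r -> r ^+ 2 <= K%:R ->
  `|(gensum 1 m K (outside r))%:R - (K.*2.+1 ^ m.+1)%:R| <=
    m.+1%:R * ((4%:R * (m.+1 ^ 2)%:R * K%:R / r + 1) * K.*2.+1%:R ^ m) :> R.
Proof.
move=> r2 rK; set x : R := 2 * (m.+1 ^ 2)%:R * K%:R / r.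
have x0 : 0 <= x by rewrite divr_ge0 ?mulr_ge0//; lra.
have -> : 4%:R * (m.+1 ^ 2)%:R * K%:R / r = 2 * x.
  by rewrite /x; ring.
apply: le_trans (ler_wpM2l (ler0n _ m.+1) (count_top_le_real m K x0)).
rewrite /gensum -(size_polybox m.+1 K) -sum1_size !natr_sum -sumrB.
apply: (le_trans (ler_norm_sum _ _ _)).
rewrite -sum1_count natr_sum mulr_sumr [leRHS]big_mkcond/= !big_seq.
apply: ler_sum => p pK; rewrite scale1r.
case: ifPn => [_|]; last first.
  by rewrite -ltNge => top; rewrite (zroots_outside1 r2 rK pK top) subrr normr0.
have sz : (zroots (outside r) ('X^(m.+1) + p) <= m.+1)%N.
  rewrite (leq_trans (zroots_le _ _))// -subn1 leq_subLR add1n.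
  have /polyboxP[sp _] := pK; rewrite (leq_trans (size_polyD _ _))// geq_max.
  by rewrite size_polyXn leqnn ltnW.
rewrite mulr1; move: sz; rewrite -(ler_nat R); move: (zroots _ _) => z.
have : 0 <= z%:R :> R by [].
have : 1 <= m.+1%:R :> R by rewrite ler1n.
by rewrite ler_norml => *; apply/andP; split; lra.
Qed.

End monic_tail.

(** * Passage to the whole real line *)

Section real_line.
Context {R : realType}.
Local Notation mu := (@lebesgue_measure R).
Local Notation lam m := (@lebesgue_tuple R m).

Lemma phi_ge0 m (t : R) : (0 <= phi m t)%E.
Proof. by rewrite phiE; apply: integral_ge0 => p _; exact: kacrice_ge0. Qed.

Lemma measurable_phi m : measurable_fun setT (@phi R m).
Proof.
rewrite (_ : phi m = fubini_F (lam m) (@kacrice R m setT)).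
  apply: measurable_fun_fubini_tonelli_F; first exact: measurable_kacrice.
  by move=> x; exact: kacrice_ge0.
by apply/funext => t; rewrite phiE.
Qed.

Definition phi_integral m (j : nat) : R :=
  fine (\int[mu]_(t in `](- j%:R)%R, j%:R[) phi m t)%E.

Lemma cvg_phi_integrale m :
  (\int[mu]_(t in `](- j%:R)%R, j%:R[) phi m t)%E @[j --> \oo] -->
  (\int[mu]_t phi m t)%E.
Proof.
have -> : [set: R] = \bigcup_j `](- j%:R)%R, (j%:R : R)[%classic.
  apply/esym/seteqP; split=> // t _; exists (Num.truncn `|t|).+1 => //=.
  by rewrite in_itv/= -ltr_norml truncnS_gt.
apply: (@ge0_nondecreasing_set_cvg_integral _ (measurableTypeR R) R (fun j => `](- j%:R)%R, (j%:R : R)[%classic) (phi m) mu).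
- apply/nondecreasing_seqP => j; apply/subsetPset => t /=; rewrite !in_itv/= -!ltr_norml.
  by move/lt_le_trans; apply; rewrite ler_nat.
- by move=> j; exact: measurable_itv.
- by move=> j; apply: measurable_funTS; exact: measurable_phi.
- by move=> j t _; exact: phi_ge0.
Qed.

Lemma gensum0_le m K (I : set R) : (0 < K)%N ->
  (gensum 0 m K I)%:R / K%:R ^+ m.+1 <= (m * 3 ^ m.+1)%:R :> R.
Proof.
move=> K0; have Kn0 : 0 < K%:R ^+ m.+1 :> R by rewrite exprn_gt0// ltr0n.
rewrite ler_pdivrMr// -natrX -natrM ler_nat; apply: (@leq_trans (m * size (polybox m.+1 K))).
  rewrite /gensum; under eq_bigr do rewrite scale0r add0r.
  by apply: sum_zroots_le => p /polyboxP[].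
rewrite size_polybox -mulnA leq_mul2l -expnMn leq_exp2rW ?orbT//; lia.
Qed.

Lemma cvg_gensum_j (c : int) m j : `|c| <= 1 -> (0 < j)%N ->
  (gensum c m K `](- j%:R)%R, (j%:R : R)[%classic)%:R / K%:R ^+ m.+1
    @[K --> \oo] --> phi_integral m j.
Proof.
move=> c1 j0; have j0' : (- j%:R)%R < j%:R :> R by rewrite gtrN// ltr0n.
exact: (cvg_gensum false true c1 j0').
Qed.

(** The integral is a limit of normalized root counts, and these are bounded by the degree times the
    size of the box. The bound does not depend on [j], so phi is integrable over R. *)
Lemma phi_integral_le m j : (0 < j)%N -> phi_integral m j <= (m * 3 ^ m.+1)%:R.
Proof.
move=> j0; have H := @cvg_gensum_j 0 m j; rewrite normr0 ler01 in H.
have {}H := H isT j0; rewrite -(cvg_lim _ H)//; apply: limr_le.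
  by apply/cvg_ex; exists (phi_integral m j).
near=> K; apply: gensum0_le; near: K; exact: nbhs_infty_gt.
Unshelve. all: by end_near. Qed.

Lemma phi_fin_num m : (\int[mu]_t phi m t)%E \is a fin_num.
Proof.
rewrite ge0_fin_numE; last by apply: integral_ge0 => t _; exact: phi_ge0.
apply: (@le_lt_trans _ _ (m * 3 ^ m.+1)%:R%:E); last exact: ltry.
have H := @cvg_phi_integrale m; rewrite -(cvg_lim _ H)//.
apply: lime_le; first by apply/cvg_ex; exists (\int[mu]_t phi m t)%E.
near=> j; have j0 : (0 < j)%N by near: j; exact: nbhs_infty_gt.
have j0' : (- j%:R)%R < j%:R :> R by rewrite gtrN// ltr0n.
by rewrite -[leLHS]fineK ?lee_fin; [exact: phi_integral_le|exact: phi_itv_fin_num].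
Unshelve. all: by end_near. Qed.

Lemma cvg_phi_integral m :
  phi_integral m j @[j --> \oo] --> fine (\int[mu]_t phi m t)%E.
Proof.
by apply: fine_cvg; rewrite fineK ?phi_fin_num//; exact: cvg_phi_integrale.
Qed.

(** Exchange of limits: [C] depends neither on [j] nor on [K], so one [j] can be fixed before [K]
    grows. The term [r] carries mass escaping to infinity. *)
Lemma cvg_exhaustion (A r : nat -> R) (a : nat -> nat -> R) (v : nat -> R) (V l C : R) :
  (forall j, (0 < j)%N -> a j K @[K --> \oo] --> v j) -> v @ \oo --> V ->
  r @ \oo --> l ->
  (forall j, (2 <= j)%N -> \forall K \near \oo, `|A K - a j K - r K| <= C / j%:R) ->
  A @ \oo --> V + l.
Proof.
move=> av vV rl H; apply/cvgrPdist_le => eps eps0.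
have e4 : 0 < eps / 4%:R by rewrite divr_gt0.
have vS : v n.+1 @[n --> \oo] --> V by rewrite (cvg_shiftS v).
have CC : C * n.+1%:R^-1 @[n --> \oo] --> (0 : R).
  by rewrite -[0](mulr0 C); apply: cvgMl_tmp; exact: cvg_harmonic.
have : \forall n \near \oo, [/\ `|V - v n.+1| <= eps / 4%:R, C / n.+1%:R <= eps / 4%:R & (1 <= n)%N].
  near=> n; split.
  - by near: n; move/cvgrPdist_le : vS; apply.
  - by apply: ltW; near: n; apply: cvgr_lt e4; exact: CC.
  - by near: n; exact: nbhs_infty_ge.
move=> [n0 _ /(_ n0 (leqnn n0))[vn Cn n1]].
near=> K.
have h1 : `|v n0.+1 - a n0.+1 K| <= eps / 4%:R.
  by near: K; have /cvgrPdist_le := av n0.+1 isT; apply.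
have h2 : `|l - r K| <= eps / 4%:R by near: K; move/cvgrPdist_le : rl; apply.
have h3 : `|A K - a n0.+1 K - r K| <= C / n0.+1%:R.
  by near: K; apply: H; rewrite ltnS.
have {}h3 := le_trans h3 Cn; move: vn h1 h2 h3; rewrite !ler_norml.
move: (v _) (a _ _) (A _) (r _) => v0 a0 A0 r0 /andP[? ?] /andP[? ?] /andP[? ?] /andP[? ?].
by apply/andP; split; lra.
Unshelve. all: by end_near. Qed.

Lemma tail_le m K j (x : R) : (0 < j)%N -> (j <= K)%N -> 0 <= x ->
  (x * K%:R / j%:R + 1) * K.*2.+1%:R ^+ m / K%:R ^+ m.+1 <= 3%:R ^+ m * (x + 1) / j%:R.
Proof.
move=> j0 jK x0; have K0 : (0 < K)%N by exact: leq_trans jK.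
have K0' : 0 < K%:R :> R by rewrite ltr0n.
have j0' : 0 < j%:R :> R by rewrite ltr0n.
rewrite ler_pdivrMr ?exprn_gt0//.
have a1 : x * K%:R / j%:R + 1 <= (x + 1) / j%:R * K%:R.
  rewrite mulrDl mul1r mulrDl mulrAC lerD2l mulrC ler_pdivlMr// mul1r ler_nat//.
have a2 : K.*2.+1%:R ^+ m <= 3%:R ^+ m * K%:R ^+ m :> R.
  by rewrite -exprMn lerXn2r// ?nnegrE// -natrM ler_nat; lia.
apply: (le_trans (ler_pM _ _ a1 a2)).
- by rewrite addr_ge0// divr_ge0// mulr_ge0// ltW.
- by rewrite exprn_ge0.
by rewrite exprS le_eqVlt; apply/orP; left; apply/eqP; ring.
Qed.

Lemma cvg_gensum0_setT m :
  (gensum 0 m K [set: R])%:R / K%:R ^+ m.+1 @[K --> \oo] -->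
  fine (\int[mu]_t phi m t)%E.
Proof.
rewrite -[fine _]addr0.
apply: (@cvg_exhaustion _ (cst 0)
  (fun j K => (gensum 0 m K `](- j%:R)%R, (j%:R : R)[%classic)%:R / K%:R ^+ m.+1)
  (phi_integral m) _ 0 (m%:R * (3%:R ^+ m * (4%:R + 1)))).
- by move=> j j0; apply: cvg_gensum_j => //; rewrite normr0.
- exact: cvg_phi_integral.
- exact: cvg_cst.
- move=> j j2; near=> K.
  have jK : (j <= K)%N by near: K; exact: nbhs_infty_ge.
  have j0 : (0 < j)%N by exact: leq_trans j2.
  have Kn0 : 0 < K%:R ^+ m.+1 :> R by rewrite exprn_gt0// ltr0n (leq_trans j0).
  rewrite subr0 (gensum_outside _ _ _ j%:R) natrD mulrDl addrAC subrr add0r.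
  rewrite ger0_norm ?divr_ge0// ?(ltW Kn0)//.
  have r2 : 2 <= j%:R :> R by rewrite ler_nat.
  apply: (@le_trans _ _ (m%:R * ((4%:R * K%:R / j%:R + 1) * K.*2.+1%:R ^+ m) / K%:R ^+ m.+1)).
    by rewrite ler_pM2r ?invr_gt0//; exact: gensum0_outside.
  by rewrite -!mulrA ler_wpM2l// !mulrA tail_le.
Unshelve. all: by end_near. Qed.

Lemma cvg_boxsize m : (K.*2.+1 ^ m)%:R / K%:R ^+ m @[K --> \oo] --> (2 ^+ m : R).
Proof.
rewrite -cvg_shiftS.
have H : (2 + n.+1%:R^-1 : R) @[n --> \oo] --> (2 : R).
  by rewrite -[X in _ --> X]addr0; apply: cvgD; [exact: cvg_cst|exact: cvg_harmonic].
have HX : (2 + n.+1%:R^-1 : R) ^+ m @[n --> \oo] --> (2 ^+ m : R).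
  elim: m => [|m IH]; first by under eq_cvg do rewrite expr0; rewrite expr0; exact: cvg_cst.
  by under eq_cvg do rewrite exprS; rewrite exprS; exact: cvgM.
apply: cvg_trans HX; apply: near_eq_cvg; near=> n.
rewrite /mk_sequence natrX -expr_div_n; congr (_ ^+ _).
have n0 : n.+1%:R != 0 :> R by rewrite pnatr_eq0.
have -> : n.+1.*2.+1%:R = 2 * n.+1%:R + 1 :> R by rewrite -natr1 -mul2n natrM.
by rewrite mulrDl mulfK// mul1r.
Unshelve. all: by end_near. Qed.

Lemma cvg_gensum1_setT m :
  (gensum 1 m K [set: R])%:R / K%:R ^+ m.+1 @[K --> \oo] -->
  fine (\int[mu]_t phi m t)%E + 2 ^+ m.+1.
Proof.
apply: (@cvg_exhaustion _ (fun K => (K.*2.+1 ^ m.+1)%:R / K%:R ^+ m.+1)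
  (fun j K => (gensum 1 m K `](- j%:R)%R, (j%:R : R)[%classic)%:R / K%:R ^+ m.+1)
  (phi_integral m) _ _ (m.+1%:R * (3%:R ^+ m * (4%:R * (m.+1 ^ 2)%:R + 1)))).
- by move=> j j0; exact: cvg_gensum_j.
- exact: cvg_phi_integral.
- exact: cvg_boxsize.
- move=> j j2; near=> K.
  (* Supplies the condition [r ^ 2 <= K] of [gensum1_outside]. *)
  have jK2 : (j ^ 2 <= K)%N by near: K; exact: nbhs_infty_ge.
  have j0 : (0 < j)%N by exact: leq_trans j2.
  have jK : (j <= K)%N by rewrite (leq_trans _ jK2)// -mulnn leq_pmulr.
  have Kn0 : 0 < K%:R ^+ m.+1 :> R by rewrite exprn_gt0// ltr0n (leq_trans j0).
  have E (x y z : R) : x + y - x - z = y - z by ring.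
  rewrite (gensum_outside _ _ _ j%:R) natrD mulrDl E.
  rewrite -mulrBl normrM normfV [X in _ / X]gtr0_norm//.
  have r2 : 2 <= j%:R :> R by rewrite ler_nat.
  have rK : j%:R ^+ 2 <= K%:R :> R by rewrite -natrX ler_nat.
  apply: (@le_trans _ _ (m.+1%:R * ((4%:R * (m.+1 ^ 2)%:R * K%:R / j%:R + 1) * K.*2.+1%:R ^+ m) / K%:R ^+ m.+1)).
    by rewrite ler_pM2r ?invr_gt0//; exact: gensum1_outside.
  by rewrite -[leLHS]mulrA -[leRHS]mulrA ler_wpM2l// tail_le// mulr_ge0.
Unshelve. all: by end_near. Qed.

End real_line.

(** * Positivity of the density *)

Section positivity.
Context {R : realType}.
Local Notation mu := (@lebesgue_measure R).
Local Notation lam m := (@lebesgue_tuple R m).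

(* On a small box of vectors p whose first coordinate dominates, |f_p| <= 1 and
   |f_p'| is bounded below on [-T, T]. *)
Lemma phi_gt0_bounded m (T : R) : 1 <= T -> exists2 c : R, 0 < c &
  forall t, `|t| <= T -> (c%:E <= phi m.+1 t)%E.
Proof.
move=> T1; have T0 : 0 < T by exact: lt_le_trans T1.
have TX0 : 0 < T ^+ m.+1 by rewrite exprn_gt0.
have TX1 : 1 <= T ^+ m.+1 by rewrite exprn_ege1.
pose M : R := m.+1%:R; have M1 : 1 <= M by rewrite ler1n.
have M0 : 0 < M by exact: lt_le_trans M1.
(* With all coefficients at most [2 d], this gives |f| <= 1 on [-T, T]. The size [h] of the
   coefficients after the first is such that they add at most [d / 2] to f', leaving
   [f' >= d / 2]. *)
pose d := (2 * M * T ^+ m.+1)^-1.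
have d0 : 0 < d by rewrite invr_gt0 !mulr_gt0.
have dE : 2 * d * M * T ^+ m.+1 = 1 by rewrite /d; field; rewrite !gt_eqF.
pose h := d / (2 * M * M * T ^+ m.+1).
have h0 : 0 < h by rewrite divr_gt0// !mulr_gt0.
have hE : M * M * h * T ^+ m.+1 = d / 2 by rewrite /h; field; rewrite !gt_eqF.
have hd : h <= d.
  apply: (@le_trans _ _ (d / 2)); last by lra.
  rewrite -hE [M * M * h]mulrC -mulrA ler_peMr//; first exact: ltW.
  by rewrite -[1]mulr1 ler_pM// -[1]mulr1 ler_pM.
clearbody h; clearbody d.
pose lo (k : 'I_m.+1) : R := if k == ord0 then d else 0.
pose hi (k : 'I_m.+1) : R := if k == ord0 then 2 * d else h.
have lohi k : lo k < hi k by rewrite /lo /hi; case: ifP => // _; lra.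
pose B := [set p : m.+1.-tuple (measurableTypeR R) |
  forall k, `[lo k, hi k]%classic (tnth p k : R)].
have mB : measurable B by exact: (@measurable_box R _ (fun k => `[lo k, hi k]%classic)).
pose v := \prod_(k < m.+1) (hi k - lo k).
have lamB : lam m.+1 B = v%:E.
  rewrite (@lebesgue_tuple_box R m.+1 (fun k => `[lo k, hi k]%classic))//.
  under eq_bigr do rewrite lebesgue_measure_itv/=.
  rewrite /v -prodEFin; apply: eq_bigr => k _.
  by rewrite lte_fin lohi -EFinB.
have v0 : 0 < v by apply: prodr_gt0 => k _; rewrite subr_gt0.
exists (d / 2 * v); first by rewrite !mulr_gt0.
move=> t tT; rewrite phiE EFinM -lamB.
have -> : lam m.+1 B = (\int[lam m.+1]_p (\1_B p)%:E)%E by rewrite integral_indic// setIT.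
rewrite -ge0_integralZl_EFin//; last 2 first.
- by apply/measurable_EFinP; exact: measurable_indic.
- by rewrite divr_ge0// ltW.
apply: ge0_le_integral => //.
- by move=> p _; rewrite -EFinM lee_fin mulr_ge0// divr_ge0// ltW.
- by apply/measurable_EFinP; apply: measurable_funM => //; exact: measurable_indic.
- apply: (measurableT_comp (@measurable_kacrice R m.+1 setT measurableT)).
  by apply: measurable_fun_pair => //; exact: measurable_cst.
move=> p _; rewrite -EFinM; case: (boolP (p \in B)) => [/set_mem pB|pB]; last first.
  by rewrite indicE (negbTE pB) mulr0; exact: kacrice_ge0.
have pb k : 0 <= (tnth p k : R) <= 2 * d /\ (k != ord0 -> `|tnth p k : R| <= h).
  have := pB k; rewrite /= in_itv/= /lo /hi; case: (k == ord0) => /andP[p1 p2].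
    by split=> //; apply/andP; split=> //; lra.
  by split=> [|_]; [apply/andP; split=> //; lra|rewrite ger0_norm].
have pn k : `|tnth p k : R| <= 2 * d.
  by have [/andP[p1 p2] _] := pb k; rewrite ger0_norm.
have tX k : (k <= m.+1)%N -> `|t| ^+ k <= T ^+ m.+1.
  move=> km; apply: (@le_trans _ _ (T ^+ k)); first by rewrite lerXn2r// nnegrE// ltW.
  by rewrite ler_weXn2l.
have d1 : 2 * d <= 1.
  apply: (@le_trans _ _ (2 * d * M * T ^+ m.+1)); last by rewrite dE.
  rewrite -mulrA ler_peMr//; first by rewrite mulr_ge0// ltW.
  by rewrite -[1]mulr1 ler_pM.
rewrite indicE mem_set// mulr1 /kacrice indicE mem_set; last first.
  by split => //; apply/cubeP => k; exact: le_trans (pn k) d1.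
rewrite mul1r lee_fin /dens /= ifT.
  rewrite horner_deriv_pol mulr0 mul0r addr0 big_ord_recl/= expr0 mulr1 mul1r.
  set S := \sum_(i < m) _.
  have Sle : `|S| <= d / 2.
    apply: (le_trans (ler_norm_sum _ _ _)).
    apply: (@le_trans _ _ (\sum_(i < m) M * h * T ^+ m.+1)).
      apply: ler_sum => i _; rewrite !normrM normr_nat normrX.
      apply: ler_pM; rewrite ?mulr_ge0//; last first.
        by apply: tX; rewrite /bump leq0n add1n ltnS ltnW// ltn_ord.
      apply: ler_pM => //; first by rewrite ler_nat ltnS ltn_ord.
      by have [_] := pb (lift ord0 i); apply.
    rewrite sumr_const card_ord -[leLHS]mulr_natr -hE mulrC !mulrA.
    by rewrite !ler_pM2r// /M ler_nat.
  have : d <= (tnth p ord0 : R).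
    by have := pB ord0; rewrite /= in_itv/= /lo eqxx => /andP[].
  move: Sle; rewrite ler_norml => /andP[S1 _] dp.
  by apply: le_trans (ler_norm _); lra.
rewrite horner_pol mul0r addr0 (le_trans (ler_norm_sum _ _ _))//.
rewrite -[leRHS]dE; apply: (@le_trans _ _ (\sum_(k < m.+1) 2 * d * T ^+ m.+1)).
  apply: ler_sum => k _; rewrite normrM normrX; apply: ler_pM => //.
  exact: tX.
by rewrite sumr_const card_ord -[leLHS]mulr_natr -/M mulrAC.
Qed.

Lemma phi_itv_gt0 m (a b : R) : a < b ->
  0 < fine (\int[mu]_(t in `]a, b[) phi m.+1 t)%E.
Proof.
move=> ab; have T1 : 1 <= 1 + (`|a| + `|b|) by rewrite lerDl addr_ge0.
have [c c0 H] := phi_gt0_bounded m T1.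
have fin := phi_itv_fin_num m.+1 ab.
rewrite -lte_fin fineK//.
apply: (@lt_le_trans _ _ (\int[mu]_(t in `]a, b[) (cst c%:E t))%E).
  rewrite integral_cst//= lebesgue_measure_itv/= lte_fin ab -EFinB -EFinM lte_fin.
  by rewrite mulr_gt0// subr_gt0.
apply: ge0_le_integral => //.
- by move=> t _; rewrite lee_fin ltW.
- by apply: measurable_funTS; exact: measurable_phi.
- move=> t /= tab; apply: H; apply: (le_trans (itv_norm_le tab)).
  by rewrite lerDr.
Qed.

End positivity.

(** * Endpoints of intervals, Cauchy's bound, and the theorem *)

Section asymptotics.
Context {R : realType}.
Local Notation mu := (@lebesgue_measure R).

Lemma bounded_interval_endpoints (I : set R) :
  is_interval I -> bounded_set I -> I° !=set0 ->
  exists (i j : bool) (a b : R),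
    a < b /\ I = [set` Interval (BSide i a) (BSide j b)].
Proof.
move=> /is_intervalP iI bI [x Ix]; have Ix0 := interior_subset Ix.
have [M [_ HM]] := bI; have {}HM y : I y -> `|y| <= M + 1.
  by move=> Iy; apply: (HM (M + 1)); rewrite ?ltrDl.
have lI : has_lbound I.
  by exists (- (M + 1)) => y /HM; rewrite ler_norml => /andP[].
have uI : has_ubound I.
  by exists (M + 1) => y /HM; rewrite ler_norml => /andP[].
(* [BSide true] is a closed end on the left but an open one on the right, hence the negation. *)
exists `[< I (inf I) >], (~~ `[< I (sup I) >]), (inf I), (sup I); split.
  move: Ix => /nbhs_ballP[e /= e0 He].
  have Ie : I (x + e / 2).
    apply: He; rewrite /ball/= opprD addNKr normrN gtr0_norm ?divr_gt0//; lra.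
  have := ge_inf lI Ix0; have := ub_le_sup uI Ie; lra.
by rewrite {1}iI /Rhull (asboolT lI) (asboolT uI).
Qed.

Lemma phi_gt0 m : 0 < fine (\int[mu]_t phi m.+1 t)%E.
Proof.
have ab : (0 : R) < 1 by [].
apply: (lt_le_trans (phi_itv_gt0 m ab)); apply: fine_le.
- exact: phi_itv_fin_num.
- exact: phi_fin_num.
apply: ge0_subset_integral => //.
- exact: measurable_phi.
- by move=> t _; exact: phi_ge0.
Qed.

Lemma cauchy_bound (p : {poly int}) (Q a : R) : p != 0 -> 0 <= Q ->
  (height p)%:R <= Q -> vanishes_at p a -> `|a| <= Q + 1.
Proof.
move=> p0 Q0; rewrite height_le// => /heightP hp pa.
have hpR i : `|(p`_i)%:~R| <= Q :> R by rewrite int_norm_le.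
rewrite -lerBlDr leNgt; apply/negP => Qa; have a0 : 0 < `|a| - 1 by exact: le_lt_trans Qa.
have t0 : 0 < `|a| by lra.
have [d sd] : exists d, size p = d.+1 by exists (size p).-1; rewrite prednK ?size_poly_gt0.
have l1 : 1 <= `|(p`_d)%:~R| :> R.
  rewrite -intr_norm -[1]/(1%:Z%:~R) ler_int -gtz0_ge1 normr_gt0.
  by have := lead_coef_eq0 p; rewrite /lead_coef sd /= => ->.
move: pa; rewrite /vanishes_at rootE (@horner_coef_wide _ d.+1) ?size_map_intr ?sd//.
rewrite big_ord_recr/= coef_map/= addrC addr_eq0 => /eqP pa.
have h1 : `|a| ^+ d <= Q * \sum_(i < d) `|a| ^+ i.
  apply: (@le_trans _ _ (`|(p`_d)%:~R| * `|a| ^+ d)); first by rewrite ler_peMl// exprn_ge0.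
  rewrite -normrX -normrM pa normrN (le_trans (ler_norm_sum _ _ _))//.
  rewrite mulr_sumr; apply: ler_sum => i _; rewrite coef_map/= normrM normrX.
  by rewrite ler_wpM2r ?exprn_ge0.
have geo : (`|a| - 1) * \sum_(i < d) `|a| ^+ i = `|a| ^+ d - 1 by rewrite subrX1.
have tm0 : 0 < `|a| ^+ d by rewrite exprn_gt0.
have : (`|a| - 1) * `|a| ^+ d <= Q * (`|a| ^+ d - 1).
  by rewrite -geo mulrCA ler_wpM2l// ltW.
have : Q * `|a| ^+ d < (`|a| - 1) * `|a| ^+ d by rewrite ltr_pM2r.
by rewrite mulrBr mulr1; lra.
Qed.

(** For [0 <= Q] it strictly contains Cauchy's bound [Q + 1], hence every number counted; the
    absolute value keeps it nonempty for negative [Q]. *)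
Definition window (Q : R) : set R := `](- (`|Q| + 2))%R, `|Q| + 2[%classic.

Lemma algebraic_window d (Q : R) : 0 <= Q ->
  algebraic_numbers d Q (window Q) = algebraic_numbers d Q [set: R] /\
  algebraic_integers d Q (window Q) = algebraic_integers d Q [set: R].
Proof.
move=> Q0.
have key p a : is_minpoly a p -> (height p)%:R <= Q -> window Q a.
  move=> [p0 pa _ _ _] hp; have := cauchy_bound p0 Q0 hp pa.
  by rewrite /window/= in_itv/= -ltr_norml (ger0_norm Q0) => /le_lt_trans; apply; lra.
split; apply/seteqP; split=> a [_ [p H]]; split=> //; try by exists p.
- by have [mp _ hp] := H; exact: key mp hp.
- by have [mp _ _ hp] := H; exact: key mp hp.
Qed.

Lemma zeta_gt0 n : (2 <= n)%N -> 0 < zeta (n%:R : R).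
Proof. by move=> n2; apply: lt_le_trans (zeta_ge1 n2). Qed.

End asymptotics.

Theorem corollary1 (R : realType) (n : nat) (hn : (2 <= n)%N) :
  [/\ (* every fixed finite interval *)
      forall I : set R, is_interval I -> bounded_set I -> I° !=set0 ->
        count_ratio n Q I @[Q --> +oo] --> 2 * zeta (n%:R : R),
      (* failure for some infinite interval *)
      exists I : set R,
        [/\ is_interval I, ~ bounded_set I &
            ~ (count_ratio n Q I @[Q --> +oo] --> 2 * zeta (n%:R : R))],
      (* failure for some finite interval depending on Q *)
      exists J : R -> set R,
        [/\ forall Q, [/\ is_interval (J Q), bounded_set (J Q) &
                          (J Q)° !=set0],
            \forall Q \near +oo, (0 < Phi n.-1 Q (J Q))%N &
            ~ (count_ratio n Q (J Q) @[Q --> +oo] --> 2 * zeta (n%:R : R))] &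
      (* the whole real line *)
      count_ratio n Q [set: R] @[Q --> +oo] -->
        2 * zeta (n%:R : R) *
          (1 + 2 ^+ n / fine (\int[lebesgue_measure]_(t in [set: R])
                                 phi n.-1 t)%E)].
Proof.
case: n hn => [//|[//|m]] hn; set n := m.+2.
have z0 := @zeta_gt0 R n hn.
set V : R := fine (\int[lebesgue_measure]_(t in [set: R]) phi n.-1 t)%E.
have V0 : 0 < V by exact: phi_gt0.
have ratioR : count_ratio n Q [set: R] @[Q --> +oo] --> 2 * zeta (n%:R : R) * (1 + 2 ^+ n / V).
  have -> : 2 * zeta (n%:R : R) * (1 + 2 ^+ n / V) =
      2 * (V + 2 ^+ n) / (V / zeta (n%:R : R)) by field; rewrite !gt_eqF.
  apply: (@cvg_count_ratio _ m.+1) => //.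
  - by rewrite mulf_neq0 ?invr_neq0 ?gt_eqF.
  - by apply: cvg_primsum => //; [exact: ltW|exact: cvg_gensum0_setT].
  - exact: cvg_gensum1_setT.
(* Both failures are proved by exhibiting the limit over the real line, which differs by a positive
   amount. *)
have neq : 2 * zeta (n%:R : R) * (1 + 2 ^+ n / V) <> 2 * zeta (n%:R : R).
  have pos : 0 < 2 * zeta (n%:R : R) * (2 ^+ n / V).
    by apply: mulr_gt0; [exact: mulr_gt0|apply: divr_gt0 => //; exact: exprn_gt0].
  rewrite mulrDr mulr1 => E.
  by move: pos; rewrite -(ltrDl (2 * zeta n%:R)) E ltxx.
have nolim (u : R -> R) : u Q @[Q --> +oo] --> 2 * zeta (n%:R : R) * (1 + 2 ^+ n / V) ->
    ~ (u Q @[Q --> +oo] --> 2 * zeta (n%:R : R)).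
  by move=> u1 u2; apply: neq; exact: (cvg_unique _ u1 u2).
split.
- move=> I iI bI I0; have [i [j [a [b [ab ->]]]]] := bounded_interval_endpoints iI bI I0.
  set W := fine (\int[lebesgue_measure]_(t in `]a, b[) phi m.+1 t)%E.
  have W0 : 0 < W by exact: phi_itv_gt0.
  have -> : 2 * zeta (n%:R : R) = 2 * W / (W / zeta (n%:R : R)) by field; rewrite !gt_eqF.
  apply: (@cvg_count_ratio _ m.+1) => //.
  + by rewrite mulf_neq0 ?invr_neq0 ?gt_eqF.
  + apply: cvg_primsum => //; first exact: ltW.
    by apply: cvg_gensum => //; rewrite normr0.
  + exact: cvg_gensum.
- exists [set: R]; split.
  + by move=> x y _ _ z _.
  + move=> [M [_ HM]]; have M1 : M < `|M| + 1 by rewrite (le_lt_trans (ler_norm M))// ltrDl.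
    have := le_trans (ler_norm _) (HM _ M1 (`|M| + 2) Logic.I).
    by rewrite lerD2l; apply/negP; rewrite -ltNge ltr1n.
  + exact: nolim.
- exists window; split.
  + move=> Q; have Q0 : 0 < `|Q| + 2 by rewrite ltr_wpDl.
    split.
    * exact: interval_is_interval.
    * exists (`|Q| + 2); split; first exact: num_real.
      move=> M QM t; rewrite /window/= in_itv/= -ltr_norml => tQ.
      by rewrite (le_trans (ltW tQ))// ltW.
    * exists 0; have H : 0 \in `](- (`|Q| + 2))%R, `|Q| + 2[ by rewrite in_itv/= oppr_lt0 Q0.
      exact: near_in_itvoo H.
  (* The normalized [Phi] tends to [V / zeta(n) / 2 > 0], so the denominator is eventually nonzero
     and the failure is not due to division by 0. *)
  + have cP := @cvg_Phi R m.+1 [set: R] (V / zeta (n%:R : R)) isT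
      (@cvg_primsum R m.+1 _ V (ltn0Sn m) (ltW V0) (@cvg_gensum0_setT R m.+1)).
    have L0 : 0 < V / zeta (n%:R : R) / 2 by rewrite !divr_gt0.
    have H := cvg_comp _ _ (@cvg_truncn R) cP.
    near=> Q.
    have Q0 : 0 <= Q by near: Q; exact: nbhs_pinfty_ge.
    have : 0 < (Phi m.+1 (Num.truncn Q)%:R [set: R])%:R / (Num.truncn Q)%:R ^+ m.+2 :> R.
      by near: Q; apply: cvgr_gt L0; exact: H.
    have <- : Phi n.-1 Q (window Q) = Phi m.+1 (Num.truncn Q)%:R [set: R].
      by rewrite -Phi_truncn// /Phi (algebraic_window _ Q0).1.
    by case: (Phi _ _ _) => //; rewrite mul0r ltxx.
  + apply: nolim; apply: cvg_trans ratioR; apply: near_eq_cvg; near=> Q.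
    have Q0 : 0 <= Q by near: Q; exact: nbhs_pinfty_ge.
    by rewrite /count_ratio /Omega /Phi (algebraic_window _ Q0).1 (algebraic_window _ Q0).2.
- exact: ratioR.
Unshelve. all: by end_near. Qed.
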